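(* Let $f$ be a holomorphic function on the upper half-plane $\mathfrak H$ and let $k,n\in\mathbb Z_{\ge0}$. Then $$\vartheta_k^{[n]}(f)=\sum_{r=0}^n\binom nr\,(k+r)_{n-r}\Bigl(-\frac{E_2}{12}\Bigr)^{n-r}D^r(f).$$ Moreover, there exist modular forms $\omega_m\in M_{2m}(SL_2(\mathbb Z))$ $(m\ge0)$, depending only on $m$, with $\omega_0=1$, $\omega_1=0$, $\omega_2=-\frac{E_4}{72}$, $\omega_3=-\frac{E_6}{144}$, $\omega_4=-\frac{E_4^2}{288}$, $\omega_5=-\frac{5E_4E_6}{2592}$, $\omega_6=-\frac{9E_4^3+16E_6^2}{20736}$, $\omega_7=-\frac{35E_4^2E_6}{41472}$, $\omega_8=-\frac{117E_4^4+128E_4E_6^2}{373248}$, such that for all such $f,k,n$ $$\mathcal K_k^n(f)=\sum_{m=0}^n\binom nm\binom{k+n-1}{m}\,\omega_m\,\vartheta_k^{[n-m]}(f).$$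
   Context: $\mathfrak H$ is the complex upper half-plane, $q=e^{2\pi i\tau}$, and $D=\frac1{2\pi i}\frac{d}{d\tau}=q\frac{d}{dq}$. $(x)_m=x(x+1)\cdots(x+m-1)$, $(x)_0=1$. $E_2=1-24\sum_{n\ge1}\frac{nq^n}{1-q^n}$, $E_4=1+240\sum_{n\ge1}\frac{n^3q^n}{1-q^n}$, $E_6=1-504\sum_{n\ge1}\frac{n^5q^n}{1-q^n}$ are the normalized Eisenstein series; $M_k(SL_2(\mathbb Z))$ is the space of holomorphic modular forms of weight $k$ on $SL_2(\mathbb Z)$. For a real number $j$, the Serre derivative is $\vartheta_j(g)=D g-\frac{j}{12}E_2\,g$. The canonical higher Serre derivatives are defined recursively by $\vartheta_k^{[0]}(f)=f$, $\vartheta_k^{[1]}(f)=\vartheta_k(f)$ and $\vartheta_k^{[n+1]}(f)=\vartheta_{k+2n}\bigl(\vartheta_k^{[n]}(f)\bigr)-\frac{n(n+k-1)}{144}E_4\,\vartheta_k^{[n-1]}(f)$ for $n\ge1$. The Rankin–Cohen bracket is $[f,g]_n^{(k,\ell)}=\sum_{i=0}^n(-1)^i\binom{n+k-1}{n-i}\binom{n+\ell-1}{i}D^i(f)D^{n-i}(g)$. The Kaneko–Koike operator is $\mathcal K_k^n(f)=D^n(f)-\frac{k+n-1}{12}[f,E_2]_{n-1}^{(k,2)}$ for $n\ge1$, and $\mathcal K_k^0(f)=f$.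
   Formalization: The Rankin–Cohen bracket is taken with sign (-1)^{n-i} instead of the printed (-1)^i; with the printed sign the second identity fails for even n≥2 (e.g. n=2, k=0: K = D²f + E_2 Df/6, but the right side is D²f − E_2 Df/6). *)

(* Defs.v *)
From Stdlib Require Export Reals ZArith.
From Coquelicot Require Export Coquelicot.

Open Scope C_scope.

(** Functions on the upper half-plane are represented by total functions
    [C -> C] whose values off the half-plane are irrelevant; the half-plane is
    open, so derivatives at its points do not see those values. *)
Definition upper (tau : C) : Prop := (0 < Im tau)%R.

Definition holomorphic (f : C -> C) : Prop :=
  forall tau, upper tau ->
    ex_derive (K := C_AbsRing) (V := C_NormedModule) f tau.

Definition Cexp (z : C) : C :=
  (exp (Re z) * cos (Im z), exp (Re z) * sin (Im z))%R.

(** Convergence in [C] is convergence of the real and imaginary parts. *)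
Definition CSeries (a : nat -> C) : C :=
  (Series (fun n => Re (a n)), Series (fun n => Im (a n))).

Definition nome (tau : C) : C := Cexp (2 * PI * Ci * tau).

(** The sum over m >= 1 of m^p q^m / (1 - q^m); the series index starts at 0. *)
Definition lambert (p : nat) (tau : C) : C :=
  CSeries (fun n =>
    INR (S n) ^ p * nome tau ^ S n / (1 - nome tau ^ S n)).

Definition E2 (tau : C) : C := 1 - 24 * lambert 1 tau.
Definition E4 (tau : C) : C := 1 + 240 * lambert 3 tau.
Definition E6 (tau : C) : C := 1 - 504 * lambert 5 tau.

(** [C_derive] is the complex derivative wherever that exists
    ([C_derive_correct]). *)
Definition D (g : C -> C) : C -> C :=
  fun tau => C_derive g tau / (2 * PI * Ci).

Definition Diter (n : nat) (g : C -> C) : C -> C := Nat.iter n D g.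

Fixpoint pochhammer (x : R) (m : nat) : R :=
  match m with
  | O => 1
  | S m' => pochhammer x m' * (x + INR m')
  end%R.

(** x (x - 1) ... (x - m + 1) / m!.  The top argument can be -1 (for
    k = n = 0) or smaller than m, and [Binomial.C n m] is not 0 for n < m. *)
Fixpoint binom (x : R) (m : nat) : R :=
  match m with
  | O => 1
  | S m' => binom x m' * (x - INR m') / INR (S m')
  end%R.

Definition serre (j : R) (g : C -> C) : C -> C :=
  fun tau => D g tau - (j / 12)%R * E2 tau * g tau.

Fixpoint canonical_serre (k : R) (n : nat) (f : C -> C) : C -> C :=
  match n with
  | O => f
  | S O => serre k f
  | S (S n'' as m) => fun tau =>
      serre (k + 2 * INR m)%R (canonical_serre k m f) tau
      - (INR m * (INR m + k - 1) / 144)%R * E4 tau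
        * canonical_serre k n'' f tau
  end.

(** The sign is (-1)^(n-i), i.e. the number of derivatives falling on [g], so
    that [f,g]_1 = l f' g - k f g'.  This is (-1)^n times the bracket normalised
    with the sign (-1)^i.  It is the normalisation for which [kaneko_koike k 2 f]
    is the Kaneko-Koike operator
    D^2 f - (k+1)/6 E2 D f + k(k+1)/12 (D E2) f;
    with (-1)^i the second and third terms would change sign, and likewise for
    every even order. *)
Definition rankin_cohen (k l : R) (n : nat) (f g : C -> C) : C -> C :=
  fun tau =>
    sum_n (fun i =>
      ((-1) ^ (n - i) * binom (INR n + k - 1) (n - i)
                      * binom (INR n + l - 1) i)%R
      * Diter i f tau * Diter (n - i) g tau) n.

Definition kaneko_koike (k : R) (n : nat) (f : C -> C) : C -> C :=
  match n with
  | O => f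
  | S m => fun tau =>
      Diter n f tau
      - ((k + INR n - 1) / 12)%R * rankin_cohen k 2 m f E2 tau
  end.

(** Holomorphy at the cusp is boundedness of [g] as Im tau tends to infinity. *)
Definition modular_form (w : nat) (g : C -> C) : Prop :=
  holomorphic g /\
  (forall a b c d : Z, (a * d - b * c = 1)%Z ->
     forall tau, upper tau ->
       g ((IZR a * tau + IZR b) / (IZR c * tau + IZR d))
       = (IZR c * tau + IZR d) ^ w * g tau) /\
  (exists B M : R, forall tau, upper tau -> (B <= Im tau)%R ->
     (Cmod (g tau) <= M)%R).

(* Main.v *)
(** Write x = -E2/12.  By Ramanujan's equations D x = -x^2 + E4/144, so the first formula
    follows by induction on n; it also needs that D f is again holomorphic, which is
    obtained from Goursat's theorem and Cauchy's formula on a square.  Expanding both sides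
    of the second formula in the D^r f, it reduces to
    (-1)^j j D^(j-1) E2 / (12 (j!)^2) = sum_m w_m x^(j-m) / (j-m)!  with  w_m = omega_m / (m!)^2,
    and applying D turns this into the recursion
    m (m+1) w_(m+1) = - theta_(2m) w_m - E4/144 w_(m-1).
    Since theta E4 = -E6/3 and theta E6 = -E4^2/2, the omega_m are isobaric polynomials in
    E4 and E6, hence modular.

    Ramanujan's equations are proved by Skoruppa's rearrangement of the quadruple series
    sum g(a, b) q^(a x + b y).  The modularity of E4 and E6 comes from the lattice sums
    sum (m tau + n)^(-k), whose rows are evaluated by the partial fraction expansion of
    sum_n (z + n)^(-k); the latter is the limit of the iterated duplication formula
    2^k R(e(z)) = R(e(z/2)) + R(e((z+1)/2)) for R(Q) = sum_d d^(k-1) Q^d. *)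

Require Import Defs.
From Stdlib Require Import Lra Lia List ClassicalEpsilon Psatz FinFun.
Import ListNotations.

(** * Complex differentiation *)

(** Ramanujan's equations come from the q-series alone, before any modularity is available; the
    rearrangement behind them also yields E4^2 = E8, which the equation for E6 requires. They show
    that the Serre derivative of an isobaric polynomial in E4 and E6 is again one, so the modularity
    of all omega_m reduces to that of the two generators.

    The factor (m!)^2 decouples m from n and k: once it is split off, the coefficient of D^r f on
    the right of the second formula is a factor depending only on n, k and j = n - r times c_j, the
    coefficient of T^j in e^(x T) sum_m w_m T^m. The recursion for w_m is what makes D c_j = - j
    (j+1) c_(j+1), and c_1 = x then generates every derivative of E2 that occurs in the Rankin-Cohen
    bracket.

    All infinite sums are unordered sums over arbitrary index types, since the arguments consist of
    reindexing and interchanging sums over pairs, quadruples and Z. *)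

Notation is_Cderive f z l :=
  (is_derive (K := C_AbsRing) (V := C_NormedModule) f z l).

Notation is_Kderive f z l :=
  (is_derive (K := C_AbsRing) (V := AbsRing_NormedModule C_AbsRing) f z l).

(** The normed-module structures on C that occur here reduce to this one statement about [Cmod], so
    it mediates between them in [is_Cderive_K]; the estimates and path integrals below also start
    from it. *)
Lemma is_Cderive_eps (f : C -> C) (z l : C) :
  is_Cderive f z l <->
  forall eps : R, (0 < eps)%R -> exists delta : R, (0 < delta)%R /\
    forall w, (Cmod (w - z) < delta)%R ->
      (Cmod (f w - f z - (w - z) * l) <= eps * Cmod (w - z))%R.
Proof.
split.
- intros [_ H] eps Heps.
  specialize (H z (fun P HP => HP) (mkposreal eps Heps)).
  destruct H as [d Hd]. exists d; split; [apply cond_pos|].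
  intros w Hw. exact (Hd w Hw).
- intros H. split.
  + exact (is_linear_scal_l (K := C_AbsRing) (V := C_NormedModule) l).
  + intros x Hx eps.
    assert (Hxz : z = x).
    { apply (is_filter_lim_locally_unique (K:=C_AbsRing) (V:=AbsRing_NormedModule C_AbsRing)). exact Hx. }
    subst x.
    destruct (H eps (cond_pos eps)) as [d [Hd Hw]].
    exists (mkposreal d Hd). intros w Hb. exact (Hw w Hb).
Qed.

Lemma is_Kderive_eps (f : C -> C) (z l : C) :
  is_Kderive f z l <->
  forall eps : R, (0 < eps)%R -> exists delta : R, (0 < delta)%R /\
    forall w, (Cmod (w - z) < delta)%R ->
      (Cmod (f w - f z - (w - z) * l) <= eps * Cmod (w - z))%R.
Proof.
split.
- intros [_ H] eps Heps.
  specialize (H z (fun P HP => HP) (mkposreal eps Heps)).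
  destruct H as [d Hd]. exists d; split; [apply cond_pos|].
  intros w Hw. exact (Hd w Hw).
- intros H. split.
  + exact (is_linear_scal_l (K := C_AbsRing) (V := AbsRing_NormedModule C_AbsRing) l).
  + intros x Hx eps.
    assert (Hxz : z = x).
    { apply (is_filter_lim_locally_unique (K:=C_AbsRing) (V:=AbsRing_NormedModule C_AbsRing)). exact Hx. }
    subst x.
    destruct (H eps (cond_pos eps)) as [d [Hd Hw]].
    exists (mkposreal d Hd). intros w Hb. exact (Hw w Hb).
Qed.

(** Coquelicot states the product and chain rules for the normed module
    underlying the ring [C_AbsRing], whose uniform structure differs
    syntactically from the one of [C_NormedModule]. *)
Lemma is_Cderive_K (f : C -> C) (z l : C) : is_Cderive f z l <-> is_Kderive f z l.
Proof. rewrite is_Cderive_eps, is_Kderive_eps. reflexivity. Qed.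

Lemma is_Cderive_mult (f g : C -> C) (z df dg : C) :
  is_Cderive f z df -> is_Cderive g z dg ->
  is_Cderive (fun w => f w * g w) z (df * g z + f z * dg).
Proof.
rewrite !is_Cderive_K. intros Hf Hg.
exact (is_derive_mult (K := C_AbsRing) f g z df dg Hf Hg Cmult_comm).
Qed.

Lemma is_Cderive_comp (f g : C -> C) (z df dg : C) :
  is_Cderive f (g z) df -> is_Cderive g z dg ->
  is_Cderive (fun w => f (g w)) z (dg * df).
Proof.
intros Hf Hg. apply is_Cderive_K in Hg.
exact (is_derive_comp (K := C_AbsRing) (V := C_NormedModule) f g z df dg Hf Hg).
Qed.

Lemma is_Cderive_plus (f g : C -> C) (z df dg : C) :
  is_Cderive f z df -> is_Cderive g z dg ->
  is_Cderive (fun w => f w + g w) z (df + dg).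
Proof. exact (is_derive_plus (K := C_AbsRing) (V := C_NormedModule) f g z df dg). Qed.

Lemma is_Cderive_minus (f g : C -> C) (z df dg : C) :
  is_Cderive f z df -> is_Cderive g z dg ->
  is_Cderive (fun w => f w - g w) z (df - dg).
Proof. exact (is_derive_minus (K := C_AbsRing) (V := C_NormedModule) f g z df dg). Qed.

Lemma is_Cderive_const (c z : C) : is_Cderive (fun _ => c) z (RtoC 0).
Proof. exact (is_derive_const (K := C_AbsRing) (V := C_NormedModule) c z). Qed.

Lemma is_Cderive_id (z : C) : is_Cderive (fun w => w) z (RtoC 1).
Proof. apply is_Cderive_K. exact (is_derive_id (K := C_AbsRing) z). Qed.

Lemma is_Cderive_inv (z : C) : z <> 0 -> is_Cderive (fun w => / w) z (- (/ z * / z)).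
Proof.
intros Hz. apply is_Cderive_eps. intros eps Heps.
assert (Hm := proj1 (Cmod_gt_0 z) Hz).
set (m := Cmod z) in *.
(* The remainder is (w - z)^2 / (w z^2). The first bound keeps |w| > m / 2, the second then makes
   the remainder at most eps |w - z|. *)
exists (Rmin (m / 2) (eps * (m * m * m) / 2)). split.
{ apply Rmin_pos. lra. repeat apply Rmult_lt_0_compat; lra. }
intros w Hw.
assert (H1 : (Cmod (w - z) < m / 2)%R) by (eapply Rlt_le_trans; [exact Hw|apply Rmin_l]).
assert (H2 : (Cmod (w - z) < eps * (m * m * m) / 2)%R) by (eapply Rlt_le_trans; [exact Hw|apply Rmin_r]).
assert (Hw2 : (m / 2 < Cmod w)%R).
{ assert (T := Cmod_triangle w (- (w - z))). rewrite Cmod_opp in T.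
  replace (w + - (w - z)) with z in T by ring. fold m in T. lra. }
assert (Hw0 : w <> 0) by (apply Cmod_gt_0; lra).
replace (/ w - / z - (w - z) * - (/ z * / z)) with ((w - z) * ((w - z) / (w * z * z))) by (field; auto).
rewrite Cmod_mult, Rmult_comm. apply Rmult_le_compat_r; [apply Cmod_ge_0|].
rewrite Cmod_div by (repeat apply Cmult_neq_0; auto).
rewrite !Cmod_mult. fold m.
assert (0 < m * m)%R by nra.
apply Rmult_le_reg_r with (Cmod w * m * m)%R. nra.
unfold Rdiv. rewrite Rmult_assoc, Rinv_l by nra.
assert (m * m * m / 2 <= Cmod w * m * m)%R by nra.
assert (eps * (m * m * m / 2) <= eps * (Cmod w * m * m))%R by (apply Rmult_le_compat_l; lra).
lra.
Qed.

Lemma is_Cderive_ext_loc (f g : C -> C) (z l : C) (r : R) : (0 < r)%R ->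
  (forall w, (Cmod (w - z) < r)%R -> f w = g w) ->
  is_Cderive f z l -> is_Cderive g z l.
Proof.
intros Hr Hfg. apply is_derive_ext_loc. exists (mkposreal r Hr). exact Hfg.
Qed.

Lemma Im_le_Cmod (z : C) : (Rabs (Im z) <= Cmod z)%R.
Proof. eapply Rle_trans; [apply Rmax_r|apply Rmax_Cmod]. Qed.

Lemma Cmod_le_Re_Im (z : C) : (Cmod z <= Rabs (Re z) + Rabs (Im z))%R.
Proof.
unfold Cmod. apply Rsqr_incr_0_var; [|assert (H1 := Rabs_pos (Re z)); assert (H2 := Rabs_pos (Im z)); lra].
rewrite Rsqr_sqrt by nra. unfold Rsqr. unfold Re, Im.
assert (H1 := Rabs_pos (fst z)). assert (H2 := Rabs_pos (snd z)).
assert (H3 := pow2_abs (fst z)). assert (H4 := pow2_abs (snd z)). nra.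
Qed.

Lemma upper_ball (z w : C) : (Cmod (w - z) < Im z)%R -> upper w.
Proof.
intros H. unfold upper.
assert (T := Im_le_Cmod (w - z)). unfold Cminus in *. rewrite im_plus, im_opp in T.
assert (T2 := Rabs_le_between (Im w + - Im z) (Im z)).
destruct (Rabs_def2 (Im w + - Im z) (Im z)); lra.
Qed.

Lemma is_Cderive_ext_upper (f g : C -> C) (z l : C) : upper z ->
  (forall w, upper w -> f w = g w) -> is_Cderive f z l -> is_Cderive g z l.
Proof.
intros Hz Hfg. apply (is_Cderive_ext_loc f g z l (Im z)); [exact Hz|].
intros w Hw. apply Hfg. now apply (upper_ball z).
Qed.

Lemma is_Cderive_eq (f : C -> C) (z l m : C) : is_Cderive f z l -> l = m -> is_Cderive f z m.
Proof. now intros H <-. Qed.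

Ltac cderive :=
  lazymatch goal with
  | |- is_derive (fun _ => ?c) _ _ => apply (is_Cderive_const c)
  | |- is_derive (fun w => w) _ _ => apply is_Cderive_id
  | |- is_derive (fun w => @?f w + @?g w) _ _ => apply (is_Cderive_plus f g); cderive
  | |- is_derive (fun w => @?f w - @?g w) _ _ => apply (is_Cderive_minus f g); cderive
  | |- is_derive (fun w => @?f w * @?g w) _ _ => apply (is_Cderive_mult f g); cderive
  | _ => try eassumption
  end.

(** * Integration along rectangles *)

Definition Ccont (f : C -> C) (z : C) : Prop :=
  forall eps : R, (0 < eps)%R -> exists delta : R, (0 < delta)%R /\
    forall w, (Cmod (w - z) < delta)%R -> (Cmod (f w - f z) < eps)%R.

Lemma is_Cderive_Ccont (f : C -> C) (z l : C) : is_Cderive f z l -> Ccont f z.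
Proof.
intros H eps Heps. destruct (proj1 (is_Cderive_eps f z l) H 1%R Rlt_0_1) as [d [Hd Hw]].
assert (Hl := Cmod_ge_0 l).
assert (Hp : (0 < eps / (2 + Cmod l))%R) by (apply Rdiv_lt_0_compat; lra).
exists (Rmin d (eps / (2 + Cmod l))). split. { now apply Rmin_pos. }
intros w Hwz. assert (H1 := Rmin_l d (eps / (2 + Cmod l))). assert (H2 := Rmin_r d (eps / (2 + Cmod l))).
assert (H3 : (Cmod (w - z) < d)%R) by lra. apply Hw in H3.
replace (f w - f z) with ((f w - f z - (w - z) * l) + (w - z) * l) by ring.
eapply Rle_lt_trans; [apply Cmod_triangle|]. rewrite Cmod_mult.
assert (H4 : (Cmod (w - z) < eps / (2 + Cmod l))%R) by lra.
apply Rlt_div_r in H4; [|lra]. assert (H5 := Cmod_ge_0 (w - z)). nra.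
Qed.

Definition is_CInt (u : R -> C) (a b : R) (l : C) : Prop :=
  is_RInt (fun t => Re (u t)) a b (Re l) /\ is_RInt (fun t => Im (u t)) a b (Im l).

Definition CInt (u : R -> C) (a b : R) : C :=
  (RInt (fun t => Re (u t)) a b, RInt (fun t => Im (u t)) a b).

Definition ex_CInt (u : R -> C) (a b : R) : Prop := exists l, is_CInt u a b l.

Lemma is_CInt_unique (u : R -> C) (a b : R) (l : C) : is_CInt u a b l -> CInt u a b = l.
Proof.
intros [H1 H2]. apply injective_projections; simpl;
apply (is_RInt_unique (V := R_CompleteNormedModule)); assumption.
Qed.

Lemma is_CInt_scal (c : C) (u : R -> C) (a b : R) (l : C) :
  is_CInt u a b l -> is_CInt (fun t => c * u t) a b (c * l).
Proof.
intros [H1 H2]. split.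
- exact (is_RInt_minus _ _ _ _ _ _ (is_RInt_scal _ _ _ (Re c) _ H1) (is_RInt_scal _ _ _ (Im c) _ H2)).
- exact (is_RInt_plus _ _ _ _ _ _ (is_RInt_scal _ _ _ (Re c) _ H2) (is_RInt_scal _ _ _ (Im c) _ H1)).
Qed.

Lemma is_CInt_ext (u v : R -> C) (a b : R) (l : C) : (a <= b)%R ->
  (forall t, (a <= t <= b)%R -> u t = v t) -> is_CInt u a b l -> is_CInt v a b l.
Proof.
intros Hab He [H1 H2]. split; (eapply is_RInt_ext; [|eassumption]); simpl;
rewrite Rmin_left, Rmax_right by lra; intros t Ht; rewrite He; auto; lra.
Qed.

Lemma is_CInt_minus (u v : R -> C) (a b : R) (l m : C) :
  is_CInt u a b l -> is_CInt v a b m -> is_CInt (fun t => u t - v t) a b (l - m).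
Proof.
intros [H1 H2] [H3 H4]. split.
- exact (is_RInt_minus _ _ _ _ _ _ H1 H3).
- exact (is_RInt_minus _ _ _ _ _ _ H2 H4).
Qed.

Lemma is_CInt_Chasles (u : R -> C) (a b c : R) (l m : C) :
  is_CInt u a b l -> is_CInt u b c m -> is_CInt u a c (l + m).
Proof.
intros [H1 H2] [H3 H4]. split.
- exact (is_RInt_Chasles _ _ _ _ _ _ H1 H3).
- exact (is_RInt_Chasles _ _ _ _ _ _ H2 H4).
Qed.

(** The factor 2 comes from bounding the real and the imaginary part separately; the applications
    only need some constant. *)
Lemma is_CInt_bound (u : R -> C) (a b : R) (l : C) (M : R) : (a <= b)%R ->
  (forall t, (a <= t <= b)%R -> (Cmod (u t) <= M)%R) ->
  is_CInt u a b l -> (Cmod l <= 2 * M * (b - a))%R.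
Proof.
intros Hab HM [H1 H2].
assert (T1 := norm_RInt_le_const (V := R_NormedModule) _ a b _ M Hab
   (fun t Ht => Rle_trans _ _ _ (re_le_Cmod (u t)) (HM t Ht)) H1).
assert (T2 := norm_RInt_le_const (V := R_NormedModule) _ a b _ M Hab
   (fun t Ht => Rle_trans _ _ _ (Im_le_Cmod (u t)) (HM t Ht)) H2).
eapply Rle_trans; [apply Cmod_le_Re_Im|].
change (norm (Re l)) with (Rabs (Re l)) in T1. change (norm (Im l)) with (Rabs (Im l)) in T2. lra.
Qed.

Definition path_cont (u : R -> C) (t : R) : Prop :=
  forall eps : R, (0 < eps)%R -> exists delta : R, (0 < delta)%R /\
    forall s, (Rabs (s - t) < delta)%R -> (Cmod (u s - u t) < eps)%R.

Lemma path_cont_Re (u : R -> C) (t : R) : path_cont u t -> continuous (fun s => Re (u s)) t.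
Proof.
intros H. apply (proj2 (filterlim_locally (fun s => Re (u s)) (Re (u t)))). intros eps.
destruct (H eps (cond_pos eps)) as [d [Hd Hs]].
exists (mkposreal d Hd). intros s Hst. apply Hs in Hst.
change (Rabs (Re (u s) - Re (u t)) < eps)%R.
eapply Rle_lt_trans; [|exact Hst]. exact (re_le_Cmod (u s - u t)).
Qed.

Lemma path_cont_Im (u : R -> C) (t : R) : path_cont u t -> continuous (fun s => Im (u s)) t.
Proof.
intros H. apply (proj2 (filterlim_locally (fun s => Im (u s)) (Im (u t)))). intros eps.
destruct (H eps (cond_pos eps)) as [d [Hd Hs]].
exists (mkposreal d Hd). intros s Hst. apply Hs in Hst.
change (Rabs (Im (u s) - Im (u t)) < eps)%R.
eapply Rle_lt_trans; [|exact Hst]. exact (Im_le_Cmod (u s - u t)).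
Qed.

Lemma ex_CInt_cont (u : R -> C) (a b : R) : (a <= b)%R ->
  (forall t, (a <= t <= b)%R -> path_cont u t) -> ex_CInt u a b.
Proof.
intros Hab H.
destruct (ex_RInt_continuous (V := R_CompleteNormedModule) (fun t => Re (u t)) a b) as [l1 H1].
{ rewrite Rmin_left, Rmax_right by lra. intros t Ht. now apply path_cont_Re, H. }
destruct (ex_RInt_continuous (V := R_CompleteNormedModule) (fun t => Im (u t)) a b) as [l2 H2].
{ rewrite Rmin_left, Rmax_right by lra. intros t Ht. now apply path_cont_Im, H. }
exists (l1, l2). split; assumption.
Qed.

Lemma Cmod_hor (x y t : R) : Cmod ((x, y) - (t, y)) = Rabs (x - t).
Proof.
replace ((x, y) - (t, y)) with (RtoC (x - t)). apply Cmod_R.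
apply injective_projections; simpl; ring.
Qed.

Lemma Cmod_ver (x y t : R) : Cmod ((x, y) - (x, t)) = Rabs (y - t).
Proof.
replace ((x, y) - (x, t)) with (Ci * RtoC (y - t)). rewrite Cmod_mult, Cmod_R, Cmod_Ci. ring.
apply injective_projections; simpl; ring.
Qed.

Lemma Ccont_hor (f : C -> C) (y t : R) : Ccont f (t, y) -> path_cont (fun s => f (s, y)) t.
Proof.
intros H eps Heps. destruct (H eps Heps) as [d [Hd Hw]]. exists d; split; [exact Hd|].
intros s Hs. apply Hw. now rewrite Cmod_hor.
Qed.

Lemma Ccont_ver (f : C -> C) (x t : R) : Ccont f (x, t) -> path_cont (fun s => f (x, s)) t.
Proof.
intros H eps Heps. destruct (H eps Heps) as [d [Hd Hw]]. exists d; split; [exact Hd|].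
intros s Hs. apply Hw. now rewrite Cmod_ver.
Qed.

(** Counterclockwise boundary integral; the vertical sides carry the factor i of dz = i dt. Being a
    relation, it also records that f is integrable along the four sides. *)
Definition is_rect (f : C -> C) (x1 x2 y1 y2 : R) (l : C) : Prop :=
  exists b r t s,
    is_CInt (fun t => f (t, y1)) x1 x2 b /\ is_CInt (fun t => f (x2, t)) y1 y2 r /\
    is_CInt (fun t => f (t, y2)) x1 x2 t /\ is_CInt (fun t => f (x1, t)) y1 y2 s /\
    l = b + Ci * r - t - Ci * s.

Definition bd (x1 x2 y1 y2 : R) (z : C) : Prop :=
  ((x1 <= Re z <= x2 /\ (Im z = y1 \/ Im z = y2)) \/
   (y1 <= Im z <= y2 /\ (Re z = x1 \/ Re z = x2)))%R.

Section rect.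
Variables x1 x2 y1 y2 : R.
Hypothesis Hx : (x1 <= x2)%R.
Hypothesis Hy : (y1 <= y2)%R.

Lemma bd_b t : (x1 <= t <= x2)%R -> bd x1 x2 y1 y2 (t, y1).
Proof. intros H; left; split; [exact H|left; reflexivity]. Qed.
Lemma bd_t t : (x1 <= t <= x2)%R -> bd x1 x2 y1 y2 (t, y2).
Proof. intros H; left; split; [exact H|right; reflexivity]. Qed.
Lemma bd_l t : (y1 <= t <= y2)%R -> bd x1 x2 y1 y2 (x1, t).
Proof. intros H; right; split; [exact H|left; reflexivity]. Qed.
Lemma bd_r t : (y1 <= t <= y2)%R -> bd x1 x2 y1 y2 (x2, t).
Proof. intros H; right; split; [exact H|right; reflexivity]. Qed.

Lemma ex_rect (f : C -> C) : (forall z, bd x1 x2 y1 y2 z -> Ccont f z) ->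
  exists l, is_rect f x1 x2 y1 y2 l.
Proof.
intros H.
destruct (ex_CInt_cont (fun t => f (t, y1)) x1 x2 Hx) as [b Hb].
{ intros t Ht. now apply Ccont_hor, H, bd_b. }
destruct (ex_CInt_cont (fun t => f (t, y2)) x1 x2 Hx) as [t Ht].
{ intros s Hs. now apply Ccont_hor, H, bd_t. }
destruct (ex_CInt_cont (fun t => f (x1, t)) y1 y2 Hy) as [s Hs].
{ intros u Hu. now apply Ccont_ver, H, bd_l. }
destruct (ex_CInt_cont (fun t => f (x2, t)) y1 y2 Hy) as [r Hr].
{ intros u Hu. now apply Ccont_ver, H, bd_r. }
exists (b + Ci * r - t - Ci * s), b, r, t, s. auto.
Qed.

Lemma is_rect_unique (f : C -> C) (l m : C) :
  is_rect f x1 x2 y1 y2 l -> is_rect f x1 x2 y1 y2 m -> l = m.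
Proof.
intros (b & r & t & s & H1 & H2 & H3 & H4 & ->) (b' & r' & t' & s' & H1' & H2' & H3' & H4' & ->).
apply is_CInt_unique in H1, H2, H3, H4, H1', H2', H3', H4'. subst. reflexivity.
Qed.

Lemma is_rect_ext (f g : C -> C) (l : C) : (forall z, bd x1 x2 y1 y2 z -> f z = g z) ->
  is_rect f x1 x2 y1 y2 l -> is_rect g x1 x2 y1 y2 l.
Proof.
intros He (b & r & t & s & H1 & H2 & H3 & H4 & ->).
exists b, r, t, s. split; [|split; [|split; [|split; [|reflexivity]]]];
(eapply is_CInt_ext; [assumption| |eassumption]); intros u Hu; apply He.
- now apply bd_b.
- now apply bd_r.
- now apply bd_t.
- now apply bd_l.
Qed.

Lemma is_rect_minus (f g : C -> C) (l m : C) :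
  is_rect f x1 x2 y1 y2 l -> is_rect g x1 x2 y1 y2 m ->
  is_rect (fun z => f z - g z) x1 x2 y1 y2 (l - m).
Proof.
intros (b & r & t & s & H1 & H2 & H3 & H4 & ->) (b' & r' & t' & s' & H1' & H2' & H3' & H4' & ->).
exists (b - b'), (r - r'), (t - t'), (s - s').
repeat (split; [now apply is_CInt_minus|]). ring.
Qed.

Lemma is_rect_scal (c : C) (f : C -> C) (l : C) :
  is_rect f x1 x2 y1 y2 l -> is_rect (fun z => c * f z) x1 x2 y1 y2 (c * l).
Proof.
intros (b & r & t & s & H1 & H2 & H3 & H4 & ->).
exists (c * b), (c * r), (c * t), (c * s).
repeat (split; [now apply is_CInt_scal|]). ring.
Qed.

Lemma is_rect_bound (f : C -> C) (l : C) (M : R) :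
  (forall z, bd x1 x2 y1 y2 z -> (Cmod (f z) <= M)%R) ->
  is_rect f x1 x2 y1 y2 l -> (Cmod l <= 4 * M * ((x2 - x1) + (y2 - y1)))%R.
Proof.
intros HM (b & r & t & s & H1 & H2 & H3 & H4 & ->).
apply (is_CInt_bound _ _ _ _ M Hx (fun u Hu => HM _ (bd_b u Hu))) in H1.
apply (is_CInt_bound _ _ _ _ M Hy (fun u Hu => HM _ (bd_r u Hu))) in H2.
apply (is_CInt_bound _ _ _ _ M Hx (fun u Hu => HM _ (bd_t u Hu))) in H3.
apply (is_CInt_bound _ _ _ _ M Hy (fun u Hu => HM _ (bd_l u Hu))) in H4.
unfold Cminus.
assert (T1 := Cmod_triangle (b + Ci * r + - t) (- (Ci * s))).
assert (T2 := Cmod_triangle (b + Ci * r) (- t)).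
assert (T3 := Cmod_triangle b (Ci * r)).
rewrite !Cmod_opp, !Cmod_mult, !Cmod_Ci in *. lra.
Qed.

End rect.

(** The common side is traversed in both directions; uniqueness of the integral identifies the two
    values, which cancel. *)
Lemma is_rect_split_x (f : C -> C) (x1 x2 x3 y1 y2 : R) (l m : C) :
  is_rect f x1 x2 y1 y2 l -> is_rect f x2 x3 y1 y2 m -> is_rect f x1 x3 y1 y2 (l + m).
Proof.
intros (b & r & t & s & H1 & H2 & H3 & H4 & ->) (b' & r' & t' & s' & H1' & H2' & H3' & H4' & ->).
exists (b + b'), r', (t + t'), s.
split; [now apply (is_CInt_Chasles _ x1 x2 x3)|]. split; [assumption|].
split; [now apply (is_CInt_Chasles _ x1 x2 x3)|]. split; [assumption|].
apply is_CInt_unique in H2, H4'. rewrite <- H2, <- H4'. ring.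
Qed.

Lemma is_rect_split_y (f : C -> C) (x1 x2 y1 y2 y3 : R) (l m : C) :
  is_rect f x1 x2 y1 y2 l -> is_rect f x1 x2 y2 y3 m -> is_rect f x1 x2 y1 y3 (l + m).
Proof.
intros (b & r & t & s & H1 & H2 & H3 & H4 & ->) (b' & r' & t' & s' & H1' & H2' & H3' & H4' & ->).
exists b, (r + r'), t', (s + s').
split; [assumption|]. split; [now apply (is_CInt_Chasles _ y1 y2 y3)|].
split; [assumption|]. split; [now apply (is_CInt_Chasles _ y1 y2 y3)|].
apply is_CInt_unique in H1', H3. rewrite <- H3, <- H1'. ring.
Qed.

Lemma path_deriv_Re (F : R -> C) (l : C) (t : R) :
  (forall eps : R, (0 < eps)%R -> exists delta : R, (0 < delta)%R /\
    forall s, (Rabs (s - t) < delta)%R ->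
     (Cmod (F s - F t - RtoC (s - t) * l) <= eps * Rabs (s - t))%R) ->
  is_derive (fun s => Re (F s)) t (Re l) /\ is_derive (fun s => Im (F s)) t (Im l).
Proof.
intros H. split; (split; [apply is_linear_scal_l|]);
(intros x Hx; assert (Hxz : t = x) by (apply (is_filter_lim_locally_unique (K:=R_AbsRing) (V:=R_NormedModule)); exact Hx); subst x);
intros eps; destruct (H eps (cond_pos eps)) as [d [Hd Hw]]; exists (mkposreal d Hd);
intros s Hs; specialize (Hw s Hs); eapply Rle_trans; try exact Hw.
- change (Rabs (Re (F s) - Re (F t) - (s - t) * Re l) <= Cmod (F s - F t - (s - t)%R * l))%R.
  replace (Re (F s) - Re (F t) - (s - t) * Re l)%R with (Re (F s - F t - RtoC (s - t) * l)) by (simpl; unfold Re; ring).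
  apply re_le_Cmod.
- change (Rabs (Im (F s) - Im (F t) - (s - t) * Im l) <= Cmod (F s - F t - (s - t)%R * l))%R.
  replace (Im (F s) - Im (F t) - (s - t) * Im l)%R with (Im (F s - F t - RtoC (s - t) * l)) by (simpl; unfold Im; ring).
  apply Im_le_Cmod.
Qed.

Lemma is_CInt_FTC (F u : R -> C) (a b : R) : (a <= b)%R ->
  (forall t, (a <= t <= b)%R -> path_cont u t) ->
  (forall t, (a <= t <= b)%R -> forall eps : R, (0 < eps)%R -> exists delta : R, (0 < delta)%R /\
    forall s, (Rabs (s - t) < delta)%R ->
     (Cmod (F s - F t - RtoC (s - t) * u t) <= eps * Rabs (s - t))%R) ->
  is_CInt u a b (F b - F a).
Proof.
intros Hab Hc Hd. split.
- apply (is_RInt_derive (V := R_CompleteNormedModule) (fun s => Re (F s)) (fun s => Re (u s))); rewrite Rmin_left, Rmax_right by lra; intros t Ht.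
  + now apply path_deriv_Re, Hd.
  + now apply path_cont_Re, Hc.
- apply (is_RInt_derive (V := R_CompleteNormedModule) (fun s => Im (F s)) (fun s => Im (u s))); rewrite Rmin_left, Rmax_right by lra; intros t Ht.
  + now apply path_deriv_Re, Hd.
  + now apply path_cont_Im, Hc.
Qed.

(** The fundamental theorem on each side gives differences of F at the corners, which telescope
    around the boundary. *)
Lemma is_rect_primitive (F f : C -> C) (x1 x2 y1 y2 : R) : (x1 <= x2)%R -> (y1 <= y2)%R ->
  (forall z, bd x1 x2 y1 y2 z -> Ccont f z) ->
  (forall z, bd x1 x2 y1 y2 z -> is_Cderive F z (f z)) ->
  is_rect f x1 x2 y1 y2 0.
Proof.
intros Hx Hy Hc Hd.
assert (Hh : forall y, (forall t, (x1 <= t <= x2)%R -> bd x1 x2 y1 y2 (t, y)) ->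
  is_CInt (fun t => f (t, y)) x1 x2 (F (x2, y) - F (x1, y))).
{ intros y Hbd. apply (is_CInt_FTC (fun t => F (t, y))); [exact Hx|..]; intros t Ht.
  - now apply Ccont_hor, Hc, Hbd.
  - intros eps Heps. destruct (proj1 (is_Cderive_eps _ _ _) (Hd _ (Hbd t Ht)) eps Heps) as [d [Hd0 Hw]].
    exists d; split; [exact Hd0|]. intros s Hs. specialize (Hw (s, y)). rewrite !Cmod_hor in Hw.
    specialize (Hw Hs). replace (RtoC (s - t)) with ((s, y) - (t, y)); [exact Hw|].
    apply injective_projections; simpl; ring. }
(* On a vertical side dz = i dt, so - i F is the primitive in the real parameter. *)
assert (Hv : forall x, (forall t, (y1 <= t <= y2)%R -> bd x1 x2 y1 y2 (x, t)) ->
  is_CInt (fun t => f (x, t)) y1 y2 ((- Ci) * (F (x, y2) - F (x, y1)))).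
{ intros x Hbd. replace (- Ci * (F (x, y2) - F (x, y1))) with (- Ci * F (x, y2) - (- Ci * F (x, y1))) by ring.
  apply (is_CInt_FTC (fun t => - Ci * F (x, t))); [exact Hy|..]; intros t Ht.
  - now apply Ccont_ver, Hc, Hbd.
  - intros eps Heps. destruct (proj1 (is_Cderive_eps _ _ _) (Hd _ (Hbd t Ht)) eps Heps) as [d [Hd0 Hw]].
    exists d; split; [exact Hd0|]. intros s Hs. specialize (Hw (x, s)). rewrite !Cmod_ver in Hw.
    specialize (Hw Hs).
    assert (HCi : Ci * Ci = - (1)) by (apply injective_projections; simpl; ring).
    replace (RtoC (s - t)) with (- Ci * ((x, s) - (x, t))) by (apply injective_projections; simpl; ring).
    match goal with |- (Cmod ?e <= _)%R => replace e with (- Ci * (F (x, s) - F (x, t) - ((x, s) - (x, t)) * f (x, t))) by ring end.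
    rewrite Cmod_mult, Cmod_opp, Cmod_Ci, Rmult_1_l. exact Hw. }
eexists _, _, _, _. split; [apply Hh; intros; now apply bd_b|]. split; [apply Hv; intros; now apply bd_r|].
split; [apply Hh; intros; now apply bd_t|]. split; [apply Hv; intros; now apply bd_l|].
assert (HCi : Ci * Ci = - (1)) by (apply injective_projections; simpl; ring).
transitivity (F (x2, y1) - F (x1, y1) - Ci * Ci * (F (x2, y2) - F (x2, y1)) - (F (x2, y2) - F (x1, y2)) + Ci * Ci * (F (x1, y2) - F (x1, y1))).
rewrite HCi; ring. ring.
Qed.

(** * Goursat's theorem and Cauchy's formula *)

(** The intervals [u n, u n + w / 2^n] are nested, since each step moves the left end by at most
    half of the current width; the supremum of the left ends lies in all of them. *)
Lemma dyadic_nested (u : nat -> R) (w : R) : (0 <= w)%R ->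
  (forall n, (u n <= u (S n) <= u n + w / 2 ^ S n)%R) ->
  exists l, forall n, (u n <= l <= u n + w / 2 ^ n)%R.
Proof.
intros Hw Hu.
assert (Hp : forall n, (0 < 2 ^ n)%R) by (intros; apply pow_lt; lra).
assert (Hd : forall n k, (u n <= u (n + k)%nat <= u n + w / 2 ^ n - w / 2 ^ (n + k))%R).
{ intros n k. induction k.
  - rewrite Nat.add_0_r. lra.
  - rewrite Nat.add_succ_r. specialize (Hu (n + k)%nat).
    replace (w / 2 ^ (n + k))%R with (2 * (w / 2 ^ S (n + k)))%R in IHk.
    2:{ simpl. field. apply Rgt_not_eq, Hp. }
    lra. }
assert (Hle : forall n m, (u m <= u n + w / 2 ^ n)%R).
{ intros n m. destruct (Nat.le_ge_cases n m) as [H|H].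
  - specialize (Hd n (m - n)%nat). replace (n + (m - n))%nat with m in Hd by lia.
    assert (0 <= w / 2 ^ m)%R. { apply Rle_mult_inv_pos; auto. } lra.
  - specialize (Hd m (n - m)%nat). replace (m + (n - m))%nat with n in Hd by lia.
    assert (0 <= w / 2 ^ n)%R. { apply Rle_mult_inv_pos; auto. } lra. }
destruct (completeness (fun x => exists n, x = u n)) as [l [H1 H2]].
- exists (u 0%nat + w / 2 ^ 0)%R. intros x [m ->]. apply Hle.
- exists (u 0%nat). now exists 0%nat.
- exists l. intros n. split.
  + apply H1. now exists n.
  + apply H2. intros x [m ->]. apply Hle.
Qed.

Lemma small_dyadic (a d : R) : (0 < d)%R -> exists n, (a / 2 ^ n < d)%R.
Proof.
intros Hd. destruct (Rle_lt_dec a 0) as [Ha|Ha].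
{ exists 0%nat. simpl. lra. }
destruct (pow_lt_1_zero (1/2) ltac:(rewrite Rabs_pos_eq; lra) (d / a) ltac:(apply Rdiv_lt_0_compat; lra)) as [n Hn].
exists n. specialize (Hn n (le_n n)). rewrite Rabs_pos_eq in Hn by (apply pow_le; lra).
replace (1/2)%R with (/2)%R in Hn by lra. rewrite pow_inv in Hn. apply Rlt_div_r in Hn; [|lra].
unfold Rdiv. lra.
Qed.

(** * Goursat's subdivision argument *)

Section goursat.
Variable f : C -> C.
Variables x0 y0 w h : R.
Hypothesis Hw : (0 < w)%R.
Hypothesis Hh : (0 < h)%R.
Hypothesis Hdiff : forall z, (x0 <= Re z <= x0 + w)%R -> (y0 <= Im z <= y0 + h)%R ->
  exists l, is_Cderive f z l.

Let quad (p : R * R) (n : nat) (l : C) : Prop :=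
  is_rect f (fst p) (fst p + w / 2 ^ n) (snd p) (snd p + h / 2 ^ n) l.

Let inside (p : R * R) (n : nat) : Prop :=
  (x0 <= fst p /\ fst p + w / 2 ^ n <= x0 + w /\ y0 <= snd p /\ snd p + h / 2 ^ n <= y0 + h)%R.

(** The invariant of the subdivision. Its threshold shrinks by 4 per generation, like the product of
    diameter and perimeter that bounds the error of an affine approximation. *)
Let big (K : R) (p : R * R) (n : nat) : Prop :=
  inside p n /\ exists l, quad p n l /\ (K / 4 ^ n < Cmod l)%R.

(** The integrals over the four quarters add up to the whole, so they cannot all stay within a
    quarter of the threshold. *)
Lemma quarter (K : R) (p : R * R) (n : nat) : big K p n ->
  exists q, big K q (S n) /\ (fst p <= fst q <= fst p + w / 2 ^ S n)%R /\
    (snd p <= snd q <= snd p + h / 2 ^ S n)%R.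
Proof.
intros [Hin [l [Hq Hl]]]. apply NNPP. intros Hno.
assert (Hp : (0 < 2 ^ n)%R) by (apply pow_lt; lra).
assert (Hp4 : (0 < 4 ^ n)%R) by (apply pow_lt; lra).
destruct p as [x y]. unfold inside, quad in *. simpl fst in *. simpl snd in *.
set (w1 := (w / 2 ^ S n)%R) in *. set (h1 := (h / 2 ^ S n)%R) in *.
assert (Ew : (w / 2 ^ n = w1 + w1)%R) by (unfold w1; simpl; field; lra).
assert (Eh : (h / 2 ^ n = h1 + h1)%R) by (unfold h1; simpl; field; lra).
assert (Hw1 : (0 < w1)%R). { apply Rdiv_lt_0_compat; [lra|apply pow_lt; lra]. }
assert (Hh1 : (0 < h1)%R). { apply Rdiv_lt_0_compat; [lra|apply pow_lt; lra]. }
rewrite Ew, Eh in *.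
assert (Hs : forall a b, (x <= a <= x + w1)%R -> (y <= b <= y + h1)%R ->
  exists m, is_rect f a (a + w1) b (b + h1) m /\ (Cmod m <= K / 4 ^ S n)%R).
{ intros a b Ha Hb.
  destruct (ex_rect a (a + w1) b (b + h1) ltac:(lra) ltac:(lra) f) as [m Hm].
  { intros z Hz. destruct (Hdiff z) as [d Hd]; try (destruct Hz; lra).
    now apply is_Cderive_Ccont in Hd. }
  exists m. split; [exact Hm|]. apply Rnot_lt_le. intros Hlt. apply Hno.
  exists (a, b). simpl fst; simpl snd. split; [|split; assumption].
  split; simpl fst; simpl snd. fold w1 h1. lra. exists m. split; assumption. }
destruct (Hs x y) as [m1 [R1 B1]]; try lra.
destruct (Hs (x + w1)%R y) as [m2 [R2 B2]]; try lra.
destruct (Hs x (y + h1)%R) as [m3 [R3 B3]]; try lra.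
destruct (Hs (x + w1)%R (y + h1)%R) as [m4 [R4 B4]]; try lra.
assert (Hsum := is_rect_split_y _ _ _ _ _ _ _ _ (is_rect_split_x _ _ _ _ _ _ _ _ R1 R2) (is_rect_split_x _ _ _ _ _ _ _ _ R3 R4)).
rewrite !Rplus_assoc in Hsum.
rewrite (is_rect_unique _ _ _ _ _ _ _ Hq Hsum) in Hl.
assert (T1 := Cmod_triangle (m1 + m2) (m3 + m4)).
assert (T2 := Cmod_triangle m1 m2). assert (T3 := Cmod_triangle m3 m4).
replace (K / 4 ^ S n)%R with (K / 4 ^ n / 4)%R in * by (simpl; field; lra). lra.
Qed.

Lemma goursat_bound (l : C) (K : R) : (0 < K)%R ->
  is_rect f x0 (x0 + w) y0 (y0 + h) l -> (Cmod l <= K)%R.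
Proof.
intros HK Hl. apply Rnot_lt_le. intros Hlt.
assert (H0 : big K (x0, y0) 0).
{ split. unfold inside; simpl; lra. exists l. unfold quad; simpl. rewrite !Rdiv_1_r. split; assumption. }
(* Dependent choice: each rectangle is carried together with its proof of [big], from which the next
   one is extracted. *)
pose (step := fun (n : nat) (P : {p | big K p n}) =>
  let q := constructive_indefinite_description _ (quarter K (proj1_sig P) n (proj2_sig P)) in
  exist (fun p => big K p (S n)) (proj1_sig q) (proj1 (proj2_sig q))).
pose (sq := fix sq (n : nat) : {p | big K p n} :=
  match n with O => exist _ (x0, y0) H0 | S m => step m (sq m) end).
assert (Hstep : forall n, (fst (proj1_sig (sq n)) <= fst (proj1_sig (sq (S n))) <= fst (proj1_sig (sq n)) + w / 2 ^ S n)%R /\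
   (snd (proj1_sig (sq n)) <= snd (proj1_sig (sq (S n))) <= snd (proj1_sig (sq n)) + h / 2 ^ S n)%R).
{ intros n. change (sq (S n)) with (step n (sq n)). unfold step. cbv zeta.
  destruct (constructive_indefinite_description _ _) as [q [H1 H2]]. exact H2. }
destruct (dyadic_nested (fun n => fst (proj1_sig (sq n))) w ltac:(lra) (fun n => proj1 (Hstep n))) as [cx Hcx].
destruct (dyadic_nested (fun n => snd (proj1_sig (sq n))) h ltac:(lra) (fun n => proj2 (Hstep n))) as [cy Hcy].
destruct (Hdiff (cx, cy)) as [d Hd].
{ specialize (Hcx 0%nat). simpl in *. lra. }
{ specialize (Hcy 0%nat). simpl in *. lra. }
set (s := (w + h)%R). assert (Hs : (0 < s)%R) by (unfold s; lra).
(* With this tolerance [is_rect_bound] yields 4 (K / (8 s^2)) (s / 2^n)^2, which is half of the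
   threshold K / 4^n. *)
destruct (proj1 (is_Cderive_eps _ _ _) Hd (K / (8 * s * s))%R) as [r [Hr Hder]].
{ apply Rdiv_lt_0_compat; nra. }
destruct (small_dyadic s r Hr) as [n Hn].
specialize (Hcx n). specialize (Hcy n). simpl in Hcx, Hcy.
destruct (proj2_sig (sq n)) as [Hin [m [Hm Hbig]]].
set (p := proj1_sig (sq n)) in *. clearbody p.
assert (Hp : (0 < 2 ^ n)%R) by (apply pow_lt; lra).
assert (Hwn : (0 < w / 2 ^ n)%R) by (apply Rdiv_lt_0_compat; lra).
assert (Hhn : (0 < h / 2 ^ n)%R) by (apply Rdiv_lt_0_compat; lra).
assert (Es : (w / 2 ^ n + h / 2 ^ n = s / 2 ^ n)%R) by (unfold s; field; lra).
unfold quad in Hm.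
(* The affine approximation has a quadratic primitive, so subtracting it leaves the boundary
   integral unchanged. *)
assert (Haff : is_rect (fun z => f (cx, cy) + (z - (cx, cy)) * d) (fst p) (fst p + w / 2 ^ n) (snd p) (snd p + h / 2 ^ n) 0).
{ assert (HD : forall z, is_Cderive (fun z => f (cx, cy) + (z - (cx, cy)) * d) z d).
  { intros z. eapply is_Cderive_eq; [cderive|ring]. }
  apply (is_rect_primitive (fun z => f (cx, cy) * z + (z - (cx, cy)) * (z - (cx, cy)) * (d / 2))); try lra.
  - intros z _. exact (is_Cderive_Ccont _ _ _ (HD z)).
  - intros z _. eapply is_Cderive_eq; [cderive|field]. }
assert (Hdif := is_rect_minus _ _ _ _ _ _ _ _ Hm Haff).
apply (is_rect_bound (fst p) (fst p + w / 2 ^ n) (snd p) (snd p + h / 2 ^ n) ltac:(lra) ltac:(lra) _ _ (K / (8 * s * s) * (s / 2 ^ n))%R) in Hdif.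
- replace (m - 0) with m in Hdif by ring.
  replace (fst p + w / 2 ^ n - fst p + (snd p + h / 2 ^ n - snd p))%R with (s / 2 ^ n)%R in Hdif by lra.
  replace (4 * (K / (8 * s * s) * (s / 2 ^ n)) * (s / 2 ^ n))%R with (K / 4 ^ n / 2)%R in Hdif.
  2:{ replace 4%R with (2 * 2)%R at 1 by lra. rewrite Rpow_mult_distr. field. lra. }
  assert (0 < K / 4 ^ n)%R. { apply Rdiv_lt_0_compat; [lra|apply pow_lt; lra]. } lra.
- intros z Hz.
  assert (Hzc : (Cmod (z - (cx, cy)) <= s / 2 ^ n)%R).
  { eapply Rle_trans; [apply Cmod_le_Re_Im|]. rewrite <- Es.
    assert (E1 : Re (z - (cx, cy)) = (Re z - cx)%R) by (simpl; unfold Re; ring).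
    assert (E2 : Im (z - (cx, cy)) = (Im z - cy)%R) by (simpl; unfold Im; ring).
    rewrite E1, E2. apply Rplus_le_compat; apply Rabs_le; destruct Hz as [Hz|Hz]; lra. }
  replace (f z - (f (cx, cy) + (z - (cx, cy)) * d)) with (f z - f (cx, cy) - (z - (cx, cy)) * d) by ring.
  eapply Rle_trans; [apply Hder; lra|]. apply Rmult_le_compat_l; [|exact Hzc].
  apply Rlt_le, Rdiv_lt_0_compat; nra.
Qed.
End goursat.

Lemma goursat (f : C -> C) (x1 x2 y1 y2 : R) (l : C) : (x1 < x2)%R -> (y1 < y2)%R ->
  (forall z, (x1 <= Re z <= x2)%R -> (y1 <= Im z <= y2)%R -> exists l, is_Cderive f z l) ->
  is_rect f x1 x2 y1 y2 l -> l = 0.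
Proof.
intros Hx Hy Hd Hl. apply Cmod_eq_0. apply Rle_antisym; [|apply Cmod_ge_0].
apply Rle_plus_epsilon. intros K HK. rewrite Rplus_0_l.
replace x2 with (x1 + (x2 - x1))%R in Hl, Hd by ring. replace y2 with (y1 + (y2 - y1))%R in Hl, Hd by ring.
apply (goursat_bound f x1 y1 (x2 - x1) (y2 - y1)); auto; lra.
Qed.

(** This serves the difference quotient at a. Four rectangles around a small square centred at a
    have integral zero, and the square contributes little because f is bounded near a. *)
Lemma goursat_except (f : C -> C) (a : C) (x1 x2 y1 y2 : R) (l : C) :
  (x1 < Re a < x2)%R -> (y1 < Im a < y2)%R -> Ccont f a ->
  (forall z, (x1 <= Re z <= x2)%R -> (y1 <= Im z <= y2)%R -> z <> a -> exists l, is_Cderive f z l) ->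
  is_rect f x1 x2 y1 y2 l -> l = 0.
Proof.
intros Hx Hy Hc Hd Hl. apply Cmod_eq_0. apply Rle_antisym; [|apply Cmod_ge_0].
apply Rle_plus_epsilon. intros K HK. rewrite Rplus_0_l.
destruct (Hc 1%R Rlt_0_1) as [r [Hr Hfa]].
set (M := (Cmod (f a) + 1)%R). assert (HM : (0 < M)%R). { assert (T := Cmod_ge_0 (f a)). unfold M; lra. }
set (ax := Re a) in *. set (ay := Im a) in *.
(* e is the half-side of the square. 2 e < r keeps it where |f| is below M, and [is_rect_bound] then
   gives 4 M (2 e + 2 e) = 16 M e. *)
assert (Hm : exists e, (0 < e /\ x1 < ax - e /\ ax + e < x2 /\ y1 < ay - e /\ ay + e < y2 /\ 2 * e < r /\ 16 * M * e <= K)%R).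
{ exists (Rmin (Rmin (Rmin ((ax - x1) / 2) ((x2 - ax) / 2)) (Rmin ((ay - y1) / 2) ((y2 - ay) / 2))) (Rmin (r / 4) (K / (16 * M)))).
  set (e := Rmin _ _).
  assert (He : (0 < e)%R). { unfold e. repeat apply Rmin_pos; try lra. apply Rdiv_lt_0_compat; lra. }
  assert (A1 : (e <= (ax - x1) / 2)%R) by (unfold e; eapply Rle_trans; [apply Rmin_l|]; eapply Rle_trans; [apply Rmin_l|]; apply Rmin_l).
  assert (A2 : (e <= (x2 - ax) / 2)%R) by (unfold e; eapply Rle_trans; [apply Rmin_l|]; eapply Rle_trans; [apply Rmin_l|]; apply Rmin_r).
  assert (A3 : (e <= (ay - y1) / 2)%R) by (unfold e; eapply Rle_trans; [apply Rmin_l|]; eapply Rle_trans; [apply Rmin_r|]; apply Rmin_l).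
  assert (A4 : (e <= (y2 - ay) / 2)%R) by (unfold e; eapply Rle_trans; [apply Rmin_l|]; eapply Rle_trans; [apply Rmin_r|]; apply Rmin_r).
  assert (A5 : (e <= r / 4)%R) by (unfold e; eapply Rle_trans; [apply Rmin_r|]; apply Rmin_l).
  assert (A6 : (e <= K / (16 * M))%R) by (unfold e; eapply Rle_trans; [apply Rmin_r|]; apply Rmin_r).
  apply Rle_div_r in A6; [|lra]. lra. }
destruct Hm as (e & He & E1 & E2 & E3 & E4 & E5 & E6).
assert (Hcont : forall z, (x1 <= Re z <= x2)%R -> (y1 <= Im z <= y2)%R -> Ccont f z).
{ intros z Hzx Hzy. destruct (excluded_middle_informative (z = a)) as [->|Hne]; [exact Hc|].
  destruct (Hd z Hzx Hzy Hne) as [d D]. exact (is_Cderive_Ccont _ _ _ D). }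
assert (Hex : forall u v s t, (x1 <= u)%R -> (u < v)%R -> (v <= x2)%R -> (y1 <= s)%R -> (s < t)%R -> (t <= y2)%R ->
  exists m, is_rect f u v s t m /\ ((v < ax \/ ax < u \/ t < ay \/ ay < s)%R -> m = 0)).
{ intros u v s t U1 U2 U3 U4 U5 U6. destruct (ex_rect u v s t (Rlt_le _ _ U2) (Rlt_le _ _ U5) f) as [m Hm].
  - intros z Hz. apply Hcont; destruct Hz; lra.
  - exists m. split; [exact Hm|]. intros Hout. apply (goursat f u v s t m); auto.
    intros z Hzx Hzy. apply Hd; try lra. intros ->. fold ax in Hzx. fold ay in Hzy. lra. }
destruct (Hex x1 (ax - e) y1 y2)%R as [m1 [R1 Z1]]; try lra.
destruct (Hex (ax + e) x2 y1 y2)%R as [m2 [R2 Z2]]; try lra.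
destruct (Hex (ax - e) (ax + e) y1 (ay - e))%R as [m3 [R3 Z3]]; try lra.
destruct (Hex (ax - e) (ax + e) (ay + e) y2)%R as [m4 [R4 Z4]]; try lra.
destruct (Hex (ax - e) (ax + e) (ay - e) (ay + e))%R as [m5 [R5 _]]; try lra.
assert (R6 := is_rect_split_y _ _ _ _ _ _ _ _ (is_rect_split_y _ _ _ _ _ _ _ _ R3 R5) R4).
assert (R7 := is_rect_split_x _ _ _ _ _ _ _ _ (is_rect_split_x _ _ _ _ _ _ _ _ R1 R6) R2).
rewrite (is_rect_unique _ _ _ _ _ _ _ Hl R7), Z1, Z2, Z3, Z4 by lra.
replace (0 + (0 + m5 + 0) + 0) with m5 by ring.
apply (is_rect_bound (ax - e) (ax + e) (ay - e) (ay + e) ltac:(lra) ltac:(lra) _ _ M) in R5.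
- replace (ax + e - (ax - e) + (ay + e - (ay - e)))%R with (4 * e)%R in R5 by ring. lra.
- intros z Hz. replace (f z) with ((f z - f a) + f a) by ring.
  eapply Rle_trans; [apply Cmod_triangle|]. unfold M.
  assert (Cmod (f z - f a) < 1)%R; [|lra]. apply Hfa.
  eapply Rle_lt_trans; [apply Cmod_le_Re_Im|].
  assert (Q1 : Re (z - a) = (Re z - ax)%R) by (simpl; unfold ax, Re; ring).
  assert (Q2 : Im (z - a) = (Im z - ay)%R) by (simpl; unfold ay, Im; ring).
  rewrite Q1, Q2.
  assert (Rabs (Re z - ax) <= e)%R by (apply Rabs_le; destruct Hz; lra).
  assert (Rabs (Im z - ay) <= e)%R by (apply Rabs_le; destruct Hz; lra). lra.
Qed.

(** Differentiation under the integral sign: a first-order remainder that is quadratic in b - a,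
    uniformly on the boundary, integrates to a quadratic remainder. *)
Lemma is_Cderive_rect (k : C -> C -> C) (k' : C -> C) (I : C -> C) (l a : C)
  (x1 x2 y1 y2 r M : R) : (0 < r)%R -> (x1 <= x2)%R -> (y1 <= y2)%R ->
  (forall b, (Cmod (b - a) < r)%R -> is_rect (k b) x1 x2 y1 y2 (I b)) ->
  is_rect k' x1 x2 y1 y2 l ->
  (forall b z, (Cmod (b - a) < r)%R -> bd x1 x2 y1 y2 z ->
    (Cmod (k b z - k a z - (b - a) * k' z) <= M * (Cmod (b - a) * Cmod (b - a)))%R) ->
  is_Cderive I a l.
Proof.
intros Hr Hx Hy HI Hl HM. apply is_Cderive_eps. intros eps Heps.
set (L := (x2 - x1 + (y2 - y1))%R).
set (A := (4 * (Rabs M + 1) * L + 1)%R).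
assert (HM0 := Rabs_pos M).
assert (HL : (0 <= L)%R) by (unfold L; lra).
assert (HA : (1 <= A)%R). { unfold A. assert (0 <= 4 * (Rabs M + 1) * L)%R by (repeat apply Rmult_le_pos; lra). lra. }
exists (Rmin r (eps / A)). split. { apply Rmin_pos; [lra|apply Rdiv_lt_0_compat; lra]. }
intros b Hb.
assert (Hb1 : (Cmod (b - a) < r)%R) by (eapply Rlt_le_trans; [exact Hb|apply Rmin_l]).
assert (Hb2 : (Cmod (b - a) < eps / A)%R) by (eapply Rlt_le_trans; [exact Hb|apply Rmin_r]).
assert (Haa : (Cmod (a - a) < r)%R) by (replace (a - a) with (RtoC 0) by ring; rewrite Cmod_0; lra).
assert (D := is_rect_minus _ _ _ _ _ _ _ _ (is_rect_minus _ _ _ _ _ _ _ _ (HI b Hb1) (HI a Haa)) (is_rect_scal _ _ _ _ (b - a) _ _ Hl)).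
set (d := Cmod (b - a)) in *.
assert (Hd : (0 <= d)%R) by apply Cmod_ge_0.
apply (is_rect_bound _ _ _ _ Hx Hy _ _ (Rabs M * (d * d))) in D.
- eapply Rle_trans; [exact D|]. apply Rlt_div_r in Hb2; [|lra]. fold L.
  replace (4 * (Rabs M * (d * d)) * L)%R with (4 * Rabs M * L * d * d)%R by ring.
  apply Rmult_le_compat_r; [exact Hd|].
  assert (4 * Rabs M * L <= A)%R by (unfold A; nra).
  assert (4 * Rabs M * L * d <= A * d)%R by (apply Rmult_le_compat_r; lra). lra.
- intros t Htt. eapply Rle_trans; [apply HM; assumption|]. apply Rmult_le_compat_r; [nra|apply Rle_abs].
Qed.

Lemma path_bounded (u : R -> C) (a b : R) : (a <= b)%R ->
  (forall t, (a <= t <= b)%R -> path_cont u t) ->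
  exists M, forall t, (a <= t <= b)%R -> (Cmod (u t) <= M)%R.
Proof.
intros Hab Hc. destruct (continuity_ab_maj (fun t => Cmod (u t)) a b Hab) as [m [Hm _]].
- intros t Ht. apply continuity_pt_filterlim. apply (proj2 (filterlim_locally (fun s => Cmod (u s)) (Cmod (u t)))).
  intros eps. destruct (Hc t Ht eps (cond_pos eps)) as [d [Hd Hs]].
  exists (mkposreal d Hd). intros s Hst. apply Hs in Hst.
  change (Rabs (Cmod (u s) - Cmod (u t)) < eps)%R.
  assert (T1 := Cmod_triangle (u s - u t) (u t)). assert (T2 := Cmod_triangle (u t - u s) (u s)).
  replace (u s - u t + u t) with (u s) in T1 by ring. replace (u t - u s + u s) with (u t) in T2 by ring.
  replace (Cmod (u t - u s)) with (Cmod (u s - u t)) in T2 by (rewrite <- (Cmod_opp (u s - u t)); f_equal; ring).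
  apply Rabs_lt_between. lra.
- exists (Cmod (u m)). exact Hm.
Qed.

Lemma bd_bounded (f : C -> C) (x1 x2 y1 y2 : R) : (x1 <= x2)%R -> (y1 <= y2)%R ->
  (forall z, bd x1 x2 y1 y2 z -> Ccont f z) ->
  exists M, forall z, bd x1 x2 y1 y2 z -> (Cmod (f z) <= M)%R.
Proof.
intros Hx Hy Hc.
destruct (path_bounded (fun t => f (t, y1)) x1 x2 Hx) as [M1 H1].
{ intros t Ht. apply Ccont_hor, Hc. now apply bd_b. }
destruct (path_bounded (fun t => f (t, y2)) x1 x2 Hx) as [M2 H2].
{ intros t Ht. apply Ccont_hor, Hc. now apply bd_t. }
destruct (path_bounded (fun t => f (x1, t)) y1 y2 Hy) as [M3 H3].
{ intros t Ht. apply Ccont_ver, Hc. now apply bd_l. }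
destruct (path_bounded (fun t => f (x2, t)) y1 y2 Hy) as [M4 H4].
{ intros t Ht. apply Ccont_ver, Hc. now apply bd_r. }
exists (Rmax (Rmax M1 M2) (Rmax M3 M4)).
intros [x y] [[Hz [E|E]]|[Hz [E|E]]]; unfold Re, Im in *; simpl in *; subst.
- eapply Rle_trans; [now apply H1|]. eapply Rle_trans; [apply Rmax_l|apply Rmax_l].
- eapply Rle_trans; [now apply H2|]. eapply Rle_trans; [apply Rmax_r|apply Rmax_l].
- eapply Rle_trans; [now apply H3|]. eapply Rle_trans; [apply Rmax_l|apply Rmax_r].
- eapply Rle_trans; [now apply H4|]. eapply Rle_trans; [apply Rmax_r|apply Rmax_r].
Qed.

(** The value of the integral as a total function, so that it can be differentiated in a parameter;
    [rect_correct] gives its meaning. *)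
Definition rect (f : C -> C) (x1 x2 y1 y2 : R) : C :=
  CInt (fun t => f (t, y1)) x1 x2 + Ci * CInt (fun t => f (x2, t)) y1 y2
  - CInt (fun t => f (t, y2)) x1 x2 - Ci * CInt (fun t => f (x1, t)) y1 y2.

Lemma rect_correct (f : C -> C) (x1 x2 y1 y2 : R) (l : C) :
  is_rect f x1 x2 y1 y2 l -> is_rect f x1 x2 y1 y2 (rect f x1 x2 y1 y2).
Proof.
intros (b & r & t & s & H1 & H2 & H3 & H4 & _). exists b, r, t, s.
split; [assumption|]. split; [assumption|]. split; [assumption|]. split; [assumption|].
apply is_CInt_unique in H1, H2, H3, H4. unfold rect. now rewrite H1, H2, H3, H4.
Qed.

Definition kernel (g : C -> C) (m : nat) (b z : C) : C := g z * (/ (z - b)) ^ m.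

(** * Cauchy integrals and their derivatives in the pole *)

Section cauchy.
Variables x1 x2 y1 y2 r : R.
Variable a0 : C.
Hypothesis Hx : (x1 <= x2)%R.
Hypothesis Hy : (y1 <= y2)%R.
Hypothesis Hr : (0 < r)%R.
Hypothesis Hfar : forall a z, (Cmod (a - a0) < r)%R -> bd x1 x2 y1 y2 z -> (r <= Cmod (z - a))%R.

Lemma bd_ne a z : (Cmod (a - a0) < r)%R -> bd x1 x2 y1 y2 z -> z - a <> 0.
Proof. intros Ha Hz E. assert (H := Hfar a z Ha Hz). rewrite E, Cmod_0 in H. lra. Qed.

Lemma is_Cderive_inv_sub (b z : C) : z - b <> 0 ->
  is_Cderive (fun w => / (w - b)) z (- (/ (z - b) * / (z - b))).
Proof.
intros H. eapply is_Cderive_eq.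
- apply (is_Cderive_comp (fun w => / w) (fun w => w - b)).
  + now apply is_Cderive_inv.
  + cderive.
- ring.
Qed.

Lemma kernel_diff (g : C -> C) (m : nat) (b z : C) : z - b <> 0 ->
  (exists l, is_Cderive g z l) -> exists l, is_Cderive (kernel g m b) z l.
Proof.
intros Hz [l Hl]. unfold kernel. induction m as [|m [d IH]]; simpl.
- eexists. apply is_Cderive_mult; [exact Hl|apply is_Cderive_const].
- exists (- (/ (z - b) * / (z - b)) * (g z * (/ (z - b)) ^ m) + / (z - b) * d).
  eapply is_derive_ext; [|apply (is_Cderive_mult _ _ _ _ _ (is_Cderive_inv_sub b z Hz) IH)].
  intros t. simpl. ring.
Qed.

Variable g : C -> C.
Hypothesis Hg : forall z, bd x1 x2 y1 y2 z -> exists l, is_Cderive g z l.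

Definition moment (m : nat) (a : C) : C := rect (kernel g m a) x1 x2 y1 y2.

Lemma moment_correct (m : nat) (a : C) : (Cmod (a - a0) < r)%R ->
  is_rect (kernel g m a) x1 x2 y1 y2 (moment m a).
Proof.
intros Ha. destruct (ex_rect _ _ _ _ Hx Hy (kernel g m a)) as [l Hl].
- intros z Hz. destruct (kernel_diff g m a z (bd_ne a z Ha Hz) (Hg z Hz)) as [d Hd].
  exact (is_Cderive_Ccont _ _ _ Hd).
- exact (rect_correct _ _ _ _ _ _ Hl).
Qed.

Lemma Cmod_inv_far (a z : C) : (Cmod (a - a0) < r)%R -> bd x1 x2 y1 y2 z ->
  (Cmod (/ (z - a)) <= / r)%R.
Proof.
intros Ha Hz. rewrite Cmod_inv by now apply bd_ne. apply Rinv_le_contravar; [lra|now apply Hfar].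
Qed.

(** The remainders are explicit: 1/(z-b) - 1/(z-a) - (b-a)/(z-a)^2 equals (b-a)^2 / ((z-b)(z-a)^2),
    similarly for the squares, and [Hfar] bounds the inverses. Two derivatives are provided because
    f' will be an expression in the moments 1 and 2 that is differentiated once more. *)
Lemma moment_derive (a : C) : (Cmod (a - a0) < r)%R ->
  is_Cderive (moment 1) a (moment 2 a) /\ is_Cderive (moment 2) a (2 * moment 3 a).
Proof.
intros Ha.
destruct (bd_bounded g x1 x2 y1 y2 Hx Hy) as [B HB].
{ intros z Hz. destruct (Hg z Hz) as [d Hd]. exact (is_Cderive_Ccont _ _ _ Hd). }
assert (Hnear : forall b, (Cmod (b - a) < r - Cmod (a - a0))%R -> (Cmod (b - a0) < r)%R).
{ intros b Hb. replace (b - a0) with ((b - a) + (a - a0)) by ring.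
  eapply Rle_lt_trans; [apply Cmod_triangle|]. lra. }
assert (Hir : (0 < / r)%R) by now apply Rinv_0_lt_compat.
split.
- apply (is_Cderive_rect (kernel g 1) (kernel g 2 a) (moment 1) (moment 2 a) a x1 x2 y1 y2
    (r - Cmod (a - a0)) (B * (/ r * (/ r * / r)))); try lra.
  + intros b Hb. apply moment_correct. now apply Hnear.
  + now apply moment_correct.
  + intros b z Hb Hz. apply Hnear in Hb.
    assert (N1 := bd_ne a z Ha Hz). assert (N2 := bd_ne b z Hb Hz).
    assert (I1 := Cmod_inv_far a z Ha Hz). assert (I2 := Cmod_inv_far b z Hb Hz).
    replace (kernel g 1 b z - kernel g 1 a z - (b - a) * kernel g 2 a z) with
      (g z * (/ (z - b) * (/ (z - a) * / (z - a))) * ((b - a) * (b - a))) by (unfold kernel; simpl; field; auto).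
    rewrite (Cmod_mult _ ((b - a) * (b - a))), (Cmod_mult (b - a)).
    apply Rmult_le_compat_r; [apply Rmult_le_pos; apply Cmod_ge_0|].
    rewrite !Cmod_mult.
    repeat (apply Rmult_le_compat; repeat apply Rmult_le_pos; try apply Cmod_ge_0; auto).
- apply (is_Cderive_rect (kernel g 2) (fun z => 2 * kernel g 3 a z) (moment 2) (2 * moment 3 a) a x1 x2 y1 y2
    (r - Cmod (a - a0)) (B * (/ r * (/ r * / r)) * (3 * / r))); try lra.
  + intros b Hb. apply moment_correct. now apply Hnear.
  + apply is_rect_scal. now apply moment_correct.
  + intros b z Hb Hz. apply Hnear in Hb.
    assert (N1 := bd_ne a z Ha Hz). assert (N2 := bd_ne b z Hb Hz).
    assert (I1 := Cmod_inv_far a z Ha Hz). assert (I2 := Cmod_inv_far b z Hb Hz).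
    replace (kernel g 2 b z - kernel g 2 a z - (b - a) * (2 * kernel g 3 a z)) with
      (g z * (/ (z - b) * (/ (z - a) * / (z - a))) * (/ (z - b) + 2 * / (z - a)) * ((b - a) * (b - a)))
      by (unfold kernel; simpl; field; auto).
    rewrite (Cmod_mult _ ((b - a) * (b - a))), (Cmod_mult (b - a)).
    apply Rmult_le_compat_r; [apply Rmult_le_pos; apply Cmod_ge_0|].
    rewrite (Cmod_mult _ (/ (z - b) + _)).
    apply Rmult_le_compat; try apply Cmod_ge_0.
    * rewrite !Cmod_mult.
      repeat (apply Rmult_le_compat; repeat apply Rmult_le_pos; try apply Cmod_ge_0; auto).
    * eapply Rle_trans; [apply Cmod_triangle|]. rewrite Cmod_mult, Cmod_R, Rabs_pos_eq by lra. lra.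
Qed.
End cauchy.

Lemma is_RInt_gt_0 (u : R -> R) (a b l : R) : (a < b)%R ->
  (forall t, (a <= t <= b)%R -> (0 < u t)%R) ->
  (forall t, (a <= t <= b)%R -> continuous u t) -> is_RInt u a b l -> (0 < l)%R.
Proof.
intros Hab Hp Hc Hl. rewrite <- (is_RInt_unique (V := R_CompleteNormedModule) _ _ _ _ Hl).
apply RInt_gt_0; auto. intros t Ht. apply Hp. lra.
Qed.

(** Cauchy's formula is used below as a quotient of two boundary integrals, and this is its
    denominator. Each of the four sides contributes a positive amount to the imaginary part. *)
Lemma winding_nz (a : C) (x1 x2 y1 y2 : R) (l : C) :
  (x1 < Re a < x2)%R -> (y1 < Im a < y2)%R ->
  is_rect (fun z => / (z - a)) x1 x2 y1 y2 l -> l <> 0.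
Proof.
intros Hx Hy (b & r & t & s & H1 & H2 & H3 & H4 & ->) E.
assert (Hc : forall z, z - a <> 0 -> Ccont (fun z => / (z - a)) z).
{ intros z Hz. exact (is_Cderive_Ccont _ _ _ (is_Cderive_inv_sub a z Hz)). }
assert (Hne : forall z, (Re z <> Re a \/ Im z <> Im a) -> z - a <> 0).
{ intros z [Hz|Hz] Ez; apply Hz; replace z with (z - a + a) by ring; rewrite Ez; simpl; unfold Re, Im; simpl; ring. }
assert (HRe : forall z, (Re (/ (z - a)) = (Re z - Re a) / ((Re z - Re a) ^ 2 + (Im z - Im a) ^ 2))%R) by reflexivity.
assert (HIm : forall z, (Im (/ (z - a)) = (Im a - Im z) / ((Re z - Re a) ^ 2 + (Im z - Im a) ^ 2))%R).
{ intros z. transitivity (- (Im z - Im a) / ((Re z - Re a) ^ 2 + (Im z - Im a) ^ 2))%R; [reflexivity|f_equal; ring]. }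
assert (Hden : forall u v : R, (u <> 0 \/ v <> 0)%R -> (0 < u ^ 2 + v ^ 2)%R).
{ intros u v [H|H]; assert (Hu := pow2_ge_0 u); assert (Hv := pow2_ge_0 v);
  [assert (0 < u ^ 2)%R by (apply pow2_gt_0; auto)|assert (0 < v ^ 2)%R by (apply pow2_gt_0; auto)]; lra. }
assert (P1 : (0 < Im b)%R).
{ apply (is_RInt_gt_0 _ x1 x2 _ ltac:(lra)) with (3 := proj2 H1); intros u Hu.
  - rewrite HIm. unfold Re, Im in *; simpl fst in *; simpl snd in *. apply Rdiv_lt_0_compat; [lra|apply Hden; right; lra].
  - apply (path_cont_Im (fun t => / ((t, y1) - a))), (Ccont_hor (fun z => / (z - a))), Hc, Hne. right. simpl. lra. }
assert (P2 : (0 < Re r)%R).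
{ apply (is_RInt_gt_0 _ y1 y2 _ ltac:(lra)) with (3 := proj1 H2); intros u Hu.
  - rewrite HRe. unfold Re, Im in *; simpl fst in *; simpl snd in *. apply Rdiv_lt_0_compat; [lra|apply Hden; left; lra].
  - apply (path_cont_Re (fun t => / ((x2, t) - a))), (Ccont_ver (fun z => / (z - a))), Hc, Hne. left. simpl. lra. }
assert (P3 : (0 < - Im t)%R).
{ apply (is_RInt_gt_0 _ x1 x2 _ ltac:(lra)) with (3 := is_RInt_opp (V := R_NormedModule) _ _ _ _ (proj2 H3)); intros u Hu.
  - rewrite HIm. unfold Re, Im, opp in *; simpl fst in *; simpl snd in *; simpl.
    rewrite <- Rdiv_opp_l. apply Rdiv_lt_0_compat; [lra|]. apply Hden; right; lra.
  - apply (continuous_opp (V := R_NormedModule)).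
    apply (path_cont_Im (fun t => / ((t, y2) - a))), (Ccont_hor (fun z => / (z - a))), Hc, Hne. right. simpl. lra. }
assert (P4 : (0 < - Re s)%R).
{ apply (is_RInt_gt_0 _ y1 y2 _ ltac:(lra)) with (3 := is_RInt_opp (V := R_NormedModule) _ _ _ _ (proj1 H4)); intros u Hu.
  - rewrite HRe. unfold Re, Im, opp in *; simpl fst in *; simpl snd in *; simpl.
    rewrite <- Rdiv_opp_l. apply Rdiv_lt_0_compat; [lra|]. apply Hden; left; lra.
  - apply (continuous_opp (V := R_NormedModule)).
    apply (path_cont_Re (fun t => / ((x1, t) - a))), (Ccont_ver (fun z => / (z - a))), Hc, Hne. left. simpl. lra. }
assert (EI : Im (b + Ci * r - t - Ci * s) = (Im b + Re r - Im t - Re s)%R) by (simpl; unfold Re, Im; ring).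
rewrite E in EI. simpl in EI. lra.
Qed.

(** Filling in l at a gives the continuity that [goursat_except] asks for; the same extension,
    applied to the nome, returns in [kernel_limit]. *)
Lemma difference_quotient_cont (f : C -> C) (a l : C) : is_Cderive f a l ->
  Ccont (fun z => if excluded_middle_informative (z = a) then l else (f z - f a) * / (z - a)) a.
Proof.
intros Hl eps Heps.
destruct (proj1 (is_Cderive_eps f a l) Hl (eps / 2)%R ltac:(lra)) as [d [Hd Hw]].
exists d. split; [exact Hd|]. intros w Hwa.
destruct (excluded_middle_informative (a = a)) as [_|N]; [|now destruct N].
destruct (excluded_middle_informative (w = a)) as [->|N].
- replace (l - l) with (RtoC 0) by ring. now rewrite Cmod_0.
- assert (N' : w - a <> 0). { intros E. apply N. replace w with (w - a + a) by ring. rewrite E. ring. }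
  replace ((f w - f a) * / (w - a) - l) with ((f w - f a - (w - a) * l) * / (w - a)) by (field; exact N').
  rewrite Cmod_mult, Cmod_inv by exact N'. assert (P := proj1 (Cmod_gt_0 _) N').
  apply Rle_lt_trans with (eps / 2)%R; [|lra]. apply Rle_div_l; [exact P|]. now apply Hw.
Qed.

(** Near a0 the function f is a quotient F 1 / W 1 of boundary integrals that are twice
    differentiable in the pole, so f' is an explicit expression in the moments 1 and 2, which is
    again differentiable. *)
Lemma derive_holomorphic (f : C -> C) (a0 : C) (rho : R) : (0 < rho)%R ->
  (forall w, (Cmod (w - a0) < rho)%R -> exists l, is_Cderive f w l) ->
  exists l, is_Cderive (C_derive f) a0 l.
Proof.
intros Hrho Hf.
(* Half-side rho / 4 puts the square inside the disc of radius rho; with r = h / 2, poles within r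
   of a0 stay at distance at least r from the boundary. *)
set (h := (rho / 4)%R). set (r := (h / 2)%R).
set (x1 := (Re a0 - h)%R). set (x2 := (Re a0 + h)%R). set (y1 := (Im a0 - h)%R). set (y2 := (Im a0 + h)%R).
assert (Hh : (0 < h)%R) by (unfold h; lra).
assert (Hin : forall z, (x1 <= Re z <= x2)%R -> (y1 <= Im z <= y2)%R -> exists l, is_Cderive f z l).
{ intros z Hz1 Hz2. apply Hf. eapply Rle_lt_trans; [apply Cmod_le_Re_Im|].
  assert (E1 : Re (z - a0) = (Re z - Re a0)%R) by (simpl; unfold Re; ring).
  assert (E2 : Im (z - a0) = (Im z - Im a0)%R) by (simpl; unfold Im; ring).
  rewrite E1, E2. unfold x1, x2, y1, y2 in *.
  assert (Rabs (Re z - Re a0) <= h)%R by (apply Rabs_le; lra).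
  assert (Rabs (Im z - Im a0) <= h)%R by (apply Rabs_le; lra). unfold h in *. lra. }
assert (Hx : (x1 <= x2)%R) by (unfold x1, x2; lra).
assert (Hy : (y1 <= y2)%R) by (unfold y1, y2; lra).
assert (Hr : (0 < r)%R) by (unfold r; lra).
assert (Hbd : forall z, bd x1 x2 y1 y2 z -> (h <= Cmod (z - a0))%R).
{ intros z Hz.
  assert (E1 : Re (z - a0) = (Re z - Re a0)%R) by (simpl; unfold Re; ring).
  assert (E2 : Im (z - a0) = (Im z - Im a0)%R) by (simpl; unfold Im; ring).
  assert (I1 := re_le_Cmod (z - a0)). assert (I2 := Im_le_Cmod (z - a0)). rewrite E1 in I1. rewrite E2 in I2.
  destruct Hz as [[_ [E|E]]|[_ [E|E]]]; rewrite E in *; unfold x1, x2, y1, y2 in *.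
  - replace (Im a0 - h - Im a0)%R with (- h)%R in I2 by ring. rewrite Rabs_Ropp, Rabs_pos_eq in I2; lra.
  - replace (Im a0 + h - Im a0)%R with h in I2 by ring. rewrite Rabs_pos_eq in I2; lra.
  - replace (Re a0 - h - Re a0)%R with (- h)%R in I1 by ring. rewrite Rabs_Ropp, Rabs_pos_eq in I1; lra.
  - replace (Re a0 + h - Re a0)%R with h in I1 by ring. rewrite Rabs_pos_eq in I1; lra. }
assert (Hfar : forall a z, (Cmod (a - a0) < r)%R -> bd x1 x2 y1 y2 z -> (r <= Cmod (z - a))%R).
{ intros a z Ha Hz. assert (T := Cmod_triangle (z - a) (a - a0)).
  replace (z - a + (a - a0)) with (z - a0) in T by ring. specialize (Hbd z Hz). unfold r in *. lra. }
assert (Hfb : forall z, bd x1 x2 y1 y2 z -> exists l, is_Cderive f z l).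
{ intros z Hz. apply Hin; destruct Hz as [[A [E|E]]|[A [E|E]]]; lra. }
set (F := moment x1 x2 y1 y2 f). set (W := moment x1 x2 y1 y2 (fun _ => 1)).
assert (H1b : forall z, bd x1 x2 y1 y2 z -> exists l, is_Cderive (fun _ => RtoC 1) z l).
{ intros z _. eexists. apply is_Cderive_const. }
assert (HF := moment_derive x1 x2 y1 y2 r a0 Hx Hy Hr Hfar f Hfb).
assert (HW := moment_derive x1 x2 y1 y2 r a0 Hx Hy Hr Hfar (fun _ => RtoC 1) H1b).
fold F in HF. fold W in HW.
assert (Hcauchy : forall a, (Cmod (a - a0) < r)%R -> W 1%nat a <> 0 /\ f a = F 1%nat a * / W 1%nat a).
{ intros a Ha.
  assert (RF := moment_correct x1 x2 y1 y2 r a0 Hx Hy Hr Hfar f Hfb 1 a Ha).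
  assert (RW := moment_correct x1 x2 y1 y2 r a0 Hx Hy Hr Hfar (fun _ => RtoC 1) H1b 1 a Ha).
  fold F in RF. fold W in RW.
  assert (Hax : (x1 < Re a < x2)%R /\ (y1 < Im a < y2)%R).
  { assert (E1 : Re (a - a0) = (Re a - Re a0)%R) by (simpl; unfold Re; ring).
    assert (E2 : Im (a - a0) = (Im a - Im a0)%R) by (simpl; unfold Im; ring).
    assert (I1 := re_le_Cmod (a - a0)). assert (I2 := Im_le_Cmod (a - a0)). rewrite E1 in I1. rewrite E2 in I2.
    assert (I3 : (Rabs (Re a - Re a0) < h)%R) by (unfold r in *; lra).
    assert (I4 : (Rabs (Im a - Im a0) < h)%R) by (unfold r in *; lra).
    apply Rabs_lt_between in I3, I4. unfold x1, x2, y1, y2. lra. }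
  destruct Hax as [Hax Hay].
  assert (Wnz : W 1%nat a <> 0).
  { apply (winding_nz a x1 x2 y1 y2); auto. eapply is_rect_ext; [exact Hx|exact Hy| |exact RW].
    intros z Hz. unfold kernel. simpl. ring. }
  split; [exact Wnz|].
  destruct (Hin a) as [l Hl]; try lra.
  set (q := fun z => if excluded_middle_informative (z = a) then l else (f z - f a) * / (z - a)).
  assert (Hq : forall z, (x1 <= Re z <= x2)%R -> (y1 <= Im z <= y2)%R -> z <> a -> exists d, is_Cderive q z d).
  { intros z Hz1 Hz2 Hne. destruct (Hin z Hz1 Hz2) as [d Hd].
    assert (N : z - a <> 0). { intros E. apply Hne. replace z with (z - a + a) by ring. rewrite E. ring. }
    eexists. apply (is_Cderive_ext_loc (fun z => (f z - f a) * / (z - a)) q z _ (Cmod (z - a))).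
    - now apply Cmod_gt_0.
    - intros w Hw. unfold q. destruct (excluded_middle_informative (w = a)) as [->|_]; [exfalso|reflexivity].
      rewrite <- (Cmod_opp (z - a)) in Hw. replace (- (z - a)) with (a - z) in Hw by ring. lra.
    - apply (is_Cderive_mult (fun z => f z - f a)); [cderive|now apply is_Cderive_inv_sub]. }
  (* On the boundary the difference quotient is f z / (z - a) minus f a / (z - a); its integral
     vanishes by [goursat_except], which is Cauchy's formula. *)
  assert (Rq : is_rect q x1 x2 y1 y2 (F 1%nat a - f a * W 1%nat a)).
  { eapply is_rect_ext; [exact Hx|exact Hy| |exact (is_rect_minus _ _ _ _ _ _ _ _ RF (is_rect_scal _ _ _ _ (f a) _ _ RW))].
    intros z Hz. unfold q, kernel. simpl. destruct (excluded_middle_informative (z = a)) as [->|_].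
    - exfalso. apply (bd_ne x1 x2 y1 y2 r a0 Hr Hfar a a Ha Hz). ring.
    - ring. }
  apply (goursat_except q a) in Rq; try lra; auto; [|now apply difference_quotient_cont].
  assert (E : F 1%nat a = f a * W 1%nat a).
  { replace (F 1%nat a) with (F 1%nat a - f a * W 1%nat a + f a * W 1%nat a) by ring. rewrite Rq. ring. }
  rewrite E. field. exact Wnz. }
assert (Hder : forall a, (Cmod (a - a0) < r)%R ->
  C_derive f a = F 2%nat a * / W 1%nat a - F 1%nat a * (W 2%nat a * (/ W 1%nat a * / W 1%nat a))).
{ intros a Ha. apply is_C_derive_unique.
  apply (is_Cderive_ext_loc (fun a => F 1%nat a * / W 1%nat a) f a _ (r - Cmod (a - a0))); [lra|..].
  - intros w Hw. symmetry. apply Hcauchy. replace (w - a0) with ((w - a) + (a - a0)) by ring.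
    eapply Rle_lt_trans; [apply Cmod_triangle|]. lra.
  - eapply is_Cderive_eq.
    + apply (is_Cderive_mult (F 1%nat) (fun a => / W 1%nat a)); [exact (proj1 (HF a Ha))|].
      apply (is_Cderive_comp (fun w => / w) (W 1%nat)); [apply is_Cderive_inv, Hcauchy, Ha|exact (proj1 (HW a Ha))].
    + simpl. ring. }
assert (Ha0 : (Cmod (a0 - a0) < r)%R) by (replace (a0 - a0) with (RtoC 0) by ring; rewrite Cmod_0; exact Hr).
eexists. eapply (is_Cderive_ext_loc _ _ a0 _ r Hr).
- intros w Hw. symmetry. now apply Hder.
- destruct (HF a0 Ha0) as [F1 F2]. destruct (HW a0 Ha0) as [W1 W2].
  assert (V : is_Cderive (fun a => / W 1%nat a) a0 (W 2%nat a0 * - (/ W 1%nat a0 * / W 1%nat a0))).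
  { apply (is_Cderive_comp (fun w => / w) (W 1%nat)); [apply is_Cderive_inv, Hcauchy, Ha0|exact W1]. }
  cderive.
Qed.

Lemma holomorphic_D (f : C -> C) : holomorphic f -> holomorphic (D f).
Proof.
intros Hf z Hz.
destruct (derive_holomorphic f z (Im z) Hz) as [l Hl].
- intros w Hw. destruct (Hf w (upper_ball z w Hw)) as [d Hd]. now exists d.
- eexists. unfold D. apply (is_Cderive_mult (C_derive f) (fun _ => / (2 * PI * Ci))); cderive.
Qed.

(** * Unordered sums *)

Definition lsum {I : Type} (f : I -> C) (L : list I) : C :=
  fold_right (fun i s => f i + s) (RtoC 0) L.

Definition rsum {I : Type} (b : I -> R) (L : list I) : R :=
  fold_right (fun i s => b i + s)%R 0%R L.

(** Convergence of the net of finite partial sums. With no order on the index set, sums over pairs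
    and over Z can be reindexed freely. *)
Definition has_sum {I : Type} (f : I -> C) (s : C) : Prop :=
  forall eps : R, (0 < eps)%R -> exists L0 : list I,
    forall L, NoDup L -> incl L0 L -> (Cmod (lsum f L - s) < eps)%R.

Definition rsummable {I : Type} (b : I -> R) : Prop :=
  (forall i, (0 <= b i)%R) /\
  exists M : R, forall L, NoDup L -> (rsum b L <= M)%R.

(** Classical decidability of equality makes [nodup] and [in_dec] available for every index type. *)
Definition ceq_dec {I : Type} (x y : I) : {x = y} + {x <> y} :=
  excluded_middle_informative (x = y).

Lemma lsum_app {I} (f : I -> C) L1 L2 : lsum f (L1 ++ L2) = lsum f L1 + lsum f L2.
Proof. induction L1; simpl. now rewrite Cplus_0_l. rewrite IHL1. ring. Qed.

Lemma lsum_map {I J} (f : I -> C) (j : J -> I) L : lsum f (map j L) = lsum (fun k => f (j k)) L.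
Proof. induction L; simpl; [reflexivity|now rewrite IHL]. Qed.

Lemma lsum_ext {I} (f g : I -> C) L : (forall i, In i L -> f i = g i) -> lsum f L = lsum g L.
Proof. induction L; simpl; intros H; [reflexivity|]. rewrite H, IHL; auto. Qed.

Lemma lsum_0 {I} (f : I -> C) L : (forall i, In i L -> f i = 0) -> lsum f L = 0.
Proof. induction L; simpl; intros H; [reflexivity|]. rewrite H, IHL; auto. now rewrite Cplus_0_l. Qed.

Lemma lsum_plus {I} (f g : I -> C) L : lsum (fun i => f i + g i) L = lsum f L + lsum g L.
Proof. induction L; simpl; [ring|]. rewrite IHL. ring. Qed.

Lemma lsum_scal {I} (c : C) (f : I -> C) L : lsum (fun i => c * f i) L = c * lsum f L.
Proof. induction L; simpl; [ring|]. rewrite IHL. ring. Qed.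

Lemma Cmod_lsum {I} (f : I -> C) L : (Cmod (lsum f L) <= rsum (fun i => Cmod (f i)) L)%R.
Proof.
induction L; simpl. rewrite Cmod_0; lra.
eapply Rle_trans; [apply Cmod_triangle|]. lra.
Qed.

Lemma rsum_le {I} (b c : I -> R) L : (forall i, In i L -> (b i <= c i)%R) -> (rsum b L <= rsum c L)%R.
Proof.
induction L; simpl; intros H. lra. assert (H1 := H a (or_introl eq_refl)).
assert (H2 : (rsum b L <= rsum c L)%R) by auto. lra.
Qed.

Lemma rsum_ge0 {I} (b : I -> R) L : (forall i, (0 <= b i)%R) -> (0 <= rsum b L)%R.
Proof. intros H. induction L; simpl. lra. specialize (H a). lra. Qed.

Lemma rsum_app {I} (f : I -> R) L1 L2 : (rsum f (L1 ++ L2) = rsum f L1 + rsum f L2)%R.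
Proof. induction L1; simpl. ring. rewrite IHL1. ring. Qed.

Lemma rsum_map {I J} (f : I -> R) (j : J -> I) L : rsum f (map j L) = rsum (fun k => f (j k)) L.
Proof. induction L; simpl; [reflexivity|now rewrite IHL]. Qed.

Lemma rsum_scal {I} (c : R) (f : I -> R) L : (rsum (fun i => c * f i) L = c * rsum f L)%R.
Proof. induction L; simpl; [ring|]. rewrite IHL. ring. Qed.

Lemma lsum_RtoC {I} (b : I -> R) L : lsum (fun i => RtoC (b i)) L = RtoC (rsum b L).
Proof. induction L; simpl; [reflexivity|]. now rewrite IHL, RtoC_plus. Qed.

Lemma lsum_remove {I} (f : I -> C) (a : I) L : NoDup L -> In a L ->
  exists L', NoDup L' /\ lsum f L = f a + lsum f L' /\ (forall i, In i L <-> i = a \/ In i L') /\ ~ In a L'.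
Proof.
intros HL Ha. destruct (in_split a L Ha) as (L1 & L2 & ->).
exists (L1 ++ L2). split; [now apply NoDup_remove_1 in HL|]. split.
{ rewrite !lsum_app. simpl. ring. }
split; [|now apply NoDup_remove_2 in HL].
intros i. rewrite !in_app_iff. simpl. intuition congruence.
Qed.

Lemma rsum_incl {I} (b : I -> R) (L M : list I) : (forall i, (0 <= b i)%R) -> NoDup L -> incl L M ->
  (rsum b L <= rsum b M)%R.
Proof.
intros Hb. revert M. induction L as [|a L IH]; intros M HL Hi; simpl.
- now apply rsum_ge0.
- inversion_clear HL. destruct (in_split a M (Hi a (or_introl eq_refl))) as (M1 & M2 & ->).
  rewrite rsum_app. simpl. specialize (IH (M1 ++ M2) H0). rewrite rsum_app in IH.
  assert (incl L (M1 ++ M2)).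
  { intros x Hx. assert (Hx' := Hi x (or_intror Hx)). rewrite in_app_iff in *. simpl in Hx'.
    destruct Hx' as [?|[->|?]]; tauto. }
  specialize (IH H1). lra.
Qed.

Lemma has_sum_ext {I} (f g : I -> C) s : (forall i, f i = g i) -> has_sum f s -> has_sum g s.
Proof.
intros He H eps Heps. destruct (H eps Heps) as [L0 HL]. exists L0. intros L H1 H2.
rewrite <- (lsum_ext f g L) by auto. now apply HL.
Qed.

Lemma has_sum_unique {I} (f : I -> C) s t : has_sum f s -> has_sum f t -> s = t.
Proof.
intros Hs Ht. apply Ceq_minus, Cmod_eq_0. apply Rle_antisym; [|apply Cmod_ge_0].
apply Rle_plus_epsilon. intros eps Heps. rewrite Rplus_0_l.
destruct (Hs (eps / 2)%R ltac:(lra)) as [L1 H1]. destruct (Ht (eps / 2)%R ltac:(lra)) as [L2 H2].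
set (L := nodup ceq_dec (L1 ++ L2)).
assert (HL : NoDup L) by apply NoDup_nodup.
specialize (H1 L HL). specialize (H2 L HL).
assert (I1 : incl L1 L). { intros x Hx. apply nodup_In, in_app_iff. now left. }
assert (I2 : incl L2 L). { intros x Hx. apply nodup_In, in_app_iff. now right. }
specialize (H1 I1). specialize (H2 I2).
replace (s - t) with (- (lsum f L - s) + (lsum f L - t)) by ring.
eapply Rle_trans; [apply Cmod_triangle|]. rewrite Cmod_opp. lra.
Qed.

Lemma has_sum_plus {I} (f g : I -> C) s t : has_sum f s -> has_sum g t ->
  has_sum (fun i => f i + g i) (s + t).
Proof.
intros Hs Ht eps Heps.
destruct (Hs (eps / 2)%R ltac:(lra)) as [L1 H1]. destruct (Ht (eps / 2)%R ltac:(lra)) as [L2 H2].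
exists (L1 ++ L2). intros L HL Hi. apply incl_app_inv in Hi. destruct Hi as [I1 I2].
specialize (H1 L HL I1). specialize (H2 L HL I2). rewrite lsum_plus.
replace (lsum f L + lsum g L - (s + t)) with ((lsum f L - s) + (lsum g L - t)) by ring.
eapply Rle_lt_trans; [apply Cmod_triangle|]. lra.
Qed.

Lemma has_sum_scal {I} (c : C) (f : I -> C) s : has_sum f s -> has_sum (fun i => c * f i) (c * s).
Proof.
intros Hs eps Heps. assert (Hc := Cmod_ge_0 c).
destruct (Hs (eps / (Cmod c + 1))%R) as [L0 H0]. { apply Rdiv_lt_0_compat; lra. }
exists L0. intros L HL Hi. specialize (H0 L HL Hi). rewrite lsum_scal.
replace (c * lsum f L - c * s) with (c * (lsum f L - s)) by ring. rewrite Cmod_mult.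
apply Rlt_div_r in H0; [|lra]. assert (H1 := Cmod_ge_0 (lsum f L - s)). nra.
Qed.

Lemma has_sum_minus {I} (f g : I -> C) s t : has_sum f s -> has_sum g t ->
  has_sum (fun i => f i - g i) (s - t).
Proof.
intros Hf Hg. apply (has_sum_ext (fun i => f i + (- (1)) * g i)); [intros; ring|].
replace (s - t) with (s + (- (1)) * t) by ring. apply has_sum_plus; [assumption|now apply has_sum_scal].
Qed.

Lemma lsum_incl {I} (f : I -> C) (L0 L : list I) : NoDup L0 -> NoDup L -> incl L0 L ->
  (forall i, In i L -> ~ In i L0 -> f i = 0) -> lsum f L = lsum f L0.
Proof.
revert L. induction L0 as [|a L0 IH]; intros L H0 HL Hi Hf; simpl.
- apply lsum_0. auto.
- inversion_clear H0. destruct (lsum_remove f a L HL (Hi a (or_introl eq_refl))) as (L' & H2 & H3 & H4 & H5).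
  rewrite H3. f_equal. apply IH; auto.
  + intros x Hx. destruct (proj1 (H4 x) (Hi x (or_intror Hx))) as [->|]; [contradiction|assumption].
  + intros i Hi1 Hi2. apply Hf; [now apply H4; right|]. intros [->|]; contradiction.
Qed.

Lemma has_sum_finite {I} (f : I -> C) (L0 : list I) : NoDup L0 ->
  (forall i, ~ In i L0 -> f i = 0) -> has_sum f (lsum f L0).
Proof.
intros H0 Hf eps Heps. exists L0. intros L HL Hi.
rewrite (lsum_incl f L0 L) by auto.
replace (lsum f L0 - lsum f L0) with (RtoC 0) by ring. now rewrite Cmod_0.
Qed.

Lemma lsum_range {I J} (j : J -> I) (f : I -> C) (L : list I) :
  (forall k k', j k = j k' -> k = k') -> (forall i, (forall k, i <> j k) -> f i = 0) -> NoDup L ->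
  exists L', NoDup L' /\ lsum f L = lsum (fun k => f (j k)) L' /\ (forall k, In k L' <-> In (j k) L).
Proof.
intros Hj Hf. induction L as [|a L IH]; intros HL.
- exists []. split; [constructor|]. split; [reflexivity|]. intros k; simpl; tauto.
- inversion_clear HL. destruct (IH H0) as (L' & H1 & H2 & H3).
  destruct (excluded_middle_informative (exists k, a = j k)) as [[k ->]|N].
  + exists (k :: L'). split; [constructor; [rewrite H3; assumption|assumption]|].
    split; [simpl; now rewrite H2|]. intros k'. simpl. rewrite H3. split; (intros [E|E]; [left|now right]); [now subst|now apply Hj].
  + exists L'. split; [assumption|]. split; [simpl; rewrite Hf, H2; [ring|]; intros k E; apply N; now exists k|].
    intros k. rewrite H3. simpl. split; [tauto|]. intros [E|E]; [|assumption]. exfalso; apply N; now exists k.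
Qed.

(** The range of j contains the support of f, so finite sums on either side correspond. Bijections
    of index sets and restrictions to a subset are both instances. *)
Lemma has_sum_inj {I J} (j : J -> I) (f : I -> C) s :
  (forall k k', j k = j k' -> k = k') -> (forall i, (forall k, i <> j k) -> f i = 0) ->
  (has_sum (fun k => f (j k)) s <-> has_sum f s).
Proof.
intros Hj Hf. split; intros H eps Heps; destruct (H eps Heps) as [L0 H0].
- exists (map j L0). intros L HL Hi.
  destruct (lsum_range j f L Hj Hf HL) as (L' & H1 & H2 & H3). rewrite H2. apply H0; [assumption|].
  intros k Hk. apply H3, Hi, in_map, Hk.
- destruct (lsum_range j f (nodup ceq_dec L0) Hj Hf (NoDup_nodup _ _)) as (L0' & H1 & H2 & H3).
  exists L0'. intros L HL Hi.
  set (M := nodup ceq_dec (map j L ++ L0)).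
  assert (HM : NoDup M) by apply NoDup_nodup.
  assert (HmL : NoDup (map j L)). { apply FinFun.Injective_map_NoDup; [exact Hj|exact HL]. }
  assert (E : lsum f M = lsum f (map j L)).
  { apply lsum_incl; auto.
    - intros x Hx. apply nodup_In, in_app_iff. now left.
    - intros i Hi1 Hi2. apply Hf. intros k ->. apply Hi2. apply in_map, Hi, H3, nodup_In.
      apply nodup_In, in_app_iff in Hi1. tauto. }
  rewrite <- lsum_map, <- E. apply H0; [assumption|]. intros x Hx. apply nodup_In, in_app_iff. now right.
Qed.

Lemma has_sum_fubini {I J} (F : I * J -> C) (g : I -> C) s :
  has_sum F s -> (forall i, has_sum (fun j => F (i, j)) (g i)) -> has_sum g s.
Proof.
intros HF Hg eps Heps. destruct (HF (eps / 2)%R ltac:(lra)) as [L0 H0].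
exists (map fst L0). intros K HK Hi.
(* U approximates the rows over K: it contains the part of L0 lying over K, and its sum is within
   eta per row of the sum of g. For a K containing [map fst L0] it therefore contains all of L0. *)
assert (Hex : forall eta, (0 < eta)%R -> forall K, NoDup K -> exists U, NoDup U /\
  (forall p, In p U -> In (fst p) K) /\ (forall p, In p L0 -> In (fst p) K -> In p U) /\
  (Cmod (lsum F U - lsum g K) <= eta * INR (length K))%R).
{ intros eta Heta. clear K HK Hi. induction K as [|i K IH]; intros HK.
  - exists []. split; [constructor|]. split; [simpl; tauto|]. split; [simpl; tauto|]. simpl.
    replace (0 - 0) with (RtoC 0) by ring. rewrite Cmod_0. lra.
  - inversion_clear HK. destruct (IH H1) as (U & U1 & U2 & U3 & U4).
    destruct (Hg i eta Heta) as [J0 HJ].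
    set (Ji := nodup ceq_dec (J0 ++ map snd L0)).
    exists (map (pair i) Ji ++ U). split.
    { apply NoDup_app; [|assumption|].
      - apply FinFun.Injective_map_NoDup; [intros x y E; now inversion E|apply NoDup_nodup].
      - intros p Hp Hp2. apply in_map_iff in Hp. destruct Hp as (j & <- & _). apply U2 in Hp2. contradiction. }
    split. { intros p Hp. apply in_app_iff in Hp. destruct Hp as [Hp|Hp]; [|right; now apply U2].
      apply in_map_iff in Hp. destruct Hp as (j & <- & _). now left. }
    split. { intros p Hp [E|E]; apply in_app_iff; [left|right; now apply U3]. destruct p as [i' j]. simpl in E. subst i'.
      apply in_map. apply nodup_In, in_app_iff. right. apply in_map_iff. now exists (i, j). }
    rewrite lsum_app, lsum_map. cbn [lsum fold_right]. fold (lsum g K).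
    specialize (HJ Ji (NoDup_nodup _ _)).
    assert (HJ' : incl J0 Ji). { intros x Hx. apply nodup_In, in_app_iff. now left. }
    specialize (HJ HJ').
    replace (lsum (fun k => F (i, k)) Ji + lsum F U - (g i + lsum g K)) with
      ((lsum (fun k => F (i, k)) Ji - g i) + (lsum F U - lsum g K)) by ring.
    cbn [length]. rewrite S_INR. eapply Rle_trans; [apply Cmod_triangle|]. lra. }
assert (HlK := pos_INR (length K)).
destruct (Hex (eps / (2 * (INR (length K) + 1)))%R ltac:(apply Rdiv_lt_0_compat; lra) K HK) as (U & U1 & U2 & U3 & U4).
assert (HU : incl L0 U). { intros p Hp. apply U3; [assumption|]. now apply Hi, in_map. }
specialize (H0 U U1 HU).
replace (lsum g K - s) with (- (lsum F U - lsum g K) + (lsum F U - s)) by ring.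
eapply Rle_lt_trans; [apply Cmod_triangle|]. rewrite Cmod_opp.
assert (eps / (2 * (INR (length K) + 1)) * INR (length K) <= eps / 2)%R; [|lra].
replace (eps / (2 * (INR (length K) + 1)) * INR (length K))%R with ((eps / 2) * (INR (length K) / (INR (length K) + 1)))%R by (field; lra).
rewrite <- (Rmult_1_r (eps / 2)) at 2. apply Rmult_le_compat_l; [lra|]. apply Rle_div_l; lra.
Qed.

Lemma rsummable_le {I} (b c : I -> R) : (forall i, (0 <= b i <= c i)%R) -> rsummable c -> rsummable b.
Proof.
intros Hbc [_ [M HM]]. split; [intros; apply Hbc|]. exists M. intros L HL.
eapply Rle_trans; [apply rsum_le|now apply HM]. intros; apply Hbc.
Qed.

Lemma rsummable_scal {I} (c : R) (b : I -> R) : (0 <= c)%R -> rsummable b -> rsummable (fun i => c * b i)%R.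
Proof.
intros Hc [H0 [M HM]]. split. { intros; now apply Rmult_le_pos. }
exists (c * M)%R. intros L HL. rewrite rsum_scal. apply Rmult_le_compat_l; auto.
Qed.

Lemma rsummable_inj {I J} (j : J -> I) (b : I -> R) : (forall k k', j k = j k' -> k = k') ->
  rsummable b -> rsummable (fun k => b (j k)).
Proof.
intros Hj [H0 [M HM]]. split; [auto|]. exists M. intros L HL. rewrite <- rsum_map. apply HM.
now apply FinFun.Injective_map_NoDup.
Qed.

Lemma rsum_list_prod {I J} (b : I -> R) (c : J -> R) L1 L2 :
  (rsum (fun p => b (fst p) * c (snd p)) (list_prod L1 L2) = rsum b L1 * rsum c L2)%R.
Proof.
induction L1; simpl; [ring|]. rewrite rsum_app, rsum_map, IHL1. simpl. rewrite rsum_scal. ring.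
Qed.

Lemma rsummable_prod {I J} (b : I -> R) (c : J -> R) : rsummable b -> rsummable c ->
  rsummable (fun p : I * J => b (fst p) * c (snd p))%R.
Proof.
intros [H0 [M HM]] [H1 [N HN]]. split. { intros; now apply Rmult_le_pos. }
exists (M * N)%R. intros L HL.
set (L1 := nodup ceq_dec (map fst L)). set (L2 := nodup ceq_dec (map snd L)).
eapply Rle_trans; [apply (rsum_incl _ L (list_prod L1 L2))|].
- intros; now apply Rmult_le_pos.
- assumption.
- intros [i j] Hp. apply in_prod; apply nodup_In; apply in_map_iff; now exists (i, j).
- rewrite rsum_list_prod. apply Rmult_le_compat; try apply rsum_ge0; auto.
  + apply HM, NoDup_nodup.
  + apply HN, NoDup_nodup.
Qed.

Lemma rsummable_nat (b : nat -> R) (M : R) : (forall n, (0 <= b n)%R) ->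
  (forall n, (rsum b (seq 0 n) <= M)%R) -> rsummable b.
Proof.
intros Hb HM. split; [assumption|]. exists M. intros L HL.
eapply Rle_trans; [apply (rsum_incl b L (seq 0 (S (list_max L)))); auto|apply HM].
intros x Hx. apply in_seq. assert (H := proj1 (list_max_le L (list_max L)) (le_n _)).
rewrite Forall_forall in H. specialize (H x Hx). lia.
Qed.

Lemma rsummable_has_sum {I} (b : I -> R) : rsummable b -> exists s : R, has_sum (fun i => RtoC (b i)) s.
Proof.
intros [H0 [M HM]].
destruct (completeness (fun x => exists L, NoDup L /\ x = rsum b L)) as [s [H1 H2]].
- exists M. intros x (L & HL & ->). auto.
- exists 0%R. exists []. split; [constructor|reflexivity].
- exists s. intros eps Heps.
  destruct (excluded_middle_informative (exists L, NoDup L /\ (s - eps < rsum b L)%R)) as [(L0 & HL0 & Hs)|N].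
  + exists L0. intros L HL Hi. rewrite lsum_RtoC, <- RtoC_minus, Cmod_R.
    assert (rsum b L <= s)%R by (apply H1; now exists L).
    assert (rsum b L0 <= rsum b L)%R by now apply rsum_incl.
    apply Rabs_lt_between. lra.
  + exfalso. assert (s <= s - eps)%R; [|lra]. apply H2. intros x (L & HL & ->).
    apply Rnot_lt_le. intros Hlt. apply N. now exists L.
Qed.

(** Re f + |f| and Im f + |f| are non-negative and at most 2 |f|, which reduces the claim to bounded
    sums of non-negative terms. *)
Lemma summable_has_sum {I} (f : I -> C) : rsummable (fun i => Cmod (f i)) -> exists s, has_sum f s.
Proof.
intros Hf. destruct (rsummable_has_sum _ Hf) as [m Hm].
destruct (rsummable_has_sum (fun i => Re (f i) + Cmod (f i)))%R as [a Ha].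
{ apply (rsummable_le _ (fun i => 2 * Cmod (f i))%R); [|now apply rsummable_scal; [lra|]].
  intros i. assert (T := re_le_Cmod (f i)). apply Rabs_le_between in T. lra. }
destruct (rsummable_has_sum (fun i => Im (f i) + Cmod (f i)))%R as [b Hb].
{ apply (rsummable_le _ (fun i => 2 * Cmod (f i))%R); [|now apply rsummable_scal; [lra|]].
  intros i. assert (T := Im_le_Cmod (f i)). apply Rabs_le_between in T. lra. }
eexists. eapply has_sum_ext; [|exact (has_sum_plus _ _ _ _ (has_sum_minus _ _ _ _ Ha Hm) (has_sum_scal Ci _ _ (has_sum_minus _ _ _ _ Hb Hm)))].
intros i. simpl. apply injective_projections; simpl; unfold Re, Im; ring.
Qed.

Lemma has_sum_bound {I} (f : I -> C) s (M : R) :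
  (forall L, NoDup L -> (rsum (fun i => Cmod (f i)) L <= M)%R) -> has_sum f s -> (Cmod s <= M)%R.
Proof.
intros HM Hs. apply Rle_plus_epsilon. intros eps Heps. destruct (Hs eps Heps) as [L0 H0].
specialize (H0 (nodup ceq_dec L0) (NoDup_nodup _ _)).
assert (Hi : incl L0 (nodup ceq_dec L0)) by (intros x Hx; now apply nodup_In).
specialize (H0 Hi). specialize (HM _ (NoDup_nodup ceq_dec L0)).
assert (T := Cmod_lsum f (nodup ceq_dec L0)).
replace s with (lsum f (nodup ceq_dec L0) + - (lsum f (nodup ceq_dec L0) - s)) by ring.
eapply Rle_trans; [apply Cmod_triangle|]. rewrite Cmod_opp. lra.
Qed.

Lemma has_sum_prod {I J} (f : I -> C) (g : J -> C) s t :
  rsummable (fun i => Cmod (f i)) -> rsummable (fun j => Cmod (g j)) -> has_sum f s -> has_sum g t ->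
  has_sum (fun p : I * J => f (fst p) * g (snd p)) (s * t).
Proof.
intros Hf Hg Hs Ht.
destruct (summable_has_sum (fun p : I * J => f (fst p) * g (snd p))) as [u Hu].
{ eapply rsummable_le; [|exact (rsummable_prod _ _ Hf Hg)]. intros p. rewrite Cmod_mult.
  split; [apply Rmult_le_pos; apply Cmod_ge_0|apply Rle_refl]. }
assert (E : has_sum (fun i => f i * t) u).
{ apply (has_sum_fubini (fun p : I * J => f (fst p) * g (snd p))); [exact Hu|]. intros i. simpl. now apply has_sum_scal. }
replace (s * t) with u; [exact Hu|]. apply (has_sum_unique (fun i => f i * t)); [exact E|].
rewrite Cmult_comm. eapply has_sum_ext; [|exact (has_sum_scal t _ _ Hs)]. intros; simpl; ring.
Qed.

Lemma lsum_Re {I} (f : I -> C) L : Re (lsum f L) = rsum (fun i => Re (f i)) L.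
Proof. induction L; simpl; [reflexivity|]. now rewrite <- IHL. Qed.
Lemma lsum_Im {I} (f : I -> C) L : Im (lsum f L) = rsum (fun i => Im (f i)) L.
Proof. induction L; simpl; [reflexivity|]. now rewrite <- IHL. Qed.

Lemma sum_n_rsum (a : nat -> R) n : sum_n a n = rsum a (seq 0 (S n)).
Proof.
induction n.
- rewrite sum_O. simpl. ring.
- rewrite sum_Sn, IHn, (seq_S (S n)), rsum_app. unfold plus; simpl. ring.
Qed.

(** Initial segments of nat eventually contain any finite set, so the unordered sum is also the
    limit of the ordered partial sums used in [lambert]. *)
Lemma has_sum_CSeries (a : nat -> C) s : has_sum a s -> CSeries a = s.
Proof.
intros H.
assert (HR : forall (p : C -> R) (b : nat -> R), (forall n, p (lsum a (seq 0 n)) = rsum b (seq 0 n)) ->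
  (forall z w, (Rabs (p z - p w) <= Cmod (z - w))%R) -> is_series b (p s)).
{ intros p b Hb Hp. apply (proj2 (filterlim_locally (sum_n b) (p s))). intros eps.
  destruct (H eps (cond_pos eps)) as [L0 H0]. exists (list_max L0). intros n Hn.
  change (Rabs (sum_n b n - p s) < eps)%R. rewrite sum_n_rsum, <- Hb.
  eapply Rle_lt_trans; [apply Hp|]. apply H0; [apply seq_NoDup|].
  intros x Hx. apply in_seq. assert (Hm := proj1 (list_max_le L0 (list_max L0)) (le_n _)).
  rewrite Forall_forall in Hm. specialize (Hm x Hx). lia. }
unfold CSeries. apply injective_projections; simpl; apply is_series_unique.
- apply (HR Re); [intros; apply lsum_Re|]. intros z w. exact (re_le_Cmod (z - w)).
- apply (HR Im); [intros; apply lsum_Im|]. intros z w. exact (Im_le_Cmod (z - w)).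
Qed.

(** Tannery's theorem, shaped for [dyadic_sum]: the finite sums over [Ln n] all have the same value
    c while their terms converge under the common bound b. *)
Lemma tannery {I} (f : I -> C) (fn : nat -> I -> C) (b : I -> R) (Ln : nat -> list I) (c : C) :
  rsummable b -> (forall i, (Cmod (f i) <= b i)%R) ->
  (forall n i, In i (Ln n) -> (Cmod (fn n i) <= b i)%R) ->
  (forall n, NoDup (Ln n)) ->
  (forall i, exists N, forall n, (N <= n)%nat -> In i (Ln n)) ->
  (forall i eps, (0 < eps)%R -> exists N, forall n, (N <= n)%nat -> (Cmod (fn n i - f i) < eps)%R) ->
  (forall n, lsum (fn n) (Ln n) = c) -> has_sum f c.
Proof.
intros Hb Hfb Hfnb HLn Hex Hlim Hc.
destruct (rsummable_has_sum b Hb) as [B HB].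
intros eps Heps. destruct (HB (eps / 8)%R ltac:(lra)) as [L0 H0].
(* The final estimate adds three errors of size eps / 4: the tails of f and of [fn n] outside K, and
   the change of terms on K. *)
assert (Htail : forall L, NoDup L -> (forall i, In i L -> ~ In i L0) -> (rsum b L <= eps / 4)%R).
{ intros L HL Hd. set (K := nodup ceq_dec L0).
  assert (HK : incl L0 K) by (intros x Hx; now apply nodup_In).
  assert (H1 := H0 K (NoDup_nodup _ _) HK).
  assert (H2 := H0 (L ++ K)). rewrite !lsum_RtoC, <- !RtoC_minus, !Cmod_R in *.
  rewrite rsum_app in H2. apply Rabs_lt_between in H1.
  assert (H3 : (Rabs (rsum b L + rsum b K - B) < eps / 8)%R).
  { apply H2.
    - apply NoDup_app; [assumption|apply NoDup_nodup|]. intros x Hx Hx2. apply nodup_In in Hx2. now apply (Hd x).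
    - intros x Hx. apply in_app_iff. right. auto. }
  apply Rabs_lt_between in H3. lra. }
set (K := nodup ceq_dec L0).
exists L0. intros L HL Hi.
assert (HN : exists n, incl K (Ln n) /\ forall i, In i K -> (Cmod (fn n i - f i) * (INR (length K) + 1) < eps / 4)%R).
{ assert (Hk := pos_INR (length K)).
  assert (HA : exists N, forall n, (N <= n)%nat -> forall i, In i K -> In i (Ln n) /\ (Cmod (fn n i - f i) < eps / 4 / (INR (length K) + 1))%R).
  { generalize K at 1. intros K'. induction K' as [|a K' IH].
    - exists 0%nat. simpl. tauto.
    - destruct IH as [N HN]. destruct (Hex a) as [N1 H1].
      destruct (Hlim a (eps / 4 / (INR (length K) + 1))%R) as [N2 H2]. { apply Rdiv_lt_0_compat; lra. }
      exists (Nat.max N (Nat.max N1 N2)). intros n Hn i [<-|Hin].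
      + split; [apply H1; lia|apply H2; lia].
      + apply HN; [lia|assumption]. }
  destruct HA as [N HN]. exists N. split.
  - intros x Hx. now apply HN.
  - intros i Hin. destruct (HN N (le_n _) i Hin) as [_ H1]. apply Rlt_div_r in H1; lra. }
destruct HN as (n & HK & Hn).
assert (Hsplit : forall (g : I -> C) M, NoDup M -> incl K M -> (forall i, In i M -> (Cmod (g i) <= b i)%R) ->
  (Cmod (lsum g M - lsum g K) <= eps / 4)%R).
{ intros g M HM HKM Hg. set (T := filter (fun i => if in_dec ceq_dec i K then false else true) M).
  assert (HT : forall i, In i T <-> In i M /\ ~ In i K).
  { intros i. unfold T. rewrite filter_In. destruct (in_dec ceq_dec i K); intuition congruence. }
  assert (E : lsum g M = lsum g T + lsum g K).
  { rewrite <- lsum_app.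
    assert (HND : NoDup (T ++ K)).
    { apply NoDup_app; [apply NoDup_filter; assumption|apply NoDup_nodup|]. intros x Hx. now apply HT in Hx. }
    apply lsum_incl; [assumption|assumption| |].
    - intros x Hx. apply in_app_iff in Hx. destruct Hx as [Hx|Hx]; [now apply HT|auto].
    - intros i Hi1 Hi2. exfalso. apply Hi2, in_app_iff. destruct (in_dec ceq_dec i K); [now right|left; now apply HT]. }
  rewrite E. replace (lsum g T + lsum g K - lsum g K) with (lsum g T) by ring.
  eapply Rle_trans; [apply Cmod_lsum|]. eapply Rle_trans; [apply (rsum_le _ b)|].
  - intros i Hin. apply Hg. now apply HT in Hin.
  - apply Htail; [apply NoDup_filter; assumption|]. intros i Hin. apply HT in Hin. intros Hin2. apply (proj2 Hin). now apply nodup_In. }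
assert (HKL : incl K L). { intros x Hx. apply nodup_In in Hx. auto. }
assert (S1 := Hsplit f L HL HKL (fun i _ => Hfb i)).
assert (S2 := Hsplit (fn n) (Ln n) (HLn n) HK (fun i Hin => Hfnb n i Hin)). rewrite Hc in S2.
assert (S3 : (Cmod (lsum (fn n) K - lsum f K) <= eps / 4)%R).
{ replace (lsum (fn n) K - lsum f K) with (lsum (fun i => fn n i - f i) K).
  2:{ generalize K. induction K0; simpl; [ring|]. rewrite IHK0. ring. }
  eapply Rle_trans; [apply Cmod_lsum|].
  assert (Hk := pos_INR (length K)).
  apply Rle_trans with (rsum (fun _ : I => eps / 4 / (INR (length K) + 1))%R K).
  - apply rsum_le. intros i Hin. apply Rle_div_r; [lra|]. apply Rlt_le. now apply Hn.
  - assert (E : forall K' : list I, rsum (fun _ : I => eps / 4 / (INR (length K) + 1))%R K' = (INR (length K') * (eps / 4 / (INR (length K) + 1)))%R).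
    { induction K' as [|x K' IH]; [simpl; ring|]. cbn [length rsum fold_right]. rewrite S_INR. unfold rsum in IH. rewrite IH. ring. }
    rewrite E. replace (INR (length K) * (eps / 4 / (INR (length K) + 1)))%R with (eps / 4 * (INR (length K) / (INR (length K) + 1)))%R by (field; lra).
    rewrite <- (Rmult_1_r (eps / 4)) at 2. apply Rmult_le_compat_l; [lra|]. apply Rle_div_l; lra. }
replace (lsum f L - c) with ((lsum f L - lsum f K) + (- (lsum (fn n) K - lsum f K) + - (c - lsum (fn n) K))) by ring.
eapply Rle_lt_trans; [apply Cmod_triangle|].
assert (T := Cmod_triangle (- (lsum (fn n) K - lsum f K)) (- (c - lsum (fn n) K))).
rewrite !Cmod_opp in T. lra.
Qed.

(** * The exponential and series in the nome *)

Lemma Cexp_0 : Cexp 0 = 1.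
Proof. unfold Cexp; simpl. rewrite exp_0, cos_0, sin_0. apply injective_projections; simpl; ring. Qed.

Lemma Cexp_plus (z w : C) : Cexp (z + w) = Cexp z * Cexp w.
Proof.
unfold Cexp. rewrite re_plus, im_plus, exp_plus, cos_plus, sin_plus.
apply injective_projections; simpl; ring.
Qed.

Lemma Cmod_Cexp (z : C) : Cmod (Cexp z) = exp (Re z).
Proof.
unfold Cmod, Cexp. simpl fst; simpl snd.
replace ((exp (Re z) * cos (Im z)) ^ 2 + (exp (Re z) * sin (Im z)) ^ 2)%R with ((exp (Re z)) ^ 2)%R.
- apply sqrt_pow2, Rlt_le, exp_pos.
- assert (H := sin2_cos2 (Im z)). unfold Rsqr in H.
  transitivity (exp (Re z) ^ 2 * (sin (Im z) * sin (Im z) + cos (Im z) * cos (Im z)))%R; [rewrite H; ring|ring].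
Qed.

Lemma Cexp_INR (n : nat) (z : C) : Cexp (INR n * z) = Cexp z ^ n.
Proof.
induction n.
- simpl. rewrite Cmult_0_l. apply Cexp_0.
- rewrite S_INR, RtoC_plus. replace ((INR n + 1) * z) with (z + INR n * z) by ring.
  rewrite Cexp_plus, IHn. reflexivity.
Qed.

Lemma exp_sub_1_bound (x : R) : (Rabs (exp x - 1) <= Rabs x * exp (Rabs x))%R.
Proof.
assert (H1 := exp_ineq1_le x). assert (H2 := exp_ineq1_le (- x)).
assert (He := exp_pos x). assert (He' := exp_pos (- x)).
assert (Hm : (exp x * exp (- x) = 1)%R) by (rewrite <- exp_plus, Rplus_opp_r; apply exp_0).
destruct (Rle_lt_dec 0 x) as [Hx|Hx].
- rewrite (Rabs_pos_eq x) by lra. rewrite Rabs_pos_eq by lra. nra.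
- rewrite (Rabs_left x) by lra.
  assert (exp x < 1)%R by (rewrite <- exp_0; apply exp_increasing; lra).
  rewrite Rabs_left by lra. nra.
Qed.

Lemma exp_taylor_bound (x : R) : (Rabs (exp x - 1 - x) <= x ^ 2 * exp (Rabs x))%R.
Proof.
assert (H1 := exp_ineq1_le x). assert (H2 := exp_ineq1_le (- x)).
assert (He := exp_pos x). assert (He' := exp_pos (- x)).
assert (Hm : (exp x * exp (- x) = 1)%R) by (rewrite <- exp_plus, Rplus_opp_r; apply exp_0).
rewrite Rabs_pos_eq by lra.
destruct (Rle_lt_dec 0 x) as [Hx|Hx].
- rewrite (Rabs_pos_eq x) by lra. nra.
- rewrite (Rabs_left x) by lra.
  assert (1 <= exp (- x))%R by lra.
  assert (exp x * (1 - x) <= 1)%R by nra. nra.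
Qed.

Lemma sin_bound_abs (y : R) : (Rabs (sin y) <= Rabs y)%R.
Proof.
destruct (MVT_gen sin 0 y cos) as [c [_ Hc]].
- intros x _. apply is_derive_sin.
- intros x _. apply continuity_sin.
- rewrite sin_0, !Rminus_0_r in Hc. rewrite Hc, Rabs_mult.
  assert (Rabs (cos c) <= 1)%R by (apply Rabs_le, COS_bound).
  assert (H2 := Rabs_pos y). nra.
Qed.

Lemma cos_sub_1_bound (y : R) : (Rabs (cos y - 1) <= y ^ 2)%R.
Proof.
replace (cos y - 1)%R with (- (2 * (sin (y / 2) * sin (y / 2))))%R.
2:{ replace y with (2 * (y / 2))%R at 3 by field. rewrite cos_2a_sin. ring. }
rewrite Rabs_Ropp, Rabs_mult, Rabs_mult, (Rabs_pos_eq 2) by lra.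
assert (H := sin_bound_abs (y / 2)). assert (H0 := Rabs_pos (sin (y / 2))).
assert (E : (Rabs (y / 2) * Rabs (y / 2) = y ^ 2 / 4)%R) by (rewrite <- Rabs_mult, Rabs_pos_eq by nra; field).
assert (0 <= y ^ 2)%R by apply pow2_ge_0. nra.
Qed.

Lemma sin_sub_bound (y : R) : (Rabs (sin y - y) <= y ^ 2)%R.
Proof.
destruct (MVT_gen (fun x => sin x - x)%R 0 y (fun x => cos x - 1)%R) as [c [Hc1 Hc]].
- intros x _. auto_derive; [exact I|ring].
- intros x _. apply continuity_pt_minus; [apply continuity_sin|apply continuity_pt_id].
- rewrite sin_0, !Rminus_0_r in Hc. rewrite Hc, Rabs_mult.
  assert (Hcy : (Rabs c <= Rabs y)%R).
  { unfold Rmin, Rmax in Hc1. destruct (Rle_dec 0 y).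
    - rewrite !Rabs_pos_eq; lra.
    - rewrite !Rabs_left1; lra. }
  assert (HB : (Rabs (cos c - 1) <= Rabs c)%R).
  { destruct (MVT_gen cos 0 c (fun x => - sin x)%R) as [d [_ Hd]].
    - intros x _. apply is_derive_cos.
    - intros x _. apply continuity_cos.
    - rewrite cos_0, Rminus_0_r in Hd. rewrite Hd, Rabs_mult, Rabs_Ropp.
      assert (Rabs (sin d) <= 1)%R by (apply Rabs_le, SIN_bound). assert (H2 := Rabs_pos c). nra. }
  assert (E : (Rabs y * Rabs y = y ^ 2)%R) by (rewrite <- Rabs_mult, Rabs_pos_eq by nra; ring).
  assert (H2 := Rabs_pos y). nra.
Qed.

(** The real and imaginary parts of the remainder split into four real terms, each at most |z|^2
    e^|z|; the constant 5 leaves slack. *)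
Lemma Cexp_taylor_bound (z : C) :
  (Cmod (Cexp z - 1 - z) <= 5 * (Cmod z * Cmod z) * exp (Cmod z))%R.
Proof.
set (x := Re z). set (y := Im z). set (m := Cmod z).
assert (Hx : (Rabs x <= m)%R) by apply re_le_Cmod. assert (Hy : (Rabs y <= m)%R) by apply Im_le_Cmod.
assert (Hx0 := Rabs_pos x). assert (Hy0 := Rabs_pos y).
assert (He1 : (exp x <= exp m)%R). { assert (x <= m)%R by (eapply Rle_trans; [apply Rle_abs|exact Hx]). destruct H; [left; now apply exp_increasing|right; now f_equal]. }
assert (He2 : (exp (Rabs x) <= exp m)%R). { destruct Hx as [H|H]; [left; now apply exp_increasing|right; now f_equal]. }
assert (He3 : (1 <= exp m)%R). { assert (H := exp_ineq1_le m). lra. }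
assert (He0 := exp_pos x). assert (He4 := exp_pos (Rabs x)).
assert (Ex : (x ^ 2 = Rabs x * Rabs x)%R) by (rewrite <- Rabs_mult, Rabs_pos_eq by nra; ring).
assert (Ey : (y ^ 2 = Rabs y * Rabs y)%R) by (rewrite <- Rabs_mult, Rabs_pos_eq by nra; ring).
assert (Hxx : (x ^ 2 <= m * m)%R) by (rewrite Ex; apply Rmult_le_compat; auto).
assert (Hyy : (y ^ 2 <= m * m)%R) by (rewrite Ey; apply Rmult_le_compat; auto).
assert (Hxy : (Rabs x * Rabs y <= m * m)%R) by (apply Rmult_le_compat; auto).
eapply Rle_trans; [apply Cmod_le_Re_Im|].
replace (Re (Cexp z - 1 - z)) with ((exp x - 1 - x) + exp x * (cos y - 1))%R by (unfold x, y, Cexp, Re, Im; simpl; ring).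
replace (Im (Cexp z - 1 - z)) with ((exp x - 1) * sin y + (sin y - y))%R by (unfold x, y, Cexp, Re, Im; simpl; ring).
assert (T1 := Rabs_triang (exp x - 1 - x) (exp x * (cos y - 1))).
assert (T2 := Rabs_triang ((exp x - 1) * sin y) (sin y - y)).
rewrite Rabs_mult, (Rabs_pos_eq (exp x)) in T1 by lra. rewrite Rabs_mult in T2.
assert (B1 := exp_taylor_bound x). assert (B2 := cos_sub_1_bound y). assert (B3 := exp_sub_1_bound x).
assert (B4 := sin_bound_abs y). assert (B5 := sin_sub_bound y).
assert (C1 : (x ^ 2 * exp (Rabs x) <= m * m * exp m)%R) by (apply Rmult_le_compat; auto; [apply pow2_ge_0|lra]).
assert (C2 : (exp x * Rabs (cos y - 1) <= exp m * (m * m))%R) by (apply Rmult_le_compat; auto; [lra|apply Rabs_pos|lra]).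
assert (C3 : (Rabs (exp x - 1) * Rabs (sin y) <= (Rabs x * exp (Rabs x)) * Rabs y)%R) by (apply Rmult_le_compat; auto; apply Rabs_pos).
assert (C4 : (Rabs x * Rabs y * exp (Rabs x) <= m * m * exp m)%R) by (apply Rmult_le_compat; auto; [nra|lra]).
assert (C5 : (m * m * 1 <= m * m * exp m)%R) by (apply Rmult_le_compat_l; [nra|lra]).
nra.
Qed.

Lemma Cmod_nome (tau : C) : Cmod (nome tau) = exp (- (2 * PI * Im tau)).
Proof.
unfold nome. rewrite Cmod_Cexp. f_equal. simpl. unfold Re, Im. ring.
Qed.

Lemma nome_lt_1 (tau : C) : upper tau -> (Cmod (nome tau) < 1)%R.
Proof.
intros H. rewrite Cmod_nome, <- exp_0. apply exp_increasing. unfold upper in H. assert (HP := PI_RGT_0). nra.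
Qed.

Lemma nome_plus (tau h : C) : nome (tau + h) = nome tau * nome h.
Proof. unfold nome. rewrite <- Cexp_plus. f_equal. ring. Qed.

Lemma exp_pow (x : R) (n : nat) : (exp x ^ n = exp (INR n * x))%R.
Proof.
induction n; simpl pow. rewrite Rmult_0_l. now rewrite exp_0.
rewrite IHn, <- exp_plus, S_INR. f_equal. ring.
Qed.

(** The second-order Taylor remainders of the single terms are summed directly: a term with exponent
    m contributes at most a constant times |h|^2 |c| m^2 rho^m. *)
Lemma nome_series_derive {I} (c : I -> C) (n : I -> nat) (F F' : C -> C) (tau : C) :
  (forall rho, (0 < rho < 1)%R -> rsummable (fun i => Cmod (c i) * (INR (n i) ^ 2 * rho ^ n i))%R) ->
  (forall t, upper t -> has_sum (fun i => c i * nome t ^ n i) (F t)) ->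
  has_sum (fun i => INR (n i) * (c i * nome tau ^ n i)) (F' tau) -> upper tau ->
  is_Cderive F tau (2 * PI * Ci * F' tau).
Proof.
intros Hs HF HF' Ht. assert (HP := PI_RGT_0).
set (y := Im tau). assert (Hy : (0 < y)%R) by exact Ht.
(* rho is |q| at half the height of tau; for |h| < y / 2 it absorbs the factor e^(2 pi m |h|) of the
   Taylor remainder. *)
set (rho := exp (- (PI * y))).
assert (Hrho : (0 < rho < 1)%R). { split; [apply exp_pos|]. unfold rho. rewrite <- exp_0. apply exp_increasing. nra. }
destruct (Hs rho Hrho) as [Hpos [M HM]].
assert (HM0 : (0 <= M)%R). { assert (T := HM [] (NoDup_nil _)). simpl in T. exact T. }
set (A := (5 * (2 * PI) * (2 * PI) * M + 1)%R).
assert (HA : (1 <= A)%R). { unfold A. assert (0 <= 5 * (2 * PI) * (2 * PI) * M)%R by (repeat first [lra | apply Rmult_le_pos]). lra. }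
apply is_Cderive_eps. intros eps Heps.
exists (Rmin (y / 2) (eps / A)). split. { apply Rmin_pos; [lra|apply Rdiv_lt_0_compat; lra]. }
intros w Hw.
assert (Hw1 : (Cmod (w - tau) < y / 2)%R) by (eapply Rlt_le_trans; [exact Hw|apply Rmin_l]).
assert (Hw2 : (Cmod (w - tau) < eps / A)%R) by (eapply Rlt_le_trans; [exact Hw|apply Rmin_r]).
assert (Hup : upper w) by (apply (upper_ball tau); unfold y in *; lra).
set (h := w - tau) in *. set (d := Cmod h) in *. assert (Hd : (0 <= d)%R) by apply Cmod_ge_0.
assert (HS := has_sum_minus _ _ _ _ (has_sum_minus _ _ _ _ (HF w Hup) (HF tau Ht)) (has_sum_scal (h * (2 * PI * Ci)) _ _ HF')).
replace (F w - F tau - h * (2 * PI * Ci) * F' tau) with (F w - F tau - h * (2 * PI * Ci * F' tau)) in HS by ring.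
apply (has_sum_bound _ _ (5 * (2 * PI) * (2 * PI) * (d * d) * M)) in HS.
- eapply Rle_trans; [exact HS|]. apply Rlt_div_r in Hw2; [|lra].
  replace (5 * (2 * PI) * (2 * PI) * (d * d) * M)%R with (5 * (2 * PI) * (2 * PI) * M * d * d)%R by ring.
  apply Rmult_le_compat_r; [exact Hd|].
  assert (5 * (2 * PI) * (2 * PI) * M * d <= A * d)%R by (apply Rmult_le_compat_r; [lra|unfold A; lra]). lra.
- intros L HL. specialize (HM L HL).
  apply Rle_trans with (5 * (2 * PI) * (2 * PI) * (d * d) * rsum (fun i => Cmod (c i) * (INR (n i) ^ 2 * rho ^ n i))%R L)%R.
  2:{ apply Rmult_le_compat_l; [repeat first [lra | apply Rmult_le_pos]|exact HM]. }
  rewrite <- rsum_scal. apply rsum_le. intros i _. set (m := n i).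
  assert (Hm := pos_INR m).
  set (z := INR m * (2 * PI * Ci * h)).
  assert (Ez : nome h ^ m = Cexp z) by (unfold nome, z; now rewrite Cexp_INR).
  replace (c i * nome w ^ m - c i * nome tau ^ m - h * (2 * PI * Ci) * (INR m * (c i * nome tau ^ m)))
    with (c i * nome tau ^ m * (Cexp z - 1 - z)).
  2:{ replace w with (tau + h) by (unfold h; ring). rewrite nome_plus, Cpow_mult_l, Ez. unfold z. ring. }
  assert (Cz : Cmod z = (INR m * (2 * PI) * d)%R).
  { unfold z. rewrite !Cmod_mult, Cmod_Ci, !Cmod_R, !Rabs_pos_eq by lra. fold d. ring. }
  rewrite Cmod_mult, Cmod_mult, Cmod_pow, Cmod_nome, exp_pow.
  eapply Rle_trans. { apply Rmult_le_compat_l; [apply Rmult_le_pos; [apply Cmod_ge_0|left; apply exp_pos]|apply Cexp_taylor_bound]. }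
  rewrite Cz. fold y.
  assert (HE : (exp (INR m * - (2 * PI * y)) * exp (INR m * (2 * PI) * d) <= rho ^ m)%R).
  { unfold rho. rewrite <- exp_plus, exp_pow.
    assert (HH : (INR m * - (2 * PI * y) + INR m * (2 * PI) * d <= INR m * - (PI * y))%R).
    { replace (INR m * - (2 * PI * y) + INR m * (2 * PI) * d)%R with (INR m * (- (2 * PI * y) + 2 * PI * d))%R by ring.
      apply Rmult_le_compat_l; [exact Hm|]. nra. }
    destruct HH as [HH|HH]; [left; now apply exp_increasing|right; now f_equal]. }
  replace (Cmod (c i) * exp (INR m * - (2 * PI * y)) * (5 * (INR m * (2 * PI) * d * (INR m * (2 * PI) * d)) * exp (INR m * (2 * PI) * d)))%R
    with ((5 * (2 * PI) * (2 * PI) * (d * d) * (Cmod (c i) * INR m ^ 2)) * (exp (INR m * - (2 * PI * y)) * exp (INR m * (2 * PI) * d)))%R by ring.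
  replace (5 * (2 * PI) * (2 * PI) * (d * d) * (Cmod (c i) * (INR m ^ 2 * rho ^ m)))%R
    with ((5 * (2 * PI) * (2 * PI) * (d * d) * (Cmod (c i) * INR m ^ 2)) * rho ^ m)%R by ring.
  apply Rmult_le_compat_l; [|exact HE].
  repeat first [lra | apply pow2_ge_0 | apply Cmod_ge_0 | apply Rmult_le_pos].
Qed.

(** * Lambert series as double series *)

(** The sum chosen classically, hence a total function; the value is arbitrary when no sum
    exists. *)
Definition Csum {I : Type} (f : I -> C) : C := epsilon (inhabits (RtoC 0)) (has_sum f).

Lemma Csum_unique {I} (f : I -> C) s : has_sum f s -> Csum f = s.
Proof.
intros H. apply (has_sum_unique f); [|exact H]. unfold Csum. apply epsilon_spec. now exists s.
Qed.

Lemma Csum_correct {I} (f : I -> C) : rsummable (fun i => Cmod (f i)) -> has_sum f (Csum f).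
Proof. intros H. destruct (summable_has_sum f H) as [s Hs]. now rewrite (Csum_unique f s Hs). Qed.

Lemma bernoulli_pow (s : R) (n : nat) : (0 <= s <= 1)%R -> (INR (S n) * s ^ n * (1 - s) <= 1 - s ^ S n)%R.
Proof.
intros Hs. induction n.
- simpl. lra.
- rewrite S_INR. assert (Hp : (0 <= s ^ S n)%R) by (apply pow_le; lra).
  assert (Hp1 : (s ^ S n <= 1)%R). { rewrite <- (pow1 (S n)). apply pow_incr. lra. }
  change (s ^ S (S n))%R with (s * s ^ S n)%R.
  assert (E : (s ^ S n = s * s ^ n)%R) by reflexivity.
  assert (H1 : (s * (INR (S n) * s ^ n * (1 - s)) <= s * (1 - s ^ S n))%R) by (apply Rmult_le_compat_l; lra).
  assert (H2 : (0 <= (1 - s) * (1 - s ^ S n))%R) by (apply Rmult_le_pos; lra).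
  rewrite E in *. nra.
Qed.

(** Write rho = s^2. By [bernoulli_pow] one factor s^n absorbs a factor n + 1 up to a constant,
    leaving the exponent p with ratio s; hence the induction is over all ratios. *)
Lemma rsummable_poly_geom (p : nat) : forall rho, (0 < rho < 1)%R ->
  rsummable (fun n => INR (S n) ^ p * rho ^ n)%R.
Proof.
induction p as [|p IH]; intros rho Hrho.
- apply (rsummable_nat _ (/ (1 - rho))).
  + intros n. simpl. rewrite Rmult_1_l. apply pow_le; lra.
  + intros n.
    assert (E : rsum (fun n => INR (S n) ^ 0 * rho ^ n)%R (seq 0 n) = ((1 - rho ^ n) / (1 - rho))%R).
    { induction n. - simpl. field. lra.
      - rewrite seq_S, rsum_app, IHn. simpl. field. lra. }
    rewrite E. unfold Rdiv. rewrite <- (Rmult_1_l (/ (1 - rho))) at 2. apply Rmult_le_compat_r.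
    * left. apply Rinv_0_lt_compat; lra.
    * assert (0 <= rho ^ n)%R by (apply pow_le; lra). lra.
- set (s := sqrt rho).
  assert (Hs0 : (0 < s)%R) by (apply sqrt_lt_R0; lra).
  assert (Hss : (s * s = rho)%R) by (apply sqrt_sqrt; lra).
  assert (Hs1 : (s < 1)%R) by nra.
  apply (rsummable_le _ (fun n => / (1 - s) * (INR (S n) ^ p * s ^ n))%R).
  2:{ apply rsummable_scal; [left; apply Rinv_0_lt_compat; lra|]. apply IH. lra. }
  intros n. assert (Hn := pos_INR (S n)). assert (Hp : (0 <= INR (S n) ^ p)%R) by now apply pow_le.
  assert (Hsn : (0 <= s ^ n)%R) by (apply pow_le; lra). split.
  + apply Rmult_le_pos; apply pow_le; lra.
  + rewrite <- Hss, Rpow_mult_distr. change (INR (S n) ^ S p)%R with (INR (S n) * INR (S n) ^ p)%R.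
    replace (INR (S n) * INR (S n) ^ p * (s ^ n * s ^ n))%R with ((INR (S n) * s ^ n) * (INR (S n) ^ p * s ^ n))%R by ring.
    apply Rmult_le_compat_r; [nra|].
    assert (B := bernoulli_pow s n ltac:(lra)). assert (0 <= s ^ S n)%R by (apply pow_le; lra).
    apply Rmult_le_reg_r with (1 - s)%R; [lra|]. rewrite Rinv_l by lra. lra.
Qed.

Lemma pow_le_1_mono (r : R) (m n : nat) : (0 < r < 1)%R -> (m <= n)%nat -> (r ^ n <= r ^ m)%R.
Proof.
intros Hr Hmn. replace n with (m + (n - m))%nat by lia. rewrite pow_add.
rewrite <- (Rmult_1_r (r ^ m)) at 2. apply Rmult_le_compat_l; [apply pow_le; lra|].
rewrite <- (pow1 (n - m)). apply pow_incr. lra.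
Qed.

(** The series [lam p r tau] below is the sum of A^p X^r q^(A X) over A, X >= 1; the index
    (a, x) stands for A = a + 1 and X = x + 1. *)
Definition lamw (p r : nat) (i : nat * nat) : R := (INR (S (fst i)) ^ p * INR (S (snd i)) ^ r)%R.
Definition lamn (i : nat * nat) : nat := (S (fst i) * S (snd i))%nat.

Lemma lamw_pos p r i : (0 <= lamw p r i)%R.
Proof. apply Rmult_le_pos; apply pow_le, pos_INR. Qed.

(** Since (a+1)(x+1) >= a + x, the product of two single series dominates. *)
Lemma lam_summable (p r : nat) (rho : R) : (0 < rho < 1)%R ->
  rsummable (fun i => lamw p r i * rho ^ lamn i)%R.
Proof.
intros Hr. eapply rsummable_le; [|exact (rsummable_prod _ _ (rsummable_poly_geom p rho Hr) (rsummable_poly_geom r rho Hr))].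
intros [a x]. unfold lamw, lamn. simpl fst; simpl snd.
assert (Ha : (0 <= INR (S a) ^ p)%R) by apply pow_le, pos_INR.
assert (Hx : (0 <= INR (S x) ^ r)%R) by apply pow_le, pos_INR.
assert (Hp : (0 <= rho ^ (S a * S x))%R) by (apply pow_le; lra).
split. { repeat first [assumption | apply Rmult_le_pos]. }
replace (INR (S a) ^ p * rho ^ a * (INR (S x) ^ r * rho ^ x))%R with (INR (S a) ^ p * INR (S x) ^ r * (rho ^ a * rho ^ x))%R by ring.
apply Rmult_le_compat_l; [now apply Rmult_le_pos|]. rewrite <- pow_add. apply pow_le_1_mono; [exact Hr|lia].
Qed.

Definition lam (p r : nat) (tau : C) : C := Csum (fun i => RtoC (lamw p r i) * nome tau ^ lamn i).

Lemma nome_pos (tau : C) : (0 < Cmod (nome tau))%R.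
Proof. rewrite Cmod_nome. apply exp_pos. Qed.

Lemma lam_summable_C p r tau : upper tau ->
  rsummable (fun i => Cmod (RtoC (lamw p r i) * nome tau ^ lamn i)).
Proof.
intros Ht. eapply rsummable_le; [|apply (lam_summable p r (Cmod (nome tau)))].
- intros i. rewrite Cmod_mult, Cmod_pow, Cmod_R, Rabs_pos_eq by apply lamw_pos.
  split; [apply Rmult_le_pos; [apply lamw_pos|apply pow_le, Cmod_ge_0]|apply Rle_refl].
- split; [apply nome_pos|now apply nome_lt_1].
Qed.

Lemma lam_correct p r tau : upper tau ->
  has_sum (fun i => RtoC (lamw p r i) * nome tau ^ lamn i) (lam p r tau).
Proof. intros Ht. apply Csum_correct. now apply lam_summable_C. Qed.

(** D multiplies a term by its exponent A X, which raises both powers by one. *)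
Lemma lam_derive p r tau : upper tau ->
  is_Cderive (lam p r) tau (2 * PI * Ci * lam (S p) (S r) tau).
Proof.
intros Ht. apply (nome_series_derive (fun i => RtoC (lamw p r i)) lamn).
- intros rho Hr. eapply rsummable_le; [|exact (lam_summable (S (S p)) (S (S r)) rho Hr)].
  intros i. rewrite Cmod_R, Rabs_pos_eq by apply lamw_pos.
  assert (H := lamw_pos p r i). assert (Hp : (0 <= rho ^ lamn i)%R) by (apply pow_le; lra).
  split. { repeat first [assumption | apply pow2_ge_0 | apply Rmult_le_pos]. }
  right. unfold lamw, lamn. rewrite mult_INR. simpl. ring.
- intros t Hu. now apply lam_correct.
- eapply has_sum_ext; [|exact (lam_correct (S p) (S r) tau Ht)].
  intros i. unfold lamw, lamn. rewrite mult_INR, !RtoC_mult. cbn [pow]. rewrite !RtoC_mult. ring.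
- exact Ht.
Qed.

Lemma has_sum_S (f : nat -> C) s : has_sum (fun n => f (S n)) s -> has_sum f (f 0%nat + s).
Proof.
intros H.
apply (has_sum_ext (fun n => (match n with O => f 0%nat | _ => RtoC 0 end) + (match n with O => RtoC 0 | S m => f (S m) end))).
{ intros [|n]; ring. }
apply has_sum_plus.
- replace (f 0%nat) with (lsum (fun n => match n with O => f 0%nat | _ => RtoC 0 end) [0%nat]) at 1 by (simpl; ring).
  apply has_sum_finite; [repeat constructor; simpl; tauto|]. intros [|n]; simpl; [tauto|reflexivity].
- apply (has_sum_inj S); [intros; lia| |exact H].
  intros [|n] Hn; [reflexivity|]. exfalso. now apply (Hn n).
Qed.

Lemma has_sum_geom (Q : C) : (Cmod Q < 1)%R -> has_sum (fun n => Q ^ n) (/ (1 - Q)).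
Proof.
intros HQ.
assert (N : 1 - Q <> 0). { intros E. assert (E' : Q = 1) by (replace Q with (1 - (1 - Q)) by ring; rewrite E; ring). rewrite E', Cmod_1 in HQ. lra. }
destruct (summable_has_sum (fun n => Q ^ n)) as [s Hs].
(* The maximum with 1/2 provides a positive ratio even when Q = 0. *)
- eapply rsummable_le with (c := fun n => (INR (S n) ^ 0 * (Rmax (Cmod Q) (1 / 2)) ^ n)%R).
  + intros n. rewrite Cmod_pow. split; [apply pow_le, Cmod_ge_0|]. rewrite pow_O, Rmult_1_l. apply pow_incr.
    split; [apply Cmod_ge_0|apply Rmax_l].
  + apply rsummable_poly_geom. split; [eapply Rlt_le_trans; [|apply Rmax_r]; lra|apply Rmax_lub_lt; lra].
- assert (E : s = 1 + Q * s).
  { apply (has_sum_unique (fun n => Q ^ n)); [exact Hs|]. apply (has_sum_S (fun n => Q ^ n)).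
    apply (has_sum_scal Q) in Hs. exact Hs. }
  replace (/ (1 - Q)) with s; [exact Hs|].
  assert (E2 : s * (1 - Q) = 1). { replace (s * (1 - Q)) with (s - Q * s) by ring. rewrite E at 1. ring. }
  replace s with (s * (1 - Q) * / (1 - Q)) by (field; exact N). rewrite E2. ring.
Qed.

(** The geometric expansion of q^A / (1 - q^A) is the row A of the double series. *)
Lemma lambert_lam (p : nat) (tau : C) : upper tau -> lambert p tau = lam p 0 tau.
Proof.
intros Ht. unfold lambert. apply has_sum_CSeries.
apply (has_sum_fubini (fun i => RtoC (lamw p 0 i) * nome tau ^ lamn i)); [now apply lam_correct|].
intros a. set (Q := nome tau ^ S a).
assert (HQ : (Cmod Q < 1)%R).
{ unfold Q. rewrite Cmod_pow. assert (H := nome_pos tau). assert (H1 := nome_lt_1 tau Ht).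
  apply Rle_lt_trans with (Cmod (nome tau) ^ 1)%R; [|simpl; lra]. apply pow_le_1_mono; [lra|lia]. }
apply has_sum_geom in HQ.
apply (has_sum_scal (INR (S a) ^ p * Q)) in HQ.
eapply has_sum_ext; [|exact HQ]. intros x. unfold lamw, lamn. cbn [fst snd].
rewrite Rmult_1_r, RtoC_pow. rewrite Cpow_mult_r. fold Q. simpl. ring.
Qed.

(** * Ramanujan's differential equations *)

Lemma has_sum_lift {I J} (j : J -> I) (P : I -> bool) (f : I -> C) s :
  (forall k k', j k = j k' -> k = k') -> (forall i, P i = true <-> exists k, i = j k) ->
  has_sum (fun k => f (j k)) s -> has_sum (fun i => if P i then f i else RtoC 0) s.
Proof.
intros Hj HP H. apply (has_sum_inj j); [exact Hj|..].
- intros i Hi. destruct (P i) eqn:E; [|reflexivity]. exfalso. destruct (proj1 (HP i) E) as [k Hk]. now apply (Hi k).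
- eapply has_sum_ext; [|exact H]. intros k. simpl.
  replace (P (j k)) with true; [reflexivity|]. symmetry. apply HP. now exists k.
Qed.

(** Moving the pair (a, b) to (a + b, b) turns antidiagonals into rows, which are finite. *)
Lemma has_sum_antidiagonal (F : (nat * nat) * nat -> C) s : has_sum F s ->
  has_sum (fun i : nat * nat => lsum (fun v => F ((fst i - v, v), snd i)%nat) (seq 0 (S (fst i)))) s.
Proof.
intros H.
set (F' := fun k : (nat * nat) * nat => if (snd k <=? fst (fst k))%nat
   then F ((fst (fst k) - snd k, snd k), snd (fst k))%nat else RtoC 0).
apply (has_sum_fubini F').
- apply (has_sum_inj (fun k : (nat * nat) * nat => ((fst (fst k) + snd (fst k), snd k), snd (fst k)))%nat).
  + intros [[a b] c] [[a' b'] c'] E. simpl in E. inversion E. subst. replace a with a' by lia. reflexivity.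
  + intros [[u c] v] Hi. unfold F'. simpl. destruct (Nat.leb_spec v u) as [Hle|]; [|reflexivity].
    exfalso. apply (Hi ((u - v, v), c)%nat). simpl. repeat f_equal. lia.
  + eapply has_sum_ext; [|exact H]. intros [[a b] c]. unfold F'. cbn [fst snd].
    destruct (Nat.leb_spec b (a + b)); [|lia]. now replace (a + b - b)%nat with a by lia.
- intros [u c]. cbn [fst snd].
  rewrite (lsum_ext _ (fun v => F' ((u, c), v))).
  + apply has_sum_finite; [apply seq_NoDup|]. intros v Hv. unfold F'. simpl.
    destruct (Nat.leb_spec v u); [|reflexivity]. exfalso. apply Hv, in_seq. lia.
  + intros v Hv. apply in_seq in Hv. unfold F'. cbn [fst snd]. destruct (Nat.leb_spec v u); [reflexivity|lia].
Qed.

Notation quadruple := ((nat * nat) * (nat * nat))%type.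

(** Index ((a, x), (b, y)) stands for the term g(A, B) q^(A X + B Y) where
    A = a+1, X = x+1, B = b+1, Y = y+1. *)
Definition wT (g : R -> R -> R) (q : C) (t : quadruple) : C :=
  RtoC (g (INR (S (fst (fst t)))) (INR (S (fst (snd t)))))
  * q ^ (lamn (fst t) + lamn (snd t)).

Lemma wT_summable (g : R -> R -> R) (q : C) (K : R) : (0 < Cmod q < 1)%R ->
  (0 <= K)%R -> (forall A B, (1 <= A)%R -> (1 <= B)%R -> (Rabs (g A B) <= K * (A ^ 6 * B ^ 6))%R) ->
  rsummable (fun t => Cmod (wT g q t)).
Proof.
intros Hq HK Hg.
eapply rsummable_le; [|exact (rsummable_scal K _ HK (rsummable_prod _ _ (lam_summable 6 0 _ Hq) (lam_summable 6 0 _ Hq)))].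
intros [[a x] [b y]]. split; [apply Cmod_ge_0|]. unfold wT, lamw. cbn [fst snd].
rewrite Cmod_mult, Cmod_R, Cmod_pow, pow_add.
assert (H1 : forall n, (1 <= INR (S n))%R). { intros n. rewrite S_INR. assert (H := pos_INR n). lra. }
assert (H := Hg _ _ (H1 a) (H1 b)).
assert (Hp : forall n, (0 <= Cmod q ^ n)%R) by (intros; apply pow_le; lra).
eapply Rle_trans.
- apply Rmult_le_compat_r; [|exact H]. apply Rmult_le_pos; apply Hp.
- right. rewrite !pow_O. ring.
Qed.

(** Skoruppa's rearrangement: quadruples with y > x (resp. x > y) correspond to
    quadruples with a > b (resp. b > a) through
    (a, b, x, y) |-> (a + b, b, x, y - x) (resp. (a, a + b, x - y, y)), which preserves
    a x + b y.  When [p] takes the value g(a, b) at (a + b, b) and at (a, a + b), the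
    off-diagonal parts of the sums of [g] and of [p] cancel. *)
Lemma skoruppa (g p : R -> R -> R) (H : R -> R) (q : C) (K : R) : (0 < Cmod q < 1)%R ->
  (0 <= K)%R ->
  (forall A B, (1 <= A)%R -> (1 <= B)%R -> (Rabs (g A B) <= K * (A ^ 6 * B ^ 6))%R) ->
  (forall A B, (1 <= A)%R -> (1 <= B)%R -> (Rabs (p A B) <= K * (A ^ 6 * B ^ 6))%R) ->
  (forall A B, p (A + B)%R B = g A B) -> (forall A B, p A (A + B)%R = g A B) ->
  (forall s : nat, rsum (fun v => g (INR (S (s - v))) (INR (S v))) (seq 0 (S s)) = H (INR (S (S s)))) ->
  H 1%R = 0%R ->
  exists u v, has_sum (wT (fun A B => (g A B - p A B)%R) q) (u - v) /\
    has_sum (fun i => RtoC (H (INR (S (fst i)))) * q ^ lamn i) u /\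
    has_sum (fun i => RtoC (p (INR (S (fst i))) (INR (S (fst i))) * INR (snd i)) * q ^ lamn i) v.
Proof.
intros Hq HK Hbg Hbp Hp1 Hp2 HH HH1.
assert (Sg := wT_summable g q K Hq HK Hbg). assert (Sp := wT_summable p q K Hq HK Hbp).
(* j1 and j2 parametrise y > x and x > y in the sum of g; j1' and j2' parametrise a > b and b > a in
   the sum of p, with the same parameters. The diagonals are j3 (x = y, for g) and j4 (a = b, for
   p). The successors account for indices that start at 0. *)
set (j1 := fun k : quadruple => let '((a, b), (x, e)) := k in ((a, x), (b, S (x + e)))).
set (j1' := fun k : quadruple => let '((a, b), (x, e)) := k in ((S (a + b), x), (b, e))).
set (j2 := fun k : quadruple => let '((a, b), (y, e)) := k in ((a, S (y + e)), (b, y))).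
set (j2' := fun k : quadruple => let '((a, b), (y, e)) := k in ((a, e), (S (a + b), y))).
set (j3 := fun k : (nat * nat) * nat => let '((a, b), x) := k in ((a, x), (b, x))).
set (j4 := fun k : (nat * nat) * nat => let '((x, y), a) := k in ((a, x), (a, y))).
assert (I1 : forall k k', j1 k = j1 k' -> k = k').
{ intros [[a b] [c d]] [[a' b'] [c' d']] E. unfold j1 in E. inversion E; subst. replace d with d' by lia. reflexivity. }
assert (I1' : forall k k', j1' k = j1' k' -> k = k').
{ intros [[a b] [c d]] [[a' b'] [c' d']] E. unfold j1' in E. inversion E; subst. replace a with a' by lia. reflexivity. }
assert (I2 : forall k k', j2 k = j2 k' -> k = k').
{ intros [[a b] [c d]] [[a' b'] [c' d']] E. unfold j2 in E. inversion E; subst. replace d with d' by lia. reflexivity. }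
assert (I2' : forall k k', j2' k = j2' k' -> k = k').
{ intros [[a b] [c d]] [[a' b'] [c' d']] E. unfold j2' in E. inversion E; subst. replace b with b' by lia. reflexivity. }
assert (I3 : forall k k', j3 k = j3 k' -> k = k').
{ intros [[a b] c] [[a' b'] c'] E. unfold j3 in E. inversion E; subst. reflexivity. }
assert (I4 : forall k k', j4 k = j4 k' -> k = k').
{ intros [[a b] c] [[a' b'] c'] E. unfold j4 in E. inversion E; subst. reflexivity. }
assert (E1 : forall k, wT g q (j1 k) = wT p q (j1' k)).
{ intros [[a b] [x e]]. unfold wT, lamn, j1, j1'. cbn [fst snd]. f_equal.
  - f_equal. rewrite <- Hp1. f_equal. rewrite !S_INR, plus_INR. ring.
  - f_equal. ring. }
assert (E2 : forall k, wT g q (j2 k) = wT p q (j2' k)).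
{ intros [[a b] [y e]]. unfold wT, lamn, j2, j2'. cbn [fst snd]. f_equal.
  - f_equal. rewrite <- Hp2. f_equal. rewrite !S_INR, plus_INR. ring.
  - f_equal. ring. }
destruct (summable_has_sum _ (rsummable_inj j1 _ I1 Sg)) as [V1 HV1].
destruct (summable_has_sum _ (rsummable_inj j2 _ I2 Sg)) as [V2 HV2].
destruct (summable_has_sum _ (rsummable_inj j3 _ I3 Sg)) as [u Hu].
destruct (summable_has_sum _ (rsummable_inj j4 _ I4 Sp)) as [v Hv].
assert (HV1' := has_sum_ext _ _ _ E1 HV1). assert (HV2' := has_sum_ext _ _ _ E2 HV2).
exists u, v. split; [|split].
- apply (has_sum_lift j1 (fun t : quadruple => snd (fst t) <? snd (snd t))%nat) in HV1; [|exact I1|].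
  2:{ intros [[a x] [b y]]. simpl. rewrite Nat.ltb_lt. split.
      - intros Hlt. exists ((a, b), (x, y - x - 1))%nat. unfold j1. do 2 f_equal. lia.
      - intros [[[a' b'] [c' d']] E]. unfold j1 in E. inversion E. lia. }
  apply (has_sum_lift j2 (fun t : quadruple => snd (snd t) <? snd (fst t))%nat) in HV2; [|exact I2|].
  2:{ intros [[a x] [b y]]. simpl. rewrite Nat.ltb_lt. split.
      - intros Hlt. exists ((a, b), (y, x - y - 1))%nat. unfold j2. do 2 f_equal. lia.
      - intros [[[a' b'] [c' d']] E]. unfold j2 in E. inversion E. lia. }
  apply (has_sum_lift j1' (fun t : quadruple => fst (snd t) <? fst (fst t))%nat) in HV1'; [|exact I1'|].
  2:{ intros [[a x] [b y]]. simpl. rewrite Nat.ltb_lt. split.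
      - intros Hlt. exists ((a - b - 1, b), (x, y))%nat. unfold j1'. do 2 f_equal. lia.
      - intros [[[a' b'] [c' d']] E]. unfold j1' in E. inversion E. lia. }
  apply (has_sum_lift j2' (fun t : quadruple => fst (fst t) <? fst (snd t))%nat) in HV2'; [|exact I2'|].
  2:{ intros [[a x] [b y]]. simpl. rewrite Nat.ltb_lt. split.
      - intros Hlt. exists ((a, b - a - 1), (y, x))%nat. unfold j2'. do 2 f_equal. lia.
      - intros [[[a' b'] [c' d']] E]. unfold j2' in E. inversion E. lia. }
  assert (Hv' := has_sum_lift j4 (fun t : quadruple => fst (fst t) =? fst (snd t))%nat (wT p q) v I4).
  assert (Hu2 := has_sum_lift j3 (fun t : quadruple => snd (fst t) =? snd (snd t))%nat (wT g q) u I3).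
  assert (P3 : forall i : quadruple, (snd (fst i) =? snd (snd i))%nat = true <-> exists k, i = j3 k).
  { intros [[a x] [b y]]. simpl. rewrite Nat.eqb_eq. split.
    - intros ->. exists ((a, b), y). reflexivity.
    - intros [[[a' b'] c'] E]. unfold j3 in E. inversion E. congruence. }
  assert (P4 : forall i : quadruple, (fst (fst i) =? fst (snd i))%nat = true <-> exists k, i = j4 k).
  { intros [[a x] [b y]]. simpl. rewrite Nat.eqb_eq. split.
    - intros ->. exists ((x, y), b). reflexivity.
    - intros [[[a' b'] c'] E]. unfold j4 in E. inversion E. congruence. }
  specialize (Hu2 P3 Hu). specialize (Hv' P4 Hv).
  assert (HG := has_sum_plus _ _ _ _ (has_sum_plus _ _ _ _ HV1 HV2) Hu2).
  assert (HP := has_sum_plus _ _ _ _ (has_sum_plus _ _ _ _ HV1' HV2') Hv').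
  replace (u - v) with (V1 + V2 + u - (V1 + V2 + v)) by ring.
  eapply has_sum_ext; [|exact (has_sum_minus _ _ _ _ HG HP)].
  intros [[a x] [b y]]. cbn [fst snd].
  assert (Hdiff : wT (fun A B => (g A B - p A B)%R) q (a, x, (b, y)) = wT g q (a, x, (b, y)) - wT p q (a, x, (b, y))).
  { unfold wT. cbn [fst snd]. rewrite RtoC_minus. ring. }
  rewrite Hdiff.
  destruct (Nat.ltb_spec x y), (Nat.ltb_spec y x), (Nat.eqb_spec x y), (Nat.ltb_spec b a), (Nat.ltb_spec a b), (Nat.eqb_spec a b); try lia; ring.
(* On x = y the terms are grouped by A + B, which is at least 2; [H 1 = 0] fills the missing first
   row. *)
- apply has_sum_antidiagonal in Hu.
  apply (has_sum_inj (fun i : nat * nat => (S (fst i), snd i))).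
  + intros [a b] [a' b'] E. simpl in E. now inversion E.
  + intros [[|d] x] Hi.
    * simpl fst. change (INR 1) with 1%R. rewrite HH1. ring.
    * exfalso. now apply (Hi (d, x)).
  + eapply has_sum_ext; [|exact Hu]. intros [s x]. cbn [fst snd].
    rewrite <- HH. rewrite <- lsum_RtoC. rewrite Cmult_comm, <- lsum_scal.
    apply lsum_ext. intros w Hw. apply in_seq in Hw. unfold j3, wT, lamn. cbn [fst snd].
    rewrite Cmult_comm. f_equal. f_equal. assert (Es : s = ((s - w) + w)%nat) by lia. revert Es. generalize (s - w)%nat. intros e ->. ring.
(* On a = b the terms are grouped by Z = X + Y. There are Z - 1 of them, which is the factor
   [snd i], so the column Z = 1 is zero. *)
- apply has_sum_antidiagonal in Hv.
  apply (has_sum_inj (fun i : nat * nat => (snd i, S (fst i)))).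
  + intros [a b] [a' b'] E. simpl in E. now inversion E.
  + intros [a [|d]] Hi.
    * simpl. rewrite Rmult_0_r. ring.
    * exfalso. now apply (Hi (d, a)).
  + eapply has_sum_ext; [|exact Hv]. intros [s a]. cbn [fst snd].
    rewrite (lsum_ext _ (fun _ => RtoC (p (INR (S a)) (INR (S a))) * q ^ lamn (a, S s))).
    * rewrite RtoC_mult. generalize (RtoC (p (INR (S a)) (INR (S a)))) (q ^ lamn (a, S s)). intros c d.
      assert (Hl : forall L : list nat, lsum (fun _ : nat => c * d) L = c * INR (length L) * d).
      { induction L as [|w L IH]; [simpl; ring|]. cbn [length lsum fold_right]. unfold lsum in IH. rewrite IH, S_INR, RtoC_plus. ring. }
      rewrite Hl, length_seq. reflexivity.
    * intros w Hw. apply in_seq in Hw. unfold j4, wT, lamn. cbn [fst snd]. f_equal. f_equal.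
      assert (Es : s = ((s - w) + w)%nat) by lia. revert Es. generalize (s - w)%nat. intros e ->. ring.
Qed.

(** A^2 + A B + B^2 is invariant under the permutations of A, B, - A - B; hence replacing
    A by A - B in any of its powers gives a symmetric polynomial, as [skoruppa] requires. *)
Definition eis_g (A B : R) : R := (A ^ 2 + A * B + B ^ 2)%R.
Definition eis_p (A B : R) : R := (A ^ 2 - A * B + B ^ 2)%R.

(** For A, B >= 1 each of the three monomials is at most A^2 B^2; the constant is 27 = 3^3. *)
Lemma eis_bound (A B : R) (k : nat) : (1 <= A)%R -> (1 <= B)%R -> (k <= 3)%nat ->
  (Rabs (eis_g A B ^ k) <= 27 * (A ^ 6 * B ^ 6))%R /\ (Rabs (eis_p A B ^ k) <= 27 * (A ^ 6 * B ^ 6))%R.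
Proof.
intros HA HB Hk. set (m := (A ^ 2 * B ^ 2)%R).
assert (HAB : (1 <= A * B)%R) by nra.
assert (Hm : (1 <= m)%R) by (unfold m; nra).
assert (HA2 : (A ^ 2 <= m)%R) by (unfold m; assert (1 <= B ^ 2)%R by nra; assert (0 <= A ^ 2)%R by nra; nra).
assert (HB2 : (B ^ 2 <= m)%R) by (unfold m; assert (1 <= A ^ 2)%R by nra; assert (0 <= B ^ 2)%R by nra; nra).
assert (HABm : (A * B <= m)%R) by (unfold m; replace (A ^ 2 * B ^ 2)%R with ((A * B) * (A * B))%R by ring; nra).
assert (Hpow : ((3 * m) ^ k <= 27 * (A ^ 6 * B ^ 6))%R).
{ replace (27 * (A ^ 6 * B ^ 6))%R with ((3 * m) ^ 3)%R by (unfold m; ring). apply Rle_pow; [lra|exact Hk]. }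
split; rewrite <- RPow_abs; (eapply Rle_trans; [|exact Hpow]); apply pow_incr; (split; [apply Rabs_pos|]); apply Rabs_le; unfold eis_g, eis_p; nra.
Qed.

Lemma wT_monomial (i j : nat) (tau : C) : upper tau ->
  has_sum (wT (fun A B => (A ^ i * B ^ j)%R) (nome tau)) (lam i 0 tau * lam j 0 tau).
Proof.
intros Ht. eapply has_sum_ext; [|exact (has_sum_prod _ _ _ _ (lam_summable_C i 0 tau Ht) (lam_summable_C j 0 tau Ht)
  (lam_correct i 0 tau Ht) (lam_correct j 0 tau Ht))].
intros [[a x] [b y]]. unfold wT, lamw. cbn [fst snd]. rewrite !pow_O, !RtoC_mult, Cpow_add_r. ring.
Qed.

Lemma wT_plus (g h : R -> R -> R) (c d : R) (q : C) (s t : C) : has_sum (wT g q) s -> has_sum (wT h q) t ->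
  has_sum (wT (fun A B => (c * g A B + d * h A B)%R) q) (c * s + d * t).
Proof.
intros Hs Ht. eapply has_sum_ext; [|exact (has_sum_plus _ _ _ _ (has_sum_scal c _ _ Hs) (has_sum_scal d _ _ Ht))].
intros i. unfold wT. rewrite RtoC_plus, !RtoC_mult. ring.
Qed.

Lemma wT_ext (g h : R -> R -> R) (q : C) s : (forall A B, g A B = h A B) -> has_sum (wT g q) s -> has_sum (wT h q) s.
Proof. intros H. apply has_sum_ext. intros i. unfold wT. now rewrite H. Qed.

Lemma lam_poly (L : list (R * nat)) (f : nat * nat -> R) (tau : C) : upper tau ->
  (forall i, f i = rsum (fun cp => fst cp * INR (S (fst i)) ^ snd cp)%R L) ->
  has_sum (fun i => RtoC (f i) * nome tau ^ lamn i) (lsum (fun cp => RtoC (fst cp) * lam (snd cp) 0 tau) L).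
Proof.
intros Ht. revert f. induction L as [|[c p] L IH]; intros f Hf.
- replace (lsum _ _) with (0 * lam 0 0 tau) by (simpl; ring).
  eapply has_sum_ext; [|exact (has_sum_scal 0 _ _ (lam_correct 0 0 tau Ht))].
  intros i. rewrite Hf. simpl. ring.
- cbn [lsum fold_right fst snd].
  eapply has_sum_ext; [|exact (has_sum_plus _ _ _ _ (has_sum_scal c _ _ (lam_correct p 0 tau Ht)) (IH _ (fun i => eq_refl)))].
  intros i. cbv beta. rewrite Hf. cbn [rsum fold_right fst snd]. unfold lamw. rewrite pow_O, Rmult_1_r.
  rewrite RtoC_plus, RtoC_mult. fold (rsum (fun cp => fst cp * INR (S (fst i)) ^ snd cp)%R L). ring.
Qed.

(** The factor [snd i] is X - 1. The part with X gives [lam k 1], the derivative of [lam (k - 1) 0]: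
    this is how derivatives enter the convolution identities. *)
Lemma diag_part (p : R -> R -> R) (k : nat) (tau v : C) : upper tau ->
  (forall A, p A A = A ^ k)%R ->
  has_sum (fun i => RtoC (p (INR (S (fst i))) (INR (S (fst i))) * INR (snd i)) * nome tau ^ lamn i) v ->
  v = lam k 1 tau - lam k 0 tau.
Proof.
intros Ht Hp Hv. eapply has_sum_unique; [exact Hv|].
eapply has_sum_ext; [|exact (has_sum_minus _ _ _ _ (lam_correct k 1 tau Ht) (lam_correct k 0 tau Ht))].
intros [a x]. cbn [fst snd]. unfold lamw. cbn [fst snd]. rewrite Hp, pow_O, pow_1, (S_INR x), Rmult_1_r.
rewrite !RtoC_mult, RtoC_plus. ring.
Qed.

(** Phi D n is a closed form of the sum of g(D - v, v) over 1 <= v <= n, verified by telescoping;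
    the full antidiagonal A + B = D is n = D - 1. *)
Lemma antidiag_poly (g : R -> R -> R) (Phi : R -> R -> R) (H : R -> R) (s : nat) :
  (forall D, Phi D 0 = 0)%R -> (forall D n, Phi D n + g (D - (n + 1)) (n + 1) = Phi D (n + 1))%R ->
  (forall D, Phi D (D - 1) = H D)%R ->
  rsum (fun v => g (INR (S (s - v))) (INR (S v))) (seq 0 (S s)) = H (INR (S (S s))).
Proof.
intros H0 H1 H2. rewrite <- H2.
assert (E : forall n, (n <= S s)%nat -> rsum (fun v => g (INR (S (s - v))) (INR (S v))) (seq 0 n) = Phi (INR (S (S s))) (INR n)).
{ induction n; intros Hn.
  - simpl. now rewrite H0.
  - rewrite seq_S, rsum_app, IHn by lia. cbn [rsum fold_right Nat.add]. rewrite Rplus_0_r.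
    rewrite (S_INR n). rewrite <- H1. f_equal. f_equal.
    rewrite !S_INR, minus_INR by lia. ring. }
rewrite E by lia. f_equal. rewrite (S_INR (S s)). ring.
Qed.

(** * Convolution identities for the Lambert series *)

Section ramanujan.
Variable tau : C.
Hypothesis Ht : upper tau.

Let Hq : (0 < Cmod (nome tau) < 1)%R.
Proof. split; [apply nome_pos|now apply nome_lt_1]. Qed.

Notation L k := (lam k 0 tau).

(** [eis_g] - [eis_p] is 2 A B, whence the left side. The series [lam 2 0] occurs both in u, through
    the term - D^2 of H, and in the diagonal part v, and cancels in u - v. *)
Lemma lam_conv2 : 2 * L 1 * L 1 = 5 / 6 * L 3 + 1 / 6 * L 1 - lam 2 1 tau.
Proof.
destruct (skoruppa eis_g eis_p (fun D => 1 / 6 * D + -1 * D ^ 2 + 5 / 6 * D ^ 3)%R (nome tau) 27 Hq ltac:(lra)) as (u & v & H1 & H2 & H3).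
- intros A B HA HB. rewrite <- (pow_1 (eis_g A B)). apply eis_bound; auto.
- intros A B HA HB. rewrite <- (pow_1 (eis_p A B)). apply eis_bound; auto.
- intros. unfold eis_g, eis_p. ring.
- intros. unfold eis_g, eis_p. ring.
(* Here g(D - v, v) = D^2 - D v + v^2, and Phi inserts the sums of powers of v; the other identities
   expand powers of this polynomial. *)
- intros s. apply (antidiag_poly eis_g (fun D n => D ^ 2 * n - D * (n * (n + 1) / 2) + n * (n + 1) * (2 * n + 1) / 6)%R (fun D => 1 / 6 * D + -1 * D ^ 2 + 5 / 6 * D ^ 3)%R);
  intros; unfold eis_g; field.
- field.
- apply (diag_part eis_p 2) in H3; [|exact Ht|intros; unfold eis_p; ring].
  assert (E2 : u = lsum (fun cp => RtoC (fst cp) * lam (snd cp) 0 tau) [(1 / 6, 1%nat); (-1, 2%nat); (5 / 6, 3%nat)]%R).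
  { apply (has_sum_unique _ _ _ H2), lam_poly; [exact Ht|]. intros i. cbn [rsum fold_right fst snd]. ring. }
  assert (E1 : u - v = 2 * (L 1 * L 1) + 0 * (L 1 * L 1)).
  { apply (has_sum_unique _ _ _ H1). eapply wT_ext; [|exact (wT_plus _ _ 2 0 _ _ _ (wT_monomial 1 1 tau Ht) (wT_monomial 1 1 tau Ht))]. intros; unfold eis_g, eis_p; ring. }
  rewrite E2, H3 in E1. cbn [lsum fold_right fst snd] in E1.
  revert E1. rewrite !RtoC_div by lra. intros E1.
  transitivity (2 * (L 1 * L 1) + 0 * (L 1 * L 1)); [ring|]. rewrite <- E1. ring.
Qed.

(** The squares of the two forms differ by 4 A B (A^2 + B^2). *)
Lemma lam_conv4 : 8 * L 1 * L 3 = 7 / 10 * L 5 + 1 / 3 * L 3 - 1 / 30 * L 1 - lam 4 1 tau.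
Proof.
destruct (skoruppa (fun A B => eis_g A B ^ 2)%R (fun A B => eis_p A B ^ 2)%R (fun D => -1 / 30 * D + 1 / 3 * D ^ 3 + -1 * D ^ 4 + 7 / 10 * D ^ 5)%R (nome tau) 27 Hq ltac:(lra)) as (u & v & H1 & H2 & H3).
- intros A B HA HB. apply eis_bound; auto.
- intros A B HA HB. apply eis_bound; auto.
- intros. unfold eis_g, eis_p. ring.
- intros. unfold eis_g, eis_p. ring.
- intros s. apply (antidiag_poly (fun A B => eis_g A B ^ 2)%R (fun D n => D ^ 4 * n - 2 * D ^ 3 * (n * (n + 1) / 2) + 3 * D ^ 2 * (n * (n + 1) * (2 * n + 1) / 6) - 2 * D * (n ^ 2 * (n + 1) ^ 2 / 4) + n * (n + 1) * (2 * n + 1) * (3 * n ^ 2 + 3 * n - 1) / 30)%R (fun D => -1 / 30 * D + 1 / 3 * D ^ 3 + -1 * D ^ 4 + 7 / 10 * D ^ 5)%R);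
  intros; unfold eis_g; field.
- field.
- apply (diag_part (fun A B => eis_p A B ^ 2)%R 4) in H3; [|exact Ht|intros; unfold eis_p; ring].
  assert (E2 : u = lsum (fun cp => RtoC (fst cp) * lam (snd cp) 0 tau) [(-1 / 30, 1%nat); (1 / 3, 3%nat); (-1, 4%nat); (7 / 10, 5%nat)]%R).
  { apply (has_sum_unique _ _ _ H2), lam_poly; [exact Ht|]. intros i. cbn [rsum fold_right fst snd]. ring. }
  assert (E1 : u - v = 4 * (L 3 * L 1) + 4 * (L 1 * L 3)).
  { apply (has_sum_unique _ _ _ H1). eapply wT_ext; [|exact (wT_plus _ _ 4 4 _ _ _ (wT_monomial 3 1 tau Ht) (wT_monomial 1 3 tau Ht))]. intros; unfold eis_g, eis_p; ring. }
  rewrite E2, H3 in E1. cbn [lsum fold_right fst snd] in E1.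
  revert E1. rewrite !RtoC_div by lra. intros E1.
  transitivity (4 * (L 3 * L 1) + 4 * (L 1 * L 3)); [ring|]. rewrite <- E1. field.
Qed.

(** The cubes differ by 6 A^5 B + 14 A^3 B^3 + 6 A B^5. The terms in L 3 squared and L 7 are
    reconciled by [lam_conv_E8]. *)
Lemma lam_conv6 : 12 * L 1 * L 5 + 14 * L 3 * L 3 =
  83 / 140 * L 7 + 1 / 2 * L 5 - 7 / 60 * L 3 + 1 / 42 * L 1 - lam 6 1 tau.
Proof.
destruct (skoruppa (fun A B => eis_g A B ^ 3)%R (fun A B => eis_p A B ^ 3)%R (fun D => 1 / 42 * D + -7 / 60 * D ^ 3 + 1 / 2 * D ^ 5 + -1 * D ^ 6 + 83 / 140 * D ^ 7)%R (nome tau) 27 Hq ltac:(lra)) as (u & v & H1 & H2 & H3).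
- intros A B HA HB. apply eis_bound; auto.
- intros A B HA HB. apply eis_bound; auto.
- intros. unfold eis_g, eis_p. ring.
- intros. unfold eis_g, eis_p. ring.
- intros s. apply (antidiag_poly (fun A B => eis_g A B ^ 3)%R (fun D n => D ^ 6 * n - 3 * D ^ 5 * (n * (n + 1) / 2) + 6 * D ^ 4 * (n * (n + 1) * (2 * n + 1) / 6) - 7 * D ^ 3 * (n ^ 2 * (n + 1) ^ 2 / 4) + 6 * D ^ 2 * (n * (n + 1) * (2 * n + 1) * (3 * n ^ 2 + 3 * n - 1) / 30) - 3 * D * (n ^ 2 * (n + 1) ^ 2 * (2 * n ^ 2 + 2 * n - 1) / 12) + n * (n + 1) * (2 * n + 1) * (3 * n ^ 4 + 6 * n ^ 3 - 3 * n + 1) / 42)%R (fun D => 1 / 42 * D + -7 / 60 * D ^ 3 + 1 / 2 * D ^ 5 + -1 * D ^ 6 + 83 / 140 * D ^ 7)%R);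
  intros; unfold eis_g; field.
- field.
- apply (diag_part (fun A B => eis_p A B ^ 3)%R 6) in H3; [|exact Ht|intros; unfold eis_p; ring].
  assert (E2 : u = lsum (fun cp => RtoC (fst cp) * lam (snd cp) 0 tau) [(1 / 42, 1%nat); (-7 / 60, 3%nat); (1 / 2, 5%nat); (-1, 6%nat); (83 / 140, 7%nat)]%R).
  { apply (has_sum_unique _ _ _ H2), lam_poly; [exact Ht|]. intros i. cbn [rsum fold_right fst snd]. ring. }
  assert (E1 : u - v = 1 * (6 * (L 5 * L 1) + 6 * (L 1 * L 5)) + 14 * (L 3 * L 3)).
  { apply (has_sum_unique _ _ _ H1). eapply wT_ext; [|exact (wT_plus _ _ 1 14 _ _ _ (wT_plus _ _ 6 6 _ _ _ (wT_monomial 5 1 tau Ht) (wT_monomial 1 5 tau Ht)) (wT_monomial 3 3 tau Ht))]. intros; unfold eis_g, eis_p; ring. }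
  rewrite E2, H3 in E1. cbn [lsum fold_right fst snd] in E1.
  revert E1. rewrite !RtoC_div by lra. intros E1.
  transitivity (1 * (6 * (L 5 * L 1) + 6 * (L 1 * L 5)) + 14 * (L 3 * L 3)); [ring|]. rewrite <- E1. field.
Qed.

(** This is E4^2 = E8. The weight is the square of A B (A + B), symmetric in A, B, - A - B up to
    sign; its p vanishes on A = B, so no derivative appears, and g - p = 4 A^3 B^3. *)
Lemma lam_conv_E8 : 120 * L 3 * L 3 = L 7 - L 3.
Proof.
set (g := fun A B : R => (A ^ 2 * B ^ 2 * (A + B) ^ 2)%R). set (p := fun A B : R => (A ^ 2 * B ^ 2 * (A - B) ^ 2)%R).
assert (Hg : forall A B, (1 <= A)%R -> (1 <= B)%R -> (0 <= p A B <= g A B /\ g A B <= 27 * (A ^ 6 * B ^ 6))%R).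
{ intros A B HA HB. assert (HAB : (1 <= A * B)%R) by nra.
  replace (27 * (A ^ 6 * B ^ 6))%R with (A ^ 2 * B ^ 2 * (27 * (A * B) ^ 4))%R by ring.
  assert (Hm : (0 <= A ^ 2 * B ^ 2)%R) by (replace (A ^ 2 * B ^ 2)%R with ((A * B) ^ 2)%R by ring; apply pow2_ge_0).
  assert (H4 : ((A * B) ^ 2 <= (A * B) ^ 4)%R) by (apply Rle_pow; [lra|lia]).
  assert (Hs : ((A + B) ^ 2 <= 4 * (A * B) ^ 2)%R).
  { replace (4 * (A * B) ^ 2)%R with ((2 * (A * B)) ^ 2)%R by ring. apply pow_incr. nra. }
  unfold p, g. repeat split.
  - apply Rmult_le_pos; [exact Hm|apply pow2_ge_0].
  - apply Rmult_le_compat_l; [exact Hm|nra].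
  - apply Rmult_le_compat_l; [exact Hm|]. assert (0 <= (A * B) ^ 2)%R by apply pow2_ge_0. lra. }
destruct (skoruppa g p (fun D => -1 / 30 * D ^ 3 + 1 / 30 * D ^ 7)%R (nome tau) 27 Hq ltac:(lra)) as (u & v & H1 & H2 & H3).
- intros A B HA HB. destruct (Hg A B HA HB). rewrite Rabs_pos_eq; lra.
- intros A B HA HB. destruct (Hg A B HA HB). rewrite Rabs_pos_eq; lra.
- intros. unfold g, p. ring.
- intros. unfold g, p. ring.
- intros s. apply (antidiag_poly g (fun D n => D ^ 2 * (D ^ 2 * (n * (n + 1) * (2 * n + 1) / 6) - 2 * D * (n ^ 2 * (n + 1) ^ 2 / 4) + n * (n + 1) * (2 * n + 1) * (3 * n ^ 2 + 3 * n - 1) / 30))%R (fun D => -1 / 30 * D ^ 3 + 1 / 30 * D ^ 7)%R);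
  intros; unfold g; field.
- field.
- assert (Hv0 : v = 0).
  { apply (has_sum_unique _ _ _ H3).
    replace (RtoC 0) with (0 * lam 0 0 tau) by ring.
    eapply has_sum_ext; [|exact (has_sum_scal 0 _ _ (lam_correct 0 0 tau Ht))].
    intros i. unfold p. simpl fst. match goal with |- _ = RtoC ?e * _ => replace e with 0%R by ring end. ring. }
  assert (E2 : u = lsum (fun cp => RtoC (fst cp) * lam (snd cp) 0 tau) [(-1 / 30, 3%nat); (1 / 30, 7%nat)]%R).
  { apply (has_sum_unique _ _ _ H2), lam_poly; [exact Ht|]. intros i. cbn [rsum fold_right fst snd]. ring. }
  assert (E1 : u - v = 4 * (L 3 * L 3) + 0 * (L 3 * L 3)).
  { apply (has_sum_unique _ _ _ H1). eapply wT_ext; [|exact (wT_plus _ _ 4 0 _ _ _ (wT_monomial 3 3 tau Ht) (wT_monomial 3 3 tau Ht))]. intros; unfold g, p; ring. }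
  rewrite E2, Hv0 in E1. cbn [lsum fold_right fst snd] in E1.
  revert E1. rewrite !RtoC_div by lra. intros E1.
  transitivity (30 * (4 * (L 3 * L 3) + 0 * (L 3 * L 3))); [ring|]. rewrite <- E1. field.
Qed.
End ramanujan.

Lemma E2_derive (tau : C) : upper tau ->
  is_Cderive E2 tau (2 * PI * Ci * ((E2 tau ^ 2 - E4 tau) / 12)).
Proof.
intros Ht. apply (is_Cderive_ext_upper (fun t => 1 - 24 * lam 1 0 t)); [exact Ht|..].
- intros w Hw. unfold E2. now rewrite lambert_lam.
- assert (Hd := lam_derive 1 0 tau Ht). eapply is_Cderive_eq; [cderive|].
  unfold E2, E4. rewrite !lambert_lam by exact Ht.
  assert (E := lam_conv2 tau Ht).
  replace (lam 2 1 tau) with (5 / 6 * lam 3 0 tau + 1 / 6 * lam 1 0 tau - 2 * lam 1 0 tau * lam 1 0 tau) by (rewrite E; ring).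
  field.
Qed.

Lemma E4_derive (tau : C) : upper tau ->
  is_Cderive E4 tau (2 * PI * Ci * ((E2 tau * E4 tau - E6 tau) / 3)).
Proof.
intros Ht. apply (is_Cderive_ext_upper (fun t => 1 + 240 * lam 3 0 t)); [exact Ht|..].
- intros w Hw. unfold E4. now rewrite lambert_lam.
- assert (Hd := lam_derive 3 0 tau Ht). eapply is_Cderive_eq; [cderive|].
  unfold E2, E4, E6. rewrite !lambert_lam by exact Ht.
  assert (E := lam_conv4 tau Ht).
  replace (lam 4 1 tau) with (7 / 10 * lam 5 0 tau + 1 / 3 * lam 3 0 tau - 1 / 30 * lam 1 0 tau - 8 * lam 1 0 tau * lam 3 0 tau) by (rewrite E; ring).
  field.
Qed.

Lemma E6_derive (tau : C) : upper tau ->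
  is_Cderive E6 tau (2 * PI * Ci * ((E2 tau * E6 tau - E4 tau ^ 2) / 2)).
Proof.
intros Ht. apply (is_Cderive_ext_upper (fun t => 1 - 504 * lam 5 0 t)); [exact Ht|..].
- intros w Hw. unfold E6. now rewrite lambert_lam.
- assert (Hd := lam_derive 5 0 tau Ht). eapply is_Cderive_eq; [cderive|].
  unfold E2, E4, E6. rewrite !lambert_lam by exact Ht.
  assert (E := lam_conv6 tau Ht). assert (E' := lam_conv_E8 tau Ht).
  replace (lam 6 1 tau) with (83 / 140 * lam 7 0 tau + 1 / 2 * lam 5 0 tau - 7 / 60 * lam 3 0 tau + 1 / 42 * lam 1 0 tau
    - (12 * lam 1 0 tau * lam 5 0 tau + 14 * lam 3 0 tau * lam 3 0 tau)) by (rewrite E; ring).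
  replace (lam 7 0 tau) with (120 * lam 3 0 tau * lam 3 0 tau + lam 3 0 tau) by (rewrite E'; ring).
  field.
Qed.

(** * Partial fractions *)

Lemma Ccont_mult (f g : C -> C) (z : C) : Ccont f z -> Ccont g z -> Ccont (fun w => f w * g w) z.
Proof.
intros Hf Hg eps Heps.
set (A := (Cmod (f z) + Cmod (g z) + 1)%R).
assert (Hfz := Cmod_ge_0 (f z)). assert (Hgz := Cmod_ge_0 (g z)).
set (e := Rmin 1 (eps / (2 * A))).
assert (He : (0 < e)%R). { apply Rmin_pos; [lra|]. apply Rdiv_lt_0_compat; unfold A; lra. }
assert (He1 : (e <= 1)%R) by apply Rmin_l.
assert (He2 : (e * (2 * A) <= eps)%R). { apply Rle_div_r; [unfold A; lra|apply Rmin_r]. }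
destruct (Hf e He) as [d1 [Hd1 H1]]. destruct (Hg e He) as [d2 [Hd2 H2]].
exists (Rmin d1 d2). split; [now apply Rmin_pos|]. intros w Hw.
specialize (H1 w ltac:(eapply Rlt_le_trans; [exact Hw|apply Rmin_l])).
specialize (H2 w ltac:(eapply Rlt_le_trans; [exact Hw|apply Rmin_r])).
replace (f w * g w - f z * g z) with ((f w - f z) * (g w - g z) + ((f w - f z) * g z + f z * (g w - g z))) by ring.
eapply Rle_lt_trans; [apply Cmod_triangle|].
assert (T := Cmod_triangle ((f w - f z) * g z) (f z * (g w - g z))). rewrite !Cmod_mult in *.
assert (U1 := Cmod_ge_0 (f w - f z)). assert (U2 := Cmod_ge_0 (g w - g z)).
assert (B1 : (Cmod (f w - f z) * Cmod (g w - g z) <= e * 1)%R) by (apply Rmult_le_compat; lra).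
assert (B2 : (Cmod (f w - f z) * Cmod (g z) <= e * Cmod (g z))%R) by (apply Rmult_le_compat_r; lra).
assert (B3 : (Cmod (f z) * Cmod (g w - g z) <= Cmod (f z) * e)%R) by (apply Rmult_le_compat_l; lra).
unfold A in He2. nra.
Qed.

Lemma Ccont_pow (f : C -> C) (z : C) (n : nat) : Ccont f z -> Ccont (fun w => f w ^ n) z.
Proof.
intros Hf. induction n as [|n IH]; simpl.
- intros eps Heps. exists 1%R. split; [lra|]. intros w _. replace (1 - 1) with (RtoC 0) by ring. now rewrite Cmod_0.
- exact (Ccont_mult f (fun w => f w ^ n) z Hf IH).
Qed.

Lemma Ccont_comp (f g : C -> C) (z : C) : Ccont f (g z) -> Ccont g z -> Ccont (fun w => f (g w)) z.
Proof.
intros Hf Hg eps Heps. destruct (Hf eps Heps) as [d1 [Hd1 H1]]. destruct (Hg d1 Hd1) as [d2 [Hd2 H2]].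
exists d2. split; [exact Hd2|]. intros w Hw. apply H1, H2, Hw.
Qed.

Lemma Ccont_inv (z : C) : z <> 0 -> Ccont (fun w => / w) z.
Proof. intros Hz. exact (is_Cderive_Ccont _ _ _ (is_Cderive_inv z Hz)). Qed.

Lemma two_pi_i_nz : 2 * PI * Ci <> 0.
Proof.
assert (H := PI_RGT_0). repeat apply Cmult_neq_0; [| |apply Ci_nz]; intros E; apply RtoC_inj in E; lra.
Qed.

Lemma Cexp_derive (z : C) : is_Cderive Cexp z (Cexp z).
Proof.
apply is_Cderive_eps. intros eps Heps.
set (A := (5 * Cmod (Cexp z) * exp 1 + 1)%R).
assert (Hc := Cmod_ge_0 (Cexp z)). assert (He := exp_pos 1).
assert (HA : (1 <= A)%R). { unfold A. assert (0 <= 5 * Cmod (Cexp z) * exp 1)%R by (repeat apply Rmult_le_pos; lra). lra. }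
exists (Rmin 1 (eps / A)). split. { apply Rmin_pos; [lra|apply Rdiv_lt_0_compat; lra]. }
intros w Hw.
assert (Hw1 : (Cmod (w - z) < 1)%R) by (eapply Rlt_le_trans; [exact Hw|apply Rmin_l]).
assert (Hw2 : (Cmod (w - z) < eps / A)%R) by (eapply Rlt_le_trans; [exact Hw|apply Rmin_r]).
set (h := w - z) in *. replace w with (z + h) by (unfold h; ring).
rewrite Cexp_plus. replace (Cexp z * Cexp h - Cexp z - h * Cexp z) with (Cexp z * (Cexp h - 1 - h)) by ring.
rewrite Cmod_mult. assert (B := Cexp_taylor_bound h). assert (Hh := Cmod_ge_0 h).
assert (exp (Cmod h) <= exp 1)%R by (left; apply exp_increasing; lra).
apply Rlt_div_r in Hw2; [|lra].
apply Rle_trans with (Cmod (Cexp z) * (5 * (Cmod h * Cmod h) * exp 1))%R.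
- apply Rmult_le_compat_l; [exact Hc|]. eapply Rle_trans; [exact B|]. apply Rmult_le_compat_l; [|assumption].
  assert (0 <= Cmod h * Cmod h)%R by nra. lra.
- replace (Cmod (Cexp z) * (5 * (Cmod h * Cmod h) * exp 1))%R with ((5 * Cmod (Cexp z) * exp 1) * Cmod h * Cmod h)%R by ring.
  apply Rmult_le_compat_r; [exact Hh|]. assert (5 * Cmod (Cexp z) * exp 1 * Cmod h <= A * Cmod h)%R by (apply Rmult_le_compat_r; unfold A; lra). lra.
Qed.

Lemma nome_derive (z : C) : is_Cderive nome z (2 * PI * Ci * nome z).
Proof.
unfold nome. apply (is_Cderive_comp Cexp (fun t => 2 * PI * Ci * t)); [apply Cexp_derive|].
eapply is_Cderive_eq; [cderive|]. ring.
Qed.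

Lemma nome_0 : nome 0 = 1.
Proof. unfold nome. rewrite Cmult_0_r. apply Cexp_0. Qed.

Lemma nome_1 : nome 1 = 1.
Proof.
unfold nome. replace (2 * PI * Ci * 1) with ((0, 2 * PI)%R : C) by (apply injective_projections; simpl; ring).
unfold Cexp. simpl. rewrite exp_0, cos_2PI, sin_2PI. apply injective_projections; simpl; ring.
Qed.

Lemma nome_half : nome (RtoC (1 / 2)) = - (1).
Proof.
unfold nome. replace (2 * PI * Ci * RtoC (1 / 2)) with ((0, PI)%R : C) by (apply injective_projections; simpl; field).
unfold Cexp. simpl. rewrite exp_0, cos_PI, sin_PI. apply injective_projections; simpl; ring.
Qed.

Lemma nome_nat (n : nat) (z : C) : nome (INR n * z) = nome z ^ n.
Proof. unfold nome. rewrite <- Cexp_INR. f_equal. ring. Qed.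

Lemma nome_opp (z : C) : nome (- z) * nome z = 1.
Proof. rewrite <- nome_plus. replace (- z + z) with (RtoC 0) by ring. apply nome_0. Qed.

Lemma nome_Z (m : Z) : nome (IZR m) = 1.
Proof.
assert (Hn : forall n : nat, nome (IZR (Z.of_nat n)) = 1).
{ intros n. rewrite <- INR_IZR_INZ. rewrite <- (Cmult_1_r (INR n)), nome_nat, nome_1. apply Cpow_1_l. }
destruct (Z_le_gt_dec 0 m) as [H|H].
- rewrite <- (Z2Nat.id m) by lia. apply Hn.
- assert (E := nome_opp (IZR (- m))). rewrite <- RtoC_opp, <- opp_IZR, Z.opp_involutive in E.
  rewrite <- (Z2Nat.id (- m)), Hn, Cmult_1_r in E by lia. exact E.
Qed.

Lemma nome_shift (z : C) (m : Z) : nome (z + IZR m) = nome z.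
Proof. rewrite nome_plus, nome_Z. ring. Qed.

Lemma sin_lower (x : R) : (Rabs x <= 1 / 2)%R -> (x ^ 2 <= sin (PI * x) ^ 2)%R.
Proof.
assert (HP3 : (3 < PI)%R) by (assert (H := PI2_3_2); lra).
assert (HP4 : (PI <= 4)%R) by apply PI_4.
assert (Hpos : forall t, (0 <= t <= 1 / 2)%R -> (t <= sin (PI * t))%R).
{ intros t Ht. set (u := (PI * t)%R). assert (Hu : (3 * t <= u <= 2)%R) by (unfold u; nra).
  (* sin u >= u - u^3 / 6, which is at least u / 3 for u <= 2, and u >= 3 t because PI > 3. *)
  destruct (sin_bound u 0) as [H _]; [lra|nra|]. unfold sin_approx, sin_term in H. simpl in H.
  assert (Hu2 : (u ^ 3 <= 4 * u)%R) by nra. simpl in Hu2. lra. }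
intros Hx. destruct (Rle_lt_dec 0 x) as [H|H].
- rewrite Rabs_pos_eq in Hx by lra. apply pow_incr. split; [lra|]. apply Hpos. lra.
- rewrite Rabs_left in Hx by lra. replace (x ^ 2)%R with ((- x) ^ 2)%R by ring.
  replace (sin (PI * x) ^ 2)%R with (sin (PI * - x) ^ 2)%R by (rewrite <- Ropp_mult_distr_r, sin_neg; ring).
  apply pow_incr. split; [lra|]. apply Hpos. lra.
Qed.

(** With r = |nome w|, the square of |1 - nome w| is (1 - r)^2 + 4 r sin^2(pi x); the first part
    controls y and the second x. This bounds w / (1 - nome w) uniformly, as the domination in
    [lipschitz_strip] requires. *)
Lemma one_sub_nome_lower (w : C) : (Rabs (Re w) <= 1 / 2)%R -> (0 <= Im w)%R ->
  (2 * exp (- (2 * PI * Im w)) * Cmod w <= Cmod (1 - nome w))%R.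
Proof.
intros Hx Hy. set (x := Re w) in *. set (y := Im w) in *. set (r := exp (- (2 * PI * y))).
assert (HP3 : (3 < PI)%R) by (assert (H := PI2_3_2); lra).
assert (Hr : (0 < r)%R) by apply exp_pos.
set (s := (2 * PI * y)%R). assert (Hs : (0 <= s)%R) by (unfold s; nra).
assert (Hr1 : (r * (1 + s) <= 1)%R).
{ assert (H := exp_ineq1_le s). assert (E : (r * exp s = 1)%R). { unfold r, s. rewrite <- exp_plus, Rplus_opp_l. apply exp_0. }
  rewrite <- E. apply Rmult_le_compat_l; lra. }
assert (Hrl : (r <= 1)%R) by nra.
assert (En : nome w = (r * cos (2 * PI * x), r * sin (2 * PI * x))%R).
{ unfold nome, Cexp. replace (Re (2 * PI * Ci * w)) with (- (2 * PI * y))%R by (unfold y, Re, Im; simpl; ring).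
  replace (Im (2 * PI * Ci * w)) with (2 * PI * x)%R by (unfold x, Re, Im; simpl; ring). reflexivity. }
assert (Hsin := sin_lower x Hx).
assert (E : (Cmod (1 - nome w) ^ 2 = (1 - r) ^ 2 + 4 * r * sin (PI * x) ^ 2)%R).
{ rewrite Cmod2_alt, En. unfold Re, Im. simpl fst. simpl snd.
  replace (2 * PI * x)%R with (2 * (PI * x))%R by ring. rewrite cos_2a_sin, sin_2a.
  assert (H := sin2_cos2 (PI * x)). unfold Rsqr in H.
  set (S := sin (PI * x)) in *. set (Co := cos (PI * x)) in *.
  assert (HC : (Co * Co = 1 - S * S)%R) by lra.
  transitivity ((1 - r * (1 - 2 * S * S)) ^ 2 + 4 * r ^ 2 * S ^ 2 * (Co * Co))%R; [ring|]. rewrite HC. ring. }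
assert (Ew : (Cmod w ^ 2 = x ^ 2 + y ^ 2)%R) by apply Cmod2_alt.
assert (Hq : ((2 * r * Cmod w) ^ 2 <= Cmod (1 - nome w) ^ 2)%R).
{ rewrite E, !Rpow_mult_distr, Ew.
  assert (H1 : (r ^ 2 * s ^ 2 <= (1 - r) ^ 2)%R). { replace (r ^ 2 * s ^ 2)%R with ((r * s) ^ 2)%R by ring. apply pow_incr. split; [nra|lra]. }
  assert (H2 : (4 * y ^ 2 <= s ^ 2)%R). { unfold s. replace (4 * y ^ 2)%R with ((2 * y) ^ 2)%R by ring. apply pow_incr. nra. }
  assert (H3 : (r ^ 2 * (4 * y ^ 2) <= r ^ 2 * s ^ 2)%R) by (apply Rmult_le_compat_l; [apply pow2_ge_0|exact H2]).
  assert (H4 : (r ^ 2 * x ^ 2 <= r * sin (PI * x) ^ 2)%R).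
  { apply Rmult_le_compat; [apply pow2_ge_0|apply pow2_ge_0|nra|exact Hsin]. }
  nra. }
assert (H0 := Cmod_ge_0 w). assert (H1 := Cmod_ge_0 (1 - nome w)).
apply Rsqr_incr_0_var; [|exact H1]. unfold Rsqr. nra.
Qed.

Lemma rsummable_inv_sqr : rsummable (fun n : nat => / INR (S n) ^ 2)%R.
Proof.
apply (rsummable_nat _ 2).
- intros n. left. apply Rinv_0_lt_compat. apply pow_lt. apply lt_0_INR. lia.
- assert (E : forall n, (rsum (fun n => / INR (S n) ^ 2)%R (seq 0 n) <= 2 * (1 - / INR (S n)))%R).
  { induction n.
    - simpl. lra.
    - rewrite seq_S, rsum_app. cbn [rsum fold_right Nat.add]. rewrite Rplus_0_r.
      eapply Rle_trans; [apply Rplus_le_compat_r, IHn|].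
      rewrite (S_INR (S n)). assert (Hn : (1 <= INR (S n))%R) by (rewrite S_INR; assert (H := pos_INR n); lra).
      set (t := INR (S n)) in *.
      assert (E : (2 * (1 - / (t + 1)) - (2 * (1 - / t) + / t ^ 2) = (t - 1) / (t ^ 2 * (t + 1)))%R) by (field; lra).
      assert (0 <= (t - 1) / (t ^ 2 * (t + 1)))%R. { apply Rle_mult_inv_pos; [lra|]. apply Rmult_lt_0_compat; [nra|lra]. }
      lra. }
  intros n. eapply Rle_trans; [apply E|]. assert (0 < / INR (S n))%R by (apply Rinv_0_lt_compat, lt_0_INR; lia). lra.
Qed.

Definition Zindex (n : Z) : nat := if (0 <=? n)%Z then (2 * Z.to_nat n)%nat else (2 * Z.to_nat (- n) - 1)%nat.

Lemma rsummable_Z : rsummable (fun n : Z => / (1 + IZR n ^ 2))%R.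
Proof.
apply (rsummable_le _ (fun n => 8 * / INR (S (Zindex n)) ^ 2)%R).
- intros n. assert (H : (0 <= IZR n ^ 2)%R) by apply pow2_ge_0. split; [left; apply Rinv_0_lt_compat; lra|].
  set (t := INR (S (Zindex n))).
  assert (Ht : (1 <= t <= 2 * Rabs (IZR n) + 1)%R).
  { unfold t. rewrite S_INR. split; [assert (P := pos_INR (Zindex n)); lra|].
    assert (INR (Zindex n) <= 2 * Rabs (IZR n))%R; [|lra].
    unfold Zindex. rewrite INR_IZR_INZ, <- abs_IZR, <- mult_IZR. apply IZR_le.
    destruct (Z.leb_spec 0 n); lia. }
  assert (Ha : (Rabs (IZR n) ^ 2 = IZR n ^ 2)%R) by apply pow2_abs.
  assert (Hp := Rabs_pos (IZR n)).
  assert (Ht2 : (t ^ 2 <= 8 * (1 + IZR n ^ 2))%R).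
  { apply Rle_trans with ((2 * Rabs (IZR n) + 1) ^ 2)%R; [apply pow_incr; lra|]. nra. }
  apply Rmult_le_reg_l with (t ^ 2)%R; [nra|].
  replace (t ^ 2 * (8 * / t ^ 2))%R with 8%R by (field; lra).
  apply Rmult_le_reg_r with (1 + IZR n ^ 2)%R; [lra|]. rewrite Rmult_assoc, Rinv_l by lra. lra.
- apply rsummable_scal; [lra|]. apply (rsummable_inj Zindex (fun n => / INR (S n) ^ 2)%R); [|exact rsummable_inv_sqr].
  intros a b. unfold Zindex. destruct (Z.leb_spec 0 a), (Z.leb_spec 0 b); lia.
Qed.

Definition children (L : list Z) : list Z := flat_map (fun j => [2 * j; 2 * j + 1]%Z) L.

(** The integers -2^M <= j < 2^M, listed in the tree order in which repeated halving produces the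
    points (z + j) / 2^(M+1). *)
Fixpoint dyadic (M : nat) : list Z :=
  match M with O => [-1; 0]%Z | S M' => children (dyadic M') end.

Lemma in_children (x : Z) (L : list Z) : In x (children L) <-> In (x / 2)%Z L.
Proof.
unfold children. rewrite in_flat_map. split.
- intros [j [Hj [E|[E|[]]]]]; subst x.
  + now rewrite Z.mul_comm, Z.div_mul by lia.
  + replace (2 * j + 1)%Z with (1 + j * 2)%Z by ring. rewrite Z.div_add by lia. now replace (1 / 2 + j)%Z with j by reflexivity.
- intros H. exists (x / 2)%Z. split; [exact H|]. assert (E := Z.div_mod x 2 ltac:(lia)).
  assert (B := Z.mod_pos_bound x 2 ltac:(lia)). cbn [In]. lia.
Qed.

Lemma NoDup_children (L : list Z) : NoDup L -> NoDup (children L).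
Proof.
induction 1 as [|j L Hj HL IH]; simpl; [constructor|].
assert (H0 : ~ In (2 * j)%Z (children L)). { rewrite in_children, Z.mul_comm, Z.div_mul by lia. exact Hj. }
assert (H1 : ~ In (2 * j + 1)%Z (children L)).
{ rewrite in_children. replace (2 * j + 1)%Z with (1 + j * 2)%Z by ring. rewrite Z.div_add by lia. exact Hj. }
constructor; [|constructor; assumption]. simpl. intros [E|E]; [lia|now apply H0].
Qed.

Lemma NoDup_dyadic (M : nat) : NoDup (dyadic M).
Proof. induction M; simpl; [repeat constructor; simpl; lia|now apply NoDup_children]. Qed.

Lemma in_dyadic (M : nat) (j : Z) : In j (dyadic M) <-> (- 2 ^ Z.of_nat M <= j < 2 ^ Z.of_nat M)%Z.
Proof.
revert j. induction M as [|M IH]; intros j.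
- simpl. lia.
- cbn [dyadic]. rewrite in_children, IH, Nat2Z.inj_succ, Z.pow_succ_r by lia.
  assert (E := Z.div_mod j 2 ltac:(lia)). assert (B := Z.mod_pos_bound j 2 ltac:(lia)). lia.
Qed.

Lemma lsum_children (f : Z -> C) (L : list Z) :
  lsum f (children L) = lsum (fun j => f (2 * j)%Z + f (2 * j + 1)%Z) L.
Proof. induction L; cbn [children flat_map app lsum fold_right]; [reflexivity|]. unfold lsum, children in IHL. rewrite IHL. ring. Qed.

Lemma Cpow_even_opp (n : nat) (z : C) : (- z) ^ (2 * n) = z ^ (2 * n).
Proof. rewrite !Cpow_mult_r. f_equal. simpl. ring. Qed.

Lemma rsummable_shifted_pow (z : C) (k : nat) : (2 <= k)%nat -> (0 <= Re z <= 1)%R ->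
  (forall n : Z, z + IZR n <> 0) -> rsummable (fun n : Z => Cmod ((/ (z + IZR n)) ^ k)).
Proof.
intros Hk Hz Hne.
(* For 0 <= Re z <= 1 the modulus of z + n is at least n for n >= 1 and at least - n - 1 for n <=
   -2, which the 8 covers; the terms n = 0 and n = -1 are put into the constant. *)
set (A := (8 + Cmod ((/ z) ^ k) + 2 * Cmod ((/ (z + IZR (-1))) ^ k))%R).
assert (P1 := Cmod_ge_0 ((/ z) ^ k)). assert (P2 := Cmod_ge_0 ((/ (z + IZR (-1))) ^ k)).
apply (rsummable_le _ (fun n => A * / (1 + IZR n ^ 2))%R); [|apply rsummable_scal; [unfold A; lra|exact rsummable_Z]].
intros n. split; [apply Cmod_ge_0|].
assert (HRe : forall m : Z, (Rabs (Re z + IZR m) <= Cmod (z + IZR m))%R).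
{ intros m. replace (Re z + IZR m)%R with (Re (z + IZR m)) by reflexivity. apply re_le_Cmod. }
assert (Hsq : (0 <= IZR n ^ 2)%R) by apply pow2_ge_0.
assert (Hgen : forall t : R, (1 <= t)%R -> (t <= Cmod (z + IZR n))%R -> (1 + IZR n ^ 2 <= 8 * t ^ 2)%R ->
  (Cmod ((/ (z + IZR n)) ^ k) <= A * / (1 + IZR n ^ 2))%R).
{ intros t Ht1 Ht2 Ht3. rewrite Cmod_pow, Cmod_inv by apply Hne.
  apply Rle_trans with ((/ t) ^ 2)%R.
  - apply Rle_trans with ((/ t) ^ k)%R.
    + apply pow_incr. split; [left; apply Rinv_0_lt_compat; lra|]. apply Rinv_le_contravar; lra.
    + destruct (Req_dec t 1) as [->|Ht]; [rewrite Rinv_1, !pow1; lra|].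
      apply pow_le_1_mono; [|exact Hk]. split; [apply Rinv_0_lt_compat; lra|].
      rewrite <- Rinv_1. apply Rinv_lt_contravar; lra.
  - apply Rle_trans with (8 * / (1 + IZR n ^ 2))%R.
    + rewrite pow_inv. apply Rmult_le_reg_l with (t ^ 2)%R; [nra|]. rewrite Rinv_r by nra.
      apply Rmult_le_reg_r with (1 + IZR n ^ 2)%R; [lra|].
      replace (t ^ 2 * (8 * / (1 + IZR n ^ 2)) * (1 + IZR n ^ 2))%R with (8 * t ^ 2)%R by (field; lra). lra.
    + apply Rmult_le_compat_r; [left; apply Rinv_0_lt_compat; lra|unfold A; lra]. }
destruct (Z_le_gt_dec 1 n) as [H1|H1].
- apply (Hgen (IZR n)).
  + now apply IZR_le in H1.
  + eapply Rle_trans; [|apply HRe]. apply IZR_le in H1. rewrite Rabs_pos_eq by lra. lra.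
  + apply IZR_le in H1. nra.
- destruct (Z_le_gt_dec n (-2)) as [H2|H2].
  + apply (Hgen (- IZR n - 1)%R); apply IZR_le in H2.
    * lra.
    * eapply Rle_trans; [|apply HRe]. rewrite Rabs_left by lra. lra.
    * nra.
  + assert (E : n = 0%Z \/ n = (-1)%Z) by lia. destruct E as [->| ->].
    * replace (z + IZR 0) with z by ring. replace (1 + IZR 0 ^ 2)%R with 1%R by ring. rewrite Rinv_1. unfold A. lra.
    * replace (1 + IZR (-1) ^ 2)%R with 2%R by ring. unfold A. lra.
Qed.

(** * Lipschitz's formula from the duplication formula *)

Section lipschitz.
Variables (h : nat) (P : C -> C) (B : R) (kappa : C).
Hypothesis Hh : (1 <= h)%nat.
Let k := (2 * h)%nat.
Hypothesis HPb : forall u : C, (Cmod u <= 1)%R -> (Cmod (P u) <= B)%R.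
Hypothesis HPd : forall u : C, exists l, is_Cderive P u l.
Hypothesis HP1 : P 1 = kappa.
Hypothesis Hk0 : kappa <> 0.
(** In the applications this is the series of d^(k-1) u^d continued as a rational function, and
    kappa = P 1 is (k-1)!. The continuation gives the formula also on the real axis, in particular
    at z = 1/2. *)
Let Rk (u : C) : C := P u * (/ (1 - u)) ^ k.
Hypothesis Hdup : forall u : C, u <> 1 -> u <> - (1) -> Rk u + Rk (- u) = 2 ^ k * Rk (u * u).

Let pt (z : C) (M : nat) (j : Z) : C := (z + IZR j) * / 2 ^ S M.

Lemma two_pow_nz (n : nat) : (2 : C) ^ n <> 0.
Proof. apply Cpow_nz. intros E. apply RtoC_inj in E. lra. Qed.

Lemma dyadic_sum (M : nat) : forall z, nome z <> 1 ->
  (2 ^ k) ^ S M * Rk (nome z) = lsum (fun j => Rk (nome (pt z M j))) (dyadic M).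
Proof.
assert (H2 : (2 : C) <> 0) by (intros E; apply RtoC_inj in E; lra).
assert (Hdup' : forall z, nome z <> 1 -> 2 ^ k * Rk (nome z) = Rk (nome (z * / 2)) + Rk (nome ((z + 1) * / 2))).
{ intros z Hz. set (u := nome (z * / 2)).
  assert (Eu : nome z = u * u). { unfold u. rewrite <- nome_plus. f_equal. field. }
  assert (En : nome ((z + 1) * / 2) = - u).
  { replace ((z + 1) * / 2) with (z * / 2 + RtoC (1 / 2)).
    - rewrite nome_plus, nome_half. fold u. ring.
    - rewrite RtoC_div by lra. field. }
  rewrite En, Eu. symmetry. apply Hdup; intros E; apply Hz; rewrite Eu, E; ring. }
induction M as [|M IH]; intros z Hz.
- cbn [dyadic lsum fold_right].
  replace ((2 ^ k) ^ 1 * Rk (nome z)) with (2 ^ k * Rk (nome z)) by (simpl; ring).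
  rewrite (Hdup' z Hz).
  (* The list starts with j = -1 in place of j = 1; the two points differ by 1, and the nome has
     period 1. *)
  assert (E1 : nome (pt z 0 (-1)) = nome ((z + 1) * / 2)).
  { rewrite <- (nome_shift (pt z 0 (-1)) 1). f_equal. unfold pt. simpl. field. }
  assert (E2 : pt z 0 0 = z * / 2) by (unfold pt; simpl; field).
  rewrite E1, E2. ring.
- cbn [dyadic]. rewrite lsum_children, lsum_plus.
  replace ((2 ^ k) ^ S (S M) * Rk (nome z)) with ((2 ^ k) ^ S M * (2 ^ k * Rk (nome z))) by (simpl; ring).
  rewrite (Hdup' z Hz), Cmult_plus_distr_l.
  assert (Hz1 : nome (z * / 2) <> 1).
  { intros E. apply Hz. replace z with (z * / 2 + z * / 2) by field. rewrite nome_plus, E. ring. }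
  assert (Hz2 : nome ((z + 1) * / 2) <> 1).
  { intros E. apply Hz. rewrite <- (nome_shift z 1). replace (z + IZR 1) with ((z + 1) * / 2 + (z + 1) * / 2) by (simpl; field). rewrite nome_plus, E. ring. }
  rewrite (IH _ Hz1), (IH _ Hz2). f_equal; apply lsum_ext; intros j _; do 2 f_equal; unfold pt.
  + rewrite mult_IZR, RtoC_mult. assert (N := two_pow_nz (S M)). change (2 ^ S (S M)) with (2 * 2 ^ S M). field. auto.
  + rewrite plus_IZR, mult_IZR, RtoC_plus, RtoC_mult. assert (N := two_pow_nz (S M)). change (2 ^ S (S M)) with (2 * 2 ^ S M). field. auto.
Qed.

Lemma nome_1_sub (w : C) : w <> 0 -> (Rabs (Re w) <= 1 / 2)%R -> (0 <= Im w)%R -> 1 - nome w <> 0.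
Proof.
intros Hw Hx Hy. apply Cmod_gt_0. eapply Rlt_le_trans; [|now apply one_sub_nome_lower].
repeat apply Rmult_lt_0_compat; [lra|apply exp_pos|now apply Cmod_gt_0].
Qed.

Let c := (2 * PI * Ci) ^ k * / kappa.

(** (nome w - 1) / w tends to 2 pi i, the derivative of the nome at 0, and c is chosen to normalise
    the limit to 1. *)
Lemma kernel_limit : forall eps, (0 < eps)%R -> exists delta, (0 < delta)%R /\
  forall w : C, w <> 0 -> (Cmod w < delta)%R ->
   (Cmod (c * P (nome w) * (w * / (1 - nome w)) ^ k - 1) < eps)%R.
Proof.
set (q := fun z : C => if excluded_middle_informative (z = 0) then 2 * PI * Ci * nome 0 else (nome z - nome 0) * / (z - 0)).
assert (Hq : Ccont q 0) by (apply difference_quotient_cont, nome_derive).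
assert (Hq0 : q 0 = 2 * PI * Ci).
{ unfold q. destruct (excluded_middle_informative (RtoC 0 = 0)) as [_|N]; [|now destruct N]. rewrite nome_0. ring. }
assert (HN := two_pi_i_nz).
assert (Hc : Ccont (fun w => c * (P (nome w) * (/ q w) ^ k)) 0).
{ apply (Ccont_mult (fun _ => c)); [exact (is_Cderive_Ccont _ _ _ (is_Cderive_const c 0))|].
  apply (Ccont_mult (fun w => P (nome w))).
  - apply Ccont_comp; [|exact (is_Cderive_Ccont _ _ _ (nome_derive 0))].
    destruct (HPd (nome 0)) as [l Hl]. exact (is_Cderive_Ccont _ _ _ Hl).
  - apply (Ccont_pow (fun w => / q w)). apply (Ccont_comp (fun w => / w) q); [|exact Hq].
    apply Ccont_inv. rewrite Hq0. exact HN. }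
intros eps Heps. destruct (Hc eps Heps) as [d [Hd Hw]]. exists d. split; [exact Hd|].
intros w Hw0 Hwd. specialize (Hw w). replace (w - 0) with w in Hw by ring. specialize (Hw Hwd).
assert (E0 : c * (P (nome 0) * (/ q 0) ^ k) = 1).
{ rewrite nome_0, HP1, Hq0. unfold c. rewrite Cpow_inv by exact HN. field. split; [now apply Cpow_nz|exact Hk0]. }
rewrite E0 in Hw.
assert (E1 : (/ q w) ^ k = (w * / (1 - nome w)) ^ k).
{ unfold q. destruct (excluded_middle_informative (w = 0)) as [|_]; [contradiction|]. rewrite nome_0.
  (* As k is even, nome w - 1 may be replaced by its negative. If it vanishes, both sides agree
     because the inverse of 0 is 0. *)
  unfold k. rewrite <- Cpow_even_opp. f_equal.
  destruct (excluded_middle_informative (1 - nome w = 0)) as [E|E].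
  - replace (nome w - 1) with (- (1 - nome w)) by ring. rewrite E.
    apply injective_projections; simpl; unfold Rdiv; ring.
  - replace (w - 0) with w by ring. field. repeat split; auto.
    intros E'. apply E. replace (1 - nome w) with (- (nome w - 1)) by ring. rewrite E'. ring. }
rewrite E1 in Hw. replace (c * P (nome w) * (w * / (1 - nome w)) ^ k) with (c * (P (nome w) * (w * / (1 - nome w)) ^ k)) by ring.
exact Hw.
Qed.

Lemma nome_ne_shift (z : C) (j : Z) : nome z <> 1 -> z + IZR j <> 0.
Proof.
intros Hz E. apply Hz. rewrite <- (nome_shift z j), E. apply nome_0.
Qed.

Let fn (z : C) (M : nat) (j : Z) : C := c * (/ (2 ^ k)) ^ S M * Rk (nome (pt z M j)).

(** For fixed j the point [pt z M j] tends to 0, so this splits the term into a factor tending to 1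
    and the summand of the limit series. *)
Lemma fn_eq (z : C) (M : nat) (j : Z) : z + IZR j <> 0 ->
  fn z M j = c * P (nome (pt z M j)) * (pt z M j * / (1 - nome (pt z M j))) ^ k * (/ (z + IZR j)) ^ k.
Proof.
intros Hz. unfold fn, Rk. set (w := pt z M j).
assert (E1 : (/ (2 ^ k)) ^ S M = (/ (2 ^ S M)) ^ k).
{ rewrite !Cpow_inv by apply two_pow_nz. f_equal. rewrite <- !Cpow_mult_r. f_equal. lia. }
assert (E2 : w ^ k * (/ (z + IZR j)) ^ k = (/ (2 ^ S M)) ^ k).
{ rewrite <- Cpow_mult_l. f_equal. unfold w, pt. field. split; first [exact Hz | apply two_pow_nz]. }
rewrite E1, <- E2, !Cpow_mult_l. ring.
Qed.

(** Tannery's theorem applied to the finite sums of [dyadic_sum]: [kernel_limit] gives the limits of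
    the terms, and a multiple of |z + n|^(-k) dominates. *)
Lemma lipschitz_strip (z : C) : (0 <= Re z <= 1)%R -> (0 <= Im z)%R -> nome z <> 1 ->
  has_sum (fun n : Z => (/ (z + IZR n)) ^ k) (c * Rk (nome z)).
Proof.
intros Hx Hy Hz.
assert (Hne : forall n : Z, z + IZR n <> 0) by (intros; now apply nome_ne_shift).
assert (HB : (0 <= B)%R). { eapply Rle_trans; [apply Cmod_ge_0|apply (HPb 0)]. rewrite Cmod_0. lra. }
set (r0 := exp (- (2 * PI * Im z))). assert (Hr0 : (0 < r0)%R) by apply exp_pos.
assert (Hir : (0 < / (2 * r0))%R) by (apply Rinv_0_lt_compat; lra).
(* The summand 1 makes the bound dominate the limit terms as well. *)
set (A := (1 + Cmod c * B * (/ (2 * r0)) ^ k)%R).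
assert (HA0 : (0 <= Cmod c * B * (/ (2 * r0)) ^ k)%R).
{ apply Rmult_le_pos; [apply Rmult_le_pos; [apply Cmod_ge_0|exact HB]|apply pow_le; lra]. }
assert (Hpw : forall M, (2 <= 2 ^ S M)%R). { intros M. simpl. assert (1 <= 2 ^ M)%R by (apply pow_R1_Rle; lra). lra. }
assert (Hpt : forall M j, pt z M j = RtoC (/ 2 ^ S M) * (z + IZR j)).
{ intros M j. unfold pt. rewrite RtoC_inv by (specialize (Hpw M); lra). rewrite RtoC_pow. ring. }
assert (Hre : forall M j, Re (pt z M j) = (/ 2 ^ S M * (Re z + IZR j))%R).
{ intros M j. rewrite Hpt, re_scal_l. reflexivity. }
assert (Him : forall M j, Im (pt z M j) = (/ 2 ^ S M * Im z)%R).
{ intros M j. rewrite Hpt, im_scal_l. simpl. unfold Im. ring. }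
assert (Hptnz : forall M j, pt z M j <> 0).
{ intros M j. unfold pt. apply Cmult_neq_0; [apply Hne|]. intros E. apply (two_pow_nz (S M)).
  replace (2 ^ S M) with (2 ^ S M * / 2 ^ S M * 2 ^ S M) by (field; apply two_pow_nz). rewrite E. ring. }
apply (tannery _ (fn z) (fun n => A * Cmod ((/ (z + IZR n)) ^ k))%R dyadic).
- apply rsummable_scal; [unfold A; lra|]. apply rsummable_shifted_pow; auto. unfold k; lia.
- intros i. assert (T := Cmod_ge_0 ((/ (z + IZR i)) ^ k)). unfold A. nra.
- intros M j Hj. rewrite fn_eq by apply Hne. rewrite Cmod_mult. apply Rmult_le_compat_r; [apply Cmod_ge_0|].
  set (w := pt z M j). specialize (Hpw M).
  assert (Hinv : (0 < / 2 ^ S M <= 1)%R).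
  { split; [apply Rinv_0_lt_compat; lra|]. rewrite <- Rinv_1. apply Rinv_le_contravar; lra. }
  (* The symmetric range of [dyadic M] and 0 <= Re z <= 1 place w in the strip where
     [one_sub_nome_lower] holds. *)
  assert (Hwx : (Rabs (Re w) <= 1 / 2)%R).
  { unfold w. rewrite Hre. apply in_dyadic in Hj. destruct Hj as [J1 J2].
    assert (J3 : (j <= 2 ^ Z.of_nat M - 1)%Z) by lia. apply IZR_le in J1, J3.
    rewrite opp_IZR in J1. rewrite minus_IZR in J3. rewrite <- pow_IZR in J1, J3.
    assert (Ep : (2 ^ S M = 2 * 2 ^ M)%R) by reflexivity.
    replace (1 / 2)%R with (/ 2 ^ S M * 2 ^ M)%R by (rewrite Ep; field; rewrite Ep in Hpw; lra).
    rewrite Rabs_mult, (Rabs_pos_eq (/ _)) by lra. apply Rmult_le_compat_l; [lra|]. apply Rabs_le. lra. }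
  assert (Hwy : (0 <= Im w <= Im z)%R).
  { unfold w. rewrite Him. split; [apply Rmult_le_pos; lra|]. rewrite <- (Rmult_1_l (Im z)) at 2. apply Rmult_le_compat_r; lra. }
  assert (Hlow := one_sub_nome_lower w Hwx (proj1 Hwy)).
  assert (HN := nome_1_sub w (Hptnz M j) Hwx (proj1 Hwy)).
  assert (HP := PI_RGT_0).
  assert (Hrr : (r0 <= exp (- (2 * PI * Im w)))%R).
  { unfold r0. destruct (Req_dec (Im w) (Im z)) as [->|Hne']; [lra|]. left. apply exp_increasing. nra. }
  assert (Hq : (Cmod (w * / (1 - nome w)) <= / (2 * r0))%R).
  { rewrite Cmod_mult, Cmod_inv by exact HN. assert (Hp := proj1 (Cmod_gt_0 _) HN).
    apply Rmult_le_reg_r with (Cmod (1 - nome w)); [exact Hp|]. rewrite Rmult_assoc, Rinv_l, Rmult_1_r by lra.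
    apply Rmult_le_reg_l with (2 * r0)%R; [lra|]. rewrite <- Rmult_assoc, Rinv_r, Rmult_1_l by lra.
    eapply Rle_trans; [|exact Hlow]. apply Rmult_le_compat_r; [apply Cmod_ge_0|lra]. }
  rewrite !Cmod_mult, Cmod_pow. unfold A.
  assert (Hn1 : (Cmod (nome w) <= 1)%R).
  { rewrite Cmod_nome, <- exp_0. destruct (Req_dec (Im w) 0) as [->|Hne']; [right; f_equal; ring|]. left. apply exp_increasing. nra. }
  assert (Hlast : (Cmod c * Cmod (P (nome w)) * Cmod (w * / (1 - nome w)) ^ k <= Cmod c * B * (/ (2 * r0)) ^ k)%R).
  { apply Rmult_le_compat.
    - apply Rmult_le_pos; apply Cmod_ge_0.
    - apply pow_le, Cmod_ge_0.
    - apply Rmult_le_compat_l; [apply Cmod_ge_0|now apply HPb].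
    - apply pow_incr. split; [apply Cmod_ge_0|exact Hq]. }
  lra.
- intros. apply NoDup_dyadic.
- intros i. exists (Z.to_nat (Z.abs i)). intros n Hn. apply in_dyadic.
  assert (G := Z.pow_gt_lin_r 2 (Z.of_nat n) ltac:(lia) ltac:(lia)). lia.
- intros j eps Heps. set (f := (/ (z + IZR j)) ^ k). assert (Hf := Cmod_ge_0 f).
  destruct (kernel_limit (eps / (Cmod f + 1))%R ltac:(apply Rdiv_lt_0_compat; lra)) as [d [Hd Hw]].
  destruct (pow_lt_1_zero (1 / 2) ltac:(rewrite Rabs_pos_eq; lra) (d / (Cmod (z + IZR j) + 1)) ltac:(apply Rdiv_lt_0_compat; [lra|assert (T := Cmod_ge_0 (z + IZR j)); lra])) as [N HN].
  exists N. intros n Hn. rewrite fn_eq by apply Hne. fold f. set (w := pt z n j).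
  match goal with |- (Cmod (?H * f - f) < _)%R => replace (H * f - f) with ((H - 1) * f) by ring end.
  assert (Hwd : (Cmod w < d)%R).
  { unfold w. rewrite Hpt, Cmod_mult, Cmod_R. specialize (HN (S n) ltac:(lia)).
    assert (T := Cmod_ge_0 (z + IZR j)). apply Rlt_div_r in HN; [|lra].
    rewrite <- pow_inv. replace (/ 2)%R with (1 / 2)%R by lra.
    assert (T2 := Rabs_pos ((1 / 2) ^ S n)). nra. }
  specialize (Hw w (Hptnz n j) Hwd). rewrite Cmod_mult.
  apply Rlt_div_r in Hw; [|lra].
  match goal with |- (?a * _ < _)%R => assert (T := Cmod_ge_0 (c * P (nome w) * (w * / (1 - nome w)) ^ k - 1)) end. nra.
- intros M. unfold fn. rewrite lsum_scal, <- dyadic_sum by exact Hz.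
  rewrite Cpow_inv by apply two_pow_nz. field. apply Cpow_nz, two_pow_nz.
Qed.

(** Both sides have period 1, so z can be moved into the strip 0 <= Re z <= 1. *)
Lemma lipschitz (z : C) : (0 <= Im z)%R -> nome z <> 1 ->
  has_sum (fun n : Z => (/ (z + IZR n)) ^ k) (c * Rk (nome z)).
Proof.
intros Hy Hz. set (m := Int_part (Re z)).
assert (Em : nome (z + IZR (- m)) = nome z) by apply nome_shift.
rewrite <- Em.
apply (has_sum_inj (fun n => n - m)%Z).
- intros; lia.
- intros i Hi. exfalso. apply (Hi (i + m)%Z). lia.
- eapply has_sum_ext; [|apply (lipschitz_strip (z + IZR (- m)))].
  + intros n. simpl. do 2 f_equal. unfold Zminus. rewrite plus_IZR, RtoC_plus. ring.
  + rewrite re_plus, re_RtoC, opp_IZR. destruct (base_Int_part (Re z)) as [H1 H2]. fold m in H1, H2. lra.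
  + rewrite im_plus, im_RtoC. lra.
  + now rewrite Em.
Qed.
End lipschitz.

(** * Lattice sums and modularity of E4 and E6 *)

Lemma Cinv_0 : / (RtoC 0) = 0.
Proof. apply injective_projections; simpl; unfold Rdiv; ring. Qed.

Lemma Cpow_0_l (n : nat) : (1 <= n)%nat -> (RtoC 0) ^ n = 0.
Proof. destruct n; [lia|]. intros _. simpl. ring. Qed.

(** With w = m tau + n, the imaginary part bounds |m| by |w| / y, and the real part then bounds |n|
    by |w| + |m| |x|. *)
Lemma lattice_lower (tau : C) : upper tau -> exists K, (1 <= K)%R /\
  forall m n : Z, (IZR m ^ 2 + IZR n ^ 2 <= K ^ 2 * Cmod (IZR m * tau + IZR n) ^ 2)%R.
Proof.
intros Ht. unfold upper in Ht. set (x := Re tau). set (y := Im tau) in *.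
exists (1 + (1 + Rabs x) / y)%R.
assert (Hx := Rabs_pos x).
assert (Hq : (0 < (1 + Rabs x) / y)%R) by (apply Rdiv_lt_0_compat; lra).
split; [lra|]. intros m n. set (w := IZR m * tau + IZR n).
assert (E1 : Re w = (IZR m * x + IZR n)%R) by (unfold w, x; simpl; unfold Re; ring).
assert (E2 : Im w = (IZR m * y)%R) by (unfold w, y; simpl; unfold Im; ring).
assert (I1 := re_le_Cmod w). assert (I2 := Im_le_Cmod w). rewrite E1 in I1. rewrite E2 in I2.
rewrite Rabs_mult, (Rabs_pos_eq y) in I2 by lra. apply Rle_div_r in I2; [|lra].
set (W := Cmod w) in *. assert (HW : (0 <= W)%R) by apply Cmod_ge_0.
assert (Hm := Rabs_pos (IZR m)). assert (Hn := Rabs_pos (IZR n)).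
assert (I3 : (Rabs (IZR n) <= W + Rabs (IZR m) * Rabs x)%R).
{ replace (IZR n) with ((IZR m * x + IZR n) + - (IZR m * x))%R at 1 by ring.
  eapply Rle_trans; [apply Rabs_triang|]. rewrite Rabs_Ropp, Rabs_mult. lra. }
assert (I4 : (Rabs (IZR m) + Rabs (IZR n) <= (1 + (1 + Rabs x) / y) * W)%R).
{ apply Rle_trans with (W + (1 + Rabs x) * Rabs (IZR m))%R; [lra|].
  assert ((1 + Rabs x) * Rabs (IZR m) <= (1 + Rabs x) * (W / y))%R by (apply Rmult_le_compat_l; lra).
  unfold Rdiv in *. lra. }
rewrite <- Rpow_mult_distr. rewrite <- (pow2_abs (IZR m)), <- (pow2_abs (IZR n)).
apply Rle_trans with ((Rabs (IZR m) + Rabs (IZR n)) ^ 2)%R; [nra|]. apply pow_incr. lra.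
Qed.

Lemma has_sum_Z_split (f : Z -> C) (s t : C) :
  has_sum (fun m : nat => f (Z.of_nat (S m))) s -> has_sum (fun m : nat => f (- Z.of_nat (S m))%Z) t ->
  has_sum f (f 0%Z + s + t).
Proof.
intros Hs Ht.
assert (H0 : has_sum (fun n => if (n =? 0)%Z then f 0%Z else RtoC 0) (f 0%Z)).
{ set (g := fun n => if (n =? 0)%Z then f 0%Z else RtoC 0).
  assert (E : lsum g [0%Z] = f 0%Z) by (unfold g; simpl; ring). rewrite <- E.
  apply has_sum_finite; [repeat constructor; simpl; tauto|]. intros i Hi. unfold g. destruct (Z.eqb_spec i 0); [|reflexivity].
  exfalso; apply Hi; subst; now left. }
assert (H1 : has_sum (fun n => if (0 <? n)%Z then f n else RtoC 0) s).
{ apply (has_sum_inj (fun m : nat => Z.of_nat (S m))); [intros; lia|..].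
  - intros i Hi. destruct (Z.ltb_spec 0 i); [|reflexivity]. exfalso. apply (Hi (Z.to_nat (i - 1))). lia.
  - eapply has_sum_ext; [|exact Hs]. intros m. cbv beta. destruct (Z.ltb_spec 0 (Z.of_nat (S m))); [reflexivity|lia]. }
assert (H2 : has_sum (fun n => if (n <? 0)%Z then f n else RtoC 0) t).
{ apply (has_sum_inj (fun m : nat => (- Z.of_nat (S m))%Z)); [intros; lia|..].
  - intros i Hi. destruct (Z.ltb_spec i 0); [|reflexivity]. exfalso. apply (Hi (Z.to_nat (- i - 1))). lia.
  - eapply has_sum_ext; [|exact Ht]. intros m. cbv beta. destruct (Z.ltb_spec (- Z.of_nat (S m)) 0); [reflexivity|lia]. }
eapply has_sum_ext; [|exact (has_sum_plus _ _ _ _ (has_sum_plus _ _ _ _ H0 H1) H2)].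
intros i. cbv beta. destruct (Z.eqb_spec i 0), (Z.ltb_spec 0 i), (Z.ltb_spec i 0); try lia; subst; ring.
Qed.

Lemma mobius_den_nz (c d : Z) (tau : C) : upper tau -> (c <> 0 \/ d <> 0)%Z -> IZR c * tau + IZR d <> 0.
Proof.
intros Ht Hcd E. unfold upper in Ht.
assert (E2 : Im (IZR c * tau + IZR d) = (IZR c * Im tau)%R) by (simpl; unfold Im; ring).
rewrite E in E2. simpl in E2. symmetry in E2. apply Rmult_integral in E2. destruct E2 as [E2|E2]; [|lra].
apply (eq_IZR c 0) in E2. subst c.
assert (E1 : Re (IZR 0 * tau + IZR d) = IZR d) by (simpl; unfold Re; ring).
rewrite E in E1. simpl in E1. symmetry in E1. apply (eq_IZR d 0) in E1. lia.
Qed.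

Lemma upper_mobius (a b c d : Z) (tau : C) : (a * d - b * c = 1)%Z -> upper tau ->
  upper ((IZR a * tau + IZR b) / (IZR c * tau + IZR d)).
Proof.
intros Hdet Ht.
assert (HN : IZR c * tau + IZR d <> 0) by (apply mobius_den_nz; [exact Ht|]; destruct (Z.eq_dec c 0); [right|left]; lia).
unfold upper in *. set (w := IZR c * tau + IZR d) in *.
assert (Hw := proj1 (Cmod_gt_0 w) HN).
assert (E : Im ((IZR a * tau + IZR b) / w) = (Im tau / Cmod w ^ 2)%R).
{ rewrite Cmod2_alt.
  assert (Hd : (IZR a * IZR d - IZR b * IZR c = 1)%R) by (rewrite <- !mult_IZR, <- minus_IZR, Hdet; reflexivity).
  assert (Hden : (Re w ^ 2 + Im w ^ 2 <> 0)%R) by (rewrite <- Cmod2_alt; nra).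
  unfold Cdiv. rewrite im_mult.
  change (Re (/ w)) with (Re w / (Re w ^ 2 + Im w ^ 2))%R. change (Im (/ w)) with (- Im w / (Re w ^ 2 + Im w ^ 2))%R.
  assert (Rw : Re w = (IZR c * Re tau + IZR d)%R) by (unfold w; simpl; unfold Re; ring).
  assert (Iw : Im w = (IZR c * Im tau)%R) by (unfold w; simpl; unfold Im; ring).
  assert (Ra : Re (IZR a * tau + IZR b) = (IZR a * Re tau + IZR b)%R) by (simpl; unfold Re; ring).
  assert (Ia : Im (IZR a * tau + IZR b) = (IZR a * Im tau)%R) by (simpl; unfold Im; ring).
  rewrite Ra, Ia.
  transitivity (((IZR a * IZR d - IZR b * IZR c) * Im tau) / (Re w ^ 2 + Im w ^ 2))%R; [|rewrite Hd; field; exact Hden].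
  rewrite Rw, Iw in *. field. exact Hden. }
rewrite E. apply Rdiv_lt_0_compat; [exact Ht|]. nra.
Qed.

(** As the inverse of 0 is 0, the term at (0, 0) vanishes for k >= 1; the sum can run over all of Z
    x Z, on which the modular group acts. *)
Definition lattice_term (k : nat) (tau : C) (p : Z * Z) : C := (/ (IZR (fst p) * tau + IZR (snd p))) ^ k.

(** Away from the origin (1 + m^2)(1 + n^2) <= 3 (m^2 + n^2)^2, so for k >= 4 a product of two
    convergent sums over Z dominates. *)
Lemma lattice_summable (k : nat) (tau : C) : (4 <= k)%nat -> upper tau ->
  rsummable (fun p => Cmod (lattice_term k tau p)).
Proof.
intros Hk Ht. destruct (lattice_lower tau Ht) as (K & HK & Hlow).
apply (rsummable_le _ (fun p : Z * Z => 3 * K ^ k * (/ (1 + IZR (fst p) ^ 2) * / (1 + IZR (snd p) ^ 2)))%R).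
2:{ apply rsummable_scal; [apply Rmult_le_pos; [lra|apply pow_le; lra]|].
    exact (rsummable_prod _ _ rsummable_Z rsummable_Z). }
intros [m n]. split; [apply Cmod_ge_0|]. unfold lattice_term. cbn [fst snd].
assert (HKk : (0 < K ^ k)%R) by (apply pow_lt; lra).
assert (Hm : (0 <= IZR m ^ 2)%R) by apply pow2_ge_0. assert (Hn : (0 <= IZR n ^ 2)%R) by apply pow2_ge_0.
assert (Hpos : (0 < / (1 + IZR m ^ 2) * / (1 + IZR n ^ 2))%R) by (apply Rmult_lt_0_compat; apply Rinv_0_lt_compat; lra).
destruct (Z.eq_dec m 0) as [Em|Em], (Z.eq_dec n 0) as [En|En].
{ subst. replace (IZR 0 * tau + IZR 0) with (RtoC 0) by ring. rewrite Cinv_0, Cpow_0_l, Cmod_0 by lia. nra. }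
all: assert (HN : IZR m * tau + IZR n <> 0) by (apply mobius_den_nz; [exact Ht|tauto]).
all: specialize (Hlow m n); set (w := IZR m * tau + IZR n) in *.
all: assert (Hw := proj1 (Cmod_gt_0 w) HN).
all: assert (Hs : (1 <= IZR m ^ 2 + IZR n ^ 2)%R) by
 (rewrite !pow_IZR, <- plus_IZR; apply IZR_le; assert (0 <= m ^ 2)%Z by nia; assert (0 <= n ^ 2)%Z by nia; change (Z.of_nat 2) with 2%Z; nia).
all: set (W := Cmod w) in *; rewrite Cmod_pow, Cmod_inv by exact HN; fold W.
all: assert (HKW : (1 <= (K * W) ^ 2)%R) by (rewrite Rpow_mult_distr; lra).
all: assert (HKW1 : (1 <= K * W)%R) by (assert (0 < K * W)%R by (apply Rmult_lt_0_compat; lra); nra).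
all: assert (Hpk : ((K * W) ^ 4 <= (K * W) ^ k)%R) by (apply Rle_pow; [exact HKW1|exact Hk]).
all: assert (H4 : ((IZR m ^ 2 + IZR n ^ 2) ^ 2 <= (K * W) ^ 4)%R) by
 (replace ((K * W) ^ 4)%R with ((K ^ 2 * W ^ 2) ^ 2)%R by ring; apply pow_incr; lra).
all: assert (H5 : ((1 + IZR m ^ 2) * (1 + IZR n ^ 2) <= 3 * (K * W) ^ k)%R) by nra.
all: rewrite Rpow_mult_distr in H5; assert (HWk : (0 < W ^ k)%R) by (apply pow_lt; lra).
all: rewrite pow_inv; apply Rmult_le_reg_r with (W ^ k)%R; [exact HWk|]; rewrite Rinv_l by lra.
all: apply Rmult_le_reg_r with ((1 + IZR m ^ 2) * (1 + IZR n ^ 2))%R; [apply Rmult_lt_0_compat; lra|].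
all: rewrite Rmult_1_l; eapply Rle_trans; [exact H5|]; right; field; lra.
Qed.

Definition lattice_sum (k : nat) (tau : C) : C := Csum (lattice_term k tau).

(** The matrix permutes the index pairs by (m, n) |-> (m a + n c, m b + n d), and clearing the
    denominator c tau + d produces the automorphy factor. *)
Lemma lattice_modular (k : nat) (a b c d : Z) (tau : C) : (4 <= k)%nat -> (a * d - b * c = 1)%Z -> upper tau ->
  lattice_sum k ((IZR a * tau + IZR b) / (IZR c * tau + IZR d)) = (IZR c * tau + IZR d) ^ k * lattice_sum k tau.
Proof.
intros Hk Hdet Ht. unfold lattice_sum at 1. apply Csum_unique.
assert (HN : IZR c * tau + IZR d <> 0) by (apply mobius_den_nz; [exact Ht|]; destruct (Z.eq_dec c 0); [right|left]; lia).
assert (H := Csum_correct _ (lattice_summable k tau Hk Ht)). fold (lattice_sum k tau) in H.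
apply (has_sum_inj (fun p : Z * Z => (fst p * a + snd p * c, fst p * b + snd p * d)%Z)) in H.
- eapply has_sum_ext; [|exact (has_sum_scal ((IZR c * tau + IZR d) ^ k) _ _ H)].
  intros [m n]. unfold lattice_term. cbn [fst snd]. rewrite <- Cpow_mult_l. f_equal.
  set (w := IZR c * tau + IZR d) in *.
  set (N := IZR (m * a + n * c) * tau + IZR (m * b + n * d)).
  assert (E : IZR m * ((IZR a * tau + IZR b) / w) + IZR n = N / w).
  { unfold N. rewrite !plus_IZR, !mult_IZR, !RtoC_plus, !RtoC_mult.
    transitivity ((IZR m * (IZR a * tau + IZR b) + IZR n * w) / w); [field; exact HN|]. f_equal. unfold w. ring. }
  (* N = 0 occurs at the origin, where both sides vanish by the convention for the inverse of 0. *)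
  rewrite E. destruct (excluded_middle_informative (N = 0)) as [E0|E0].
  + rewrite E0. replace (0 / w) with (RtoC 0) by (field; exact HN). rewrite Cinv_0. ring.
  + field. auto.
- assert (Dm : forall m n, ((m * a + n * c) * d - (m * b + n * d) * c)%Z = m).
  { intros m n. transitivity (m * (a * d - b * c))%Z; [ring|rewrite Hdet; ring]. }
  assert (Dn : forall m n, ((m * b + n * d) * a - (m * a + n * c) * b)%Z = n).
  { intros m n. transitivity (n * (a * d - b * c))%Z; [ring|rewrite Hdet; ring]. }
  intros [m n] [m' n'] E. cbn [fst snd] in E. inversion E as [[E1 E2]]. f_equal.
  + rewrite <- (Dm m n), E1, E2. apply Dm.
  + rewrite <- (Dn m n), E1, E2. apply Dn.
- intros [m n] Hi. exfalso. apply (Hi (m * d - n * c, n * a - m * b)%Z). cbn [fst snd]. f_equal.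
  + transitivity (m * (a * d - b * c))%Z; [rewrite Hdet; ring|ring].
  + transitivity (n * (a * d - b * c))%Z; [rewrite Hdet; ring|ring].
Qed.

(** * Fourier expansion of the lattice sums *)

Section fourier.
Variables (h : nat) (P : C -> C) (c : C).
Hypothesis Hh : (2 <= h)%nat.
Let k := (2 * h)%nat.
Let Rk (u : C) : C := P u * (/ (1 - u)) ^ k.
Hypothesis Hlip : forall z, (0 <= Im z)%R -> nome z <> 1 ->
  has_sum (fun n : Z => (/ (z + IZR n)) ^ k) (c * Rk (nome z)).
Hypothesis Hser : forall Q, (Cmod Q < 1)%R ->
  has_sum (fun n : nat => INR (S n) ^ (k - 1) * Q ^ S n) (Rk Q).

(** For even k >= 2 this is 2 zeta(k), the term n = 0 being 0. *)
Definition zeta_Z (k : nat) : C := Csum (fun n : Z => (/ IZR n) ^ k).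

Lemma zeta_Z_correct : has_sum (fun n : Z => (/ IZR n) ^ k) (zeta_Z k).
Proof.
apply Csum_correct. apply (rsummable_le _ (fun n => 2 * / (1 + IZR n ^ 2))%R); [|apply rsummable_scal; [lra|exact rsummable_Z]].
intros n. split; [apply Cmod_ge_0|].
assert (Hn : (0 <= IZR n ^ 2)%R) by apply pow2_ge_0.
assert (Hp : (0 < / (1 + IZR n ^ 2))%R) by (apply Rinv_0_lt_compat; lra).
destruct (Z.eq_dec n 0) as [->|Hn0].
- rewrite Cinv_0, Cpow_0_l, Cmod_0 by (unfold k; lia). lra.
- assert (HN : RtoC (IZR n) <> 0). { intros E. apply RtoC_inj in E. now apply (eq_IZR n 0) in E. }
  assert (H1 : (1 <= Rabs (IZR n))%R). { rewrite <- abs_IZR. apply IZR_le. lia. }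
  rewrite Cmod_pow, Cmod_inv, Cmod_R by exact HN. rewrite pow_inv.
  assert (H2 : (Rabs (IZR n) ^ 2 <= Rabs (IZR n) ^ k)%R) by (apply Rle_pow; [exact H1|unfold k; lia]).
  rewrite pow2_abs in H2. assert (1 <= IZR n ^ 2)%R by (rewrite <- pow2_abs; nra).
  apply Rle_trans with (/ IZR n ^ 2)%R; [apply Rinv_le_contravar; lra|].
  apply Rmult_le_reg_l with (IZR n ^ 2)%R; [lra|]. rewrite Rinv_r by lra.
  apply Rmult_le_reg_r with (1 + IZR n ^ 2)%R; [lra|].
  replace (IZR n ^ 2 * (2 * / (1 + IZR n ^ 2)) * (1 + IZR n ^ 2))%R with (2 * IZR n ^ 2)%R by (field; lra). lra.
Qed.

(** Splitting the integers into even and odd ones and using the case z = 1/2 of the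
    partial fraction expansion. *)
Lemma zeta_Z_value : (2 ^ k - 1) * zeta_Z k = c * Rk (- (1)).
Proof.
assert (H2 : (2 : C) <> 0) by (intros E; apply RtoC_inj in E; lra).
assert (HZ := zeta_Z_correct).
assert (Hhalf := Hlip (RtoC (1 / 2)) ltac:(simpl; lra)). rewrite nome_half in Hhalf.
assert (Hm1 : - (1) <> RtoC 1). { intros E. rewrite <- RtoC_opp in E. apply RtoC_inj in E. lra. }
specialize (Hhalf Hm1).
assert (He : has_sum (fun n : Z => if Z.even n then (/ IZR n) ^ k else RtoC 0) ((/ 2) ^ k * zeta_Z k)).
{ apply (has_sum_inj (fun n => 2 * n)%Z); [intros; lia|..].
  - intros i Hi. destruct (Z.even i) eqn:E; [|reflexivity]. exfalso. apply Z.even_spec in E. destruct E as [n E]. now apply (Hi n).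
  - eapply has_sum_ext; [|exact (has_sum_scal ((/ 2) ^ k) _ _ HZ)]. intros n. cbv beta. rewrite Z.even_mul. simpl orb.
    cbv iota. rewrite <- Cpow_mult_l. f_equal. rewrite mult_IZR, RtoC_mult.
    destruct (Z.eq_dec n 0) as [->|Hn]; [rewrite Cmult_0_r, Cinv_0; ring|].
    assert (HN : RtoC (IZR n) <> 0). { intros E. apply RtoC_inj in E. now apply (eq_IZR n 0) in E. }
    field. auto. }
assert (Ho : has_sum (fun n : Z => if Z.even n then RtoC 0 else (/ IZR n) ^ k) ((/ 2) ^ k * (c * Rk (- (1))))).
{ apply (has_sum_inj (fun n => 2 * n + 1)%Z); [intros; lia|..].
  - intros i Hi. destruct (Z.even i) eqn:E; [reflexivity|]. exfalso. rewrite <- Z.negb_odd in E. apply Bool.negb_false_iff, Z.odd_spec in E. destruct E as [n E]. now apply (Hi n).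
  - eapply has_sum_ext; [|exact (has_sum_scal ((/ 2) ^ k) _ _ Hhalf)]. intros n. cbv beta.
    replace (Z.even (2 * n + 1)) with false by (rewrite Z.even_add, Z.even_mul; reflexivity).
    rewrite <- Cpow_mult_l. f_equal. rewrite plus_IZR, mult_IZR, RtoC_plus, RtoC_mult, RtoC_div by lra.
    assert (HN : 2 * IZR n + 1 <> 0). { rewrite <- RtoC_mult, <- RtoC_plus, <- mult_IZR, <- plus_IZR. intros E. apply RtoC_inj, (eq_IZR _ 0) in E. lia. }
    assert (HN' : 1 / 2 + IZR n <> 0).
    { intros E. apply HN. replace (2 * IZR n + 1) with (2 * (1 / 2 + IZR n)) by field. rewrite E. ring. }
    replace (2 * IZR n + 1) with (2 * (1 / 2 + IZR n)) by field.
    set (t := 1 / 2 + IZR n) in *. clearbody t. field. auto. }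
assert (Hsum := has_sum_plus _ _ _ _ He Ho).
assert (E : zeta_Z k = (/ 2) ^ k * zeta_Z k + (/ 2) ^ k * (c * Rk (- (1)))).
{ apply (has_sum_unique _ _ _ HZ). eapply has_sum_ext; [|exact Hsum]. intros n. cbv beta. destruct (Z.even n); ring. }
assert (H2k : (2 : C) ^ k <> 0) by now apply Cpow_nz.
rewrite Cpow_inv in E by exact H2.
transitivity (2 ^ k * zeta_Z k - zeta_Z k); [ring|]. rewrite E at 1. field. exact H2k.
Qed.

(** The row m = 0 is the zeta value; the rows m and - m agree because k is even, and each is given
    by Lipschitz's formula at m tau. Summing the rows m > 0 gives a Lambert series. *)
Lemma lattice_fourier (tau : C) : upper tau ->
  lattice_sum k tau = zeta_Z k + 2 * c * lam (k - 1) 0 tau.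
Proof.
intros Ht. assert (Hk : (4 <= k)%nat) by (unfold k; lia).
assert (H := Csum_correct _ (lattice_summable k tau Hk Ht)). fold (lattice_sum k tau) in H.
assert (Hup : forall m : nat, upper (INR (S m) * tau)).
{ intros m. unfold upper in *. rewrite im_scal_l. apply Rmult_lt_0_compat; [apply lt_0_INR; lia|exact Ht]. }
assert (Hpos : forall m : nat, has_sum (fun n : Z => lattice_term k tau (Z.of_nat (S m), n)) (c * Rk (nome tau ^ S m))).
{ intros m. rewrite <- nome_nat. unfold lattice_term. cbn [fst snd]. rewrite <- INR_IZR_INZ. apply Hlip.
  - left. apply Hup.
  - intros E. assert (L := nome_lt_1 _ (Hup m)). rewrite E, Cmod_1 in L. lra. }
assert (Hneg : forall m : nat, has_sum (fun n : Z => lattice_term k tau ((- Z.of_nat (S m))%Z, n)) (c * Rk (nome tau ^ S m))).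
{ intros m. apply (has_sum_inj Z.opp).
  - intros; lia.
  - intros i Hi. exfalso. apply (Hi (- i)%Z). lia.
  - eapply has_sum_ext; [|exact (Hpos m)]. intros n. unfold lattice_term, k. cbn [fst snd].
    rewrite <- Cpow_even_opp. f_equal. rewrite !opp_IZR, !RtoC_opp.
    replace (- IZR (Z.of_nat (S m)) * tau + - IZR n) with (- (IZR (Z.of_nat (S m)) * tau + IZR n)) by ring.
    assert (HN : IZR (Z.of_nat (S m)) * tau + IZR n <> 0) by (apply mobius_den_nz; [exact Ht|lia]).
    set (X := IZR (Z.of_nat (S m)) * tau + IZR n) in *. clearbody X. field. exact HN. }
assert (Hlam : has_sum (fun m : nat => c * Rk (nome tau ^ S m)) (c * lam (k - 1) 0 tau)).
{ apply has_sum_scal. assert (HL := lam_correct (k - 1) 0 tau Ht).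
  (* The first index of [lam] carries the power; the swap makes the lattice row m the outer index
     for Fubini. *)
  assert (HL' : has_sum (fun p : nat * nat => RtoC (lamw (k - 1) 0 (snd p, fst p)) * nome tau ^ lamn (snd p, fst p)) (lam (k - 1) 0 tau)).
  { apply (has_sum_inj (fun p : nat * nat => (snd p, fst p))) in HL; [exact HL|..].
    - intros [a b] [a' b'] E. simpl in E. inversion E. reflexivity.
    - intros [a b] Hi. exfalso. now apply (Hi (b, a)). }
  apply (has_sum_fubini _ _ _ HL'). intros m.
  assert (HQ : (Cmod (nome tau ^ S m) < 1)%R).
  { rewrite <- nome_nat. apply nome_lt_1, Hup. }
  eapply has_sum_ext; [|exact (Hser _ HQ)]. intros d. unfold lamw, lamn. cbn [fst snd].
  rewrite pow_O, Rmult_1_r, RtoC_pow, <- Cpow_mult_r. f_equal. f_equal. lia. }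
set (g := fun m : Z => if (m =? 0)%Z then zeta_Z k else c * Rk (nome tau ^ Z.to_nat (Z.abs m))).
assert (Hg : has_sum g (lattice_sum k tau)).
{ apply (has_sum_fubini _ _ _ H). intros m. unfold g. destruct (Z.eqb_spec m 0) as [->|Hm].
  - eapply has_sum_ext; [|exact zeta_Z_correct]. intros n. unfold lattice_term. cbn [fst snd]. f_equal. f_equal. ring.
  - destruct (Z_le_gt_dec m 0).
    + specialize (Hneg (Z.to_nat (- m - 1))). replace (- Z.of_nat (S (Z.to_nat (- m - 1))))%Z with m in Hneg by lia.
      replace (Z.to_nat (Z.abs m)) with (S (Z.to_nat (- m - 1))) by lia. exact Hneg.
    + specialize (Hpos (Z.to_nat (m - 1))). replace (Z.of_nat (S (Z.to_nat (m - 1))))%Z with m in Hpos by lia.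
      replace (Z.to_nat (Z.abs m)) with (S (Z.to_nat (m - 1))) by lia. exact Hpos. }
apply (has_sum_unique g _ _ Hg).
replace (zeta_Z k + 2 * c * lam (k - 1) 0 tau) with (g 0%Z + c * lam (k - 1) 0 tau + c * lam (k - 1) 0 tau) by (unfold g; simpl; ring).
apply has_sum_Z_split; (eapply has_sum_ext; [|exact Hlam]); intros m; unfold g.
- destruct (Z.eqb_spec (Z.of_nat (S m)) 0); [lia|]. do 3 f_equal. lia.
- destruct (Z.eqb_spec (- Z.of_nat (S m)) 0); [lia|]. do 3 f_equal. lia.
Qed.
End fourier.

(** * Closed forms of power series with coefficients (d+1)^p *)

Section powers.
Variable Q : C.
Hypothesis HQ : (Cmod Q < 1)%R.

Let T (p : nat) : C := Csum (fun d : nat => INR (S d) ^ p * Q ^ d).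

Lemma power_sum_correct (p : nat) : has_sum (fun d : nat => INR (S d) ^ p * Q ^ d) (T p).
Proof.
apply Csum_correct. apply (rsummable_le _ (fun n => INR (S n) ^ p * (Rmax (Cmod Q) (1 / 2)) ^ n)%R).
- intros n. split; [apply Cmod_ge_0|]. rewrite Cmod_mult, !Cmod_pow, Cmod_R, Rabs_pos_eq by apply pos_INR.
  apply Rmult_le_compat_l; [apply pow_le, pos_INR|]. apply pow_incr. split; [apply Cmod_ge_0|apply Rmax_l].
- apply rsummable_poly_geom. split; [eapply Rlt_le_trans; [|apply Rmax_r]; lra|apply Rmax_lub_lt; lra].
Qed.

(** Splitting off d = 0 shifts the index by one. Expanding (INR (S d) + 1)^p then expresses s
    through T p and the lower T, which gives a linear equation for T p. *)
Lemma power_sum_step (p : nat) (s : C) :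
  has_sum (fun d : nat => (INR (S d) + 1) ^ p * Q ^ d) s -> T p = 1 + Q * s.
Proof.
intros Hs. apply Csum_unique.
replace (1 + Q * s) with (INR 1 ^ p * Q ^ 0 + Q * s) by (change (INR 1) with 1%R; rewrite Cpow_1_l; simpl; ring).
apply (has_sum_S (fun d => INR (S d) ^ p * Q ^ d)).
eapply has_sum_ext; [|exact (has_sum_scal Q _ _ Hs)]. intros d. cbv beta.
rewrite (S_INR (S d)), RtoC_plus. simpl. ring.
Qed.

Lemma one_sub_nz : 1 - Q <> 0.
Proof.
intros E. assert (E' : Q = 1) by (replace Q with (1 - (1 - Q)) by ring; rewrite E; ring). rewrite E', Cmod_1 in HQ. lra.
Qed.

Lemma solve_fixpoint (t s : C) : t = 1 + Q * (t + s) -> t = (1 + Q * s) / (1 - Q).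
Proof.
intros E. assert (N := one_sub_nz).
assert (E2 : t * (1 - Q) = 1 + Q * s). { transitivity (t - Q * t); [ring|]. rewrite E at 1. ring. }
rewrite <- E2. field. exact N.
Qed.

Lemma power_sum_closed :
  T 3 = (1 + 4 * Q + Q ^ 2) / (1 - Q) ^ 4 /\
  T 5 = (1 + 26 * Q + 66 * Q ^ 2 + 26 * Q ^ 3 + Q ^ 4) / (1 - Q) ^ 6.
Proof.
assert (N := one_sub_nz).
assert (H := power_sum_correct).
assert (T0 : T 0 = 1 / (1 - Q)).
{ rewrite (solve_fixpoint (T 0) 0); [f_equal; ring|]. apply power_sum_step.
  replace (T 0 + 0) with (T 0) by ring. eapply has_sum_ext; [|exact (H 0%nat)]. intros d. simpl. ring. }
assert (T1 : T 1 = 1 / (1 - Q) ^ 2).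
{ rewrite (solve_fixpoint (T 1) (T 0)); [rewrite T0; field; exact N|]. apply power_sum_step.
  eapply has_sum_ext; [|exact (has_sum_plus _ _ _ _ (H 1%nat) (H 0%nat))]. intros d. cbv beta. ring. }
assert (T2 : T 2 = (1 + Q) / (1 - Q) ^ 3).
{ rewrite (solve_fixpoint (T 2) (2 * T 1 + T 0)); [rewrite T0, T1; field; exact N|]. apply power_sum_step.
  eapply has_sum_ext; [|exact (has_sum_plus _ _ _ _ (H 2%nat) (has_sum_plus _ _ _ _ (has_sum_scal 2 _ _ (H 1%nat)) (H 0%nat)))].
  intros d. cbv beta. ring. }
assert (T3 : T 3 = (1 + 4 * Q + Q ^ 2) / (1 - Q) ^ 4).
{ rewrite (solve_fixpoint (T 3) (3 * T 2 + (3 * T 1 + T 0))); [rewrite T0, T1, T2; field; exact N|]. apply power_sum_step.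
  eapply has_sum_ext; [|exact (has_sum_plus _ _ _ _ (H 3%nat) (has_sum_plus _ _ _ _ (has_sum_scal 3 _ _ (H 2%nat)) (has_sum_plus _ _ _ _ (has_sum_scal 3 _ _ (H 1%nat)) (H 0%nat))))].
  intros d. cbv beta. ring. }
assert (T4 : T 4 = (1 + 11 * Q + 11 * Q ^ 2 + Q ^ 3) / (1 - Q) ^ 5).
{ rewrite (solve_fixpoint (T 4) (4 * T 3 + (6 * T 2 + (4 * T 1 + T 0)))); [rewrite T0, T1, T2, T3; field; exact N|]. apply power_sum_step.
  eapply has_sum_ext; [|exact (has_sum_plus _ _ _ _ (H 4%nat) (has_sum_plus _ _ _ _ (has_sum_scal 4 _ _ (H 3%nat)) (has_sum_plus _ _ _ _ (has_sum_scal 6 _ _ (H 2%nat)) (has_sum_plus _ _ _ _ (has_sum_scal 4 _ _ (H 1%nat)) (H 0%nat)))))].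
  intros d. cbv beta. ring. }
split; [exact T3|].
rewrite (solve_fixpoint (T 5) (5 * T 4 + (10 * T 3 + (10 * T 2 + (5 * T 1 + T 0))))); [rewrite T0, T1, T2, T3, T4; field; exact N|]. apply power_sum_step.
eapply has_sum_ext; [|exact (has_sum_plus _ _ _ _ (H 5%nat) (has_sum_plus _ _ _ _ (has_sum_scal 5 _ _ (H 4%nat)) (has_sum_plus _ _ _ _ (has_sum_scal 10 _ _ (H 3%nat)) (has_sum_plus _ _ _ _ (has_sum_scal 10 _ _ (H 2%nat)) (has_sum_plus _ _ _ _ (has_sum_scal 5 _ _ (H 1%nat)) (H 0%nat))))))].
intros d. cbv beta. ring.
Qed.
End powers.

(** Numerators of sum d^3 u^d and sum d^5 u^d over (1 - u)^4 and (1 - u)^6, that is, u times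
    Eulerian polynomials. Products in place of powers let [cderive] differentiate them. *)
Definition eulerian3 (u : C) : C := u + 4 * (u * u) + u * u * u.
Definition eulerian5 (u : C) : C := u + 26 * (u * u) + 66 * (u * u * u) + 26 * (u * u * u * u) + u * u * u * u * u.

Lemma Cmod_mul_le_1 (u v : C) : (Cmod u <= 1)%R -> (Cmod v <= 1)%R -> (Cmod (u * v) <= 1)%R.
Proof.
intros Hu Hv. rewrite Cmod_mult. assert (H1 := Cmod_ge_0 u). assert (H2 := Cmod_ge_0 v). nra.
Qed.

Lemma Cmod_scal_le_1 (r : R) (u : C) : (0 <= r)%R -> (Cmod u <= 1)%R -> (Cmod (r * u) <= r)%R.
Proof.
intros Hr Hu. rewrite Cmod_mult, Cmod_R, Rabs_pos_eq by exact Hr. nra.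
Qed.

Lemma one_add_sub_nz (u : C) : u <> 1 -> u <> - (1) -> 1 - u <> 0 /\ 1 + u <> 0 /\ 1 - u * u <> 0.
Proof.
intros H1 H2.
assert (A : 1 - u <> 0). { intros E. apply H1. replace u with (1 - (1 - u)) by ring. rewrite E. ring. }
assert (B : 1 + u <> 0). { intros E. apply H2. replace u with (1 + u - 1) by ring. rewrite E. ring. }
split; [exact A|]. split; [exact B|]. replace (1 - u * u) with ((1 - u) * (1 + u)) by ring. now apply Cmult_neq_0.
Qed.

Lemma lipschitz4 (z : C) : (0 <= Im z)%R -> nome z <> 1 ->
  has_sum (fun n : Z => (/ (z + IZR n)) ^ (2 * 2)) ((2 * PI * Ci) ^ (2 * 2) * / 6 * (eulerian3 (nome z) * (/ (1 - nome z)) ^ (2 * 2))).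
Proof.
(* The coefficients are non-negative, so 6 = 3! is both the value at 1 and a bound on the unit
   disc. *)
apply (lipschitz 2 eulerian3 6 6); [lia|..].
- intros u Hu. unfold eulerian3.
  assert (H2 := Cmod_mul_le_1 u u Hu Hu). assert (H3 := Cmod_mul_le_1 _ u H2 Hu).
  assert (S2 := Cmod_scal_le_1 4 _ ltac:(lra) H2).
  assert (A1 := Cmod_triangle (u + 4 * (u * u)) (u * u * u)). assert (A2 := Cmod_triangle u (4 * (u * u))). lra.
- intros u. eexists. unfold eulerian3. cderive.
- unfold eulerian3. ring.
- intros E. apply RtoC_inj in E. lra.
- intros u H1 H2. destruct (one_add_sub_nz u H1 H2) as (A & B & D). unfold eulerian3.
  replace (1 - - u) with (1 + u) by ring. simpl. field. repeat split; assumption.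
Qed.

Lemma lipschitz6 (z : C) : (0 <= Im z)%R -> nome z <> 1 ->
  has_sum (fun n : Z => (/ (z + IZR n)) ^ (2 * 3)) ((2 * PI * Ci) ^ (2 * 3) * / 120 * (eulerian5 (nome z) * (/ (1 - nome z)) ^ (2 * 3))).
Proof.
apply (lipschitz 3 eulerian5 120 120); [lia|..].
- intros u Hu. unfold eulerian5.
  assert (H2 := Cmod_mul_le_1 u u Hu Hu). assert (H3 := Cmod_mul_le_1 _ u H2 Hu).
  assert (H4 := Cmod_mul_le_1 _ u H3 Hu). assert (H5 := Cmod_mul_le_1 _ u H4 Hu).
  assert (S2 := Cmod_scal_le_1 26 _ ltac:(lra) H2). assert (S3 := Cmod_scal_le_1 66 _ ltac:(lra) H3).
  assert (S4 := Cmod_scal_le_1 26 _ ltac:(lra) H4).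
  assert (A1 := Cmod_triangle (u + 26 * (u * u) + 66 * (u * u * u) + 26 * (u * u * u * u)) (u * u * u * u * u)).
  assert (A2 := Cmod_triangle (u + 26 * (u * u) + 66 * (u * u * u)) (26 * (u * u * u * u))).
  assert (A3 := Cmod_triangle (u + 26 * (u * u)) (66 * (u * u * u))).
  assert (A4 := Cmod_triangle u (26 * (u * u))). lra.
- intros u. eexists. unfold eulerian5. cderive.
- unfold eulerian5. ring.
- intros E. apply RtoC_inj in E. lra.
- intros u H1 H2. destruct (one_add_sub_nz u H1 H2) as (A & B & D). unfold eulerian5.
  replace (1 - - u) with (1 + u) by ring. simpl. field. repeat split; assumption.
Qed.

Lemma series4 (Q : C) : (Cmod Q < 1)%R ->
  has_sum (fun n : nat => INR (S n) ^ (2 * 2 - 1) * Q ^ S n) (eulerian3 Q * (/ (1 - Q)) ^ (2 * 2)).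
Proof.
intros HQ. assert (N := one_sub_nz Q HQ).
assert (H := has_sum_scal Q _ _ (power_sum_correct Q HQ 3)). rewrite (proj1 (power_sum_closed Q HQ)) in H.
replace (eulerian3 Q * (/ (1 - Q)) ^ (2 * 2)) with (Q * ((1 + 4 * Q + Q ^ 2) / (1 - Q) ^ 4)) by (unfold eulerian3; simpl; field; exact N).
eapply has_sum_ext; [|exact H]. intros n. simpl. ring.
Qed.

Lemma series6 (Q : C) : (Cmod Q < 1)%R ->
  has_sum (fun n : nat => INR (S n) ^ (2 * 3 - 1) * Q ^ S n) (eulerian5 Q * (/ (1 - Q)) ^ (2 * 3)).
Proof.
intros HQ. assert (N := one_sub_nz Q HQ).
assert (H := has_sum_scal Q _ _ (power_sum_correct Q HQ 5)). rewrite (proj2 (power_sum_closed Q HQ)) in H.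
replace (eulerian5 Q * (/ (1 - Q)) ^ (2 * 3)) with (Q * ((1 + 26 * Q + 66 * Q ^ 2 + 26 * Q ^ 3 + Q ^ 4) / (1 - Q) ^ 6)) by (unfold eulerian5; simpl; field; exact N).
eapply has_sum_ext; [|exact H]. intros n. simpl. ring.
Qed.

Lemma lattice_E4 (tau : C) : upper tau -> lattice_sum 4 tau = (2 * PI * Ci) ^ 4 / 720 * E4 tau.
Proof.
intros Ht. assert (F := lattice_fourier 2 eulerian3 _ ltac:(lia) lipschitz4 series4 tau Ht).
assert (V := zeta_Z_value 2 eulerian3 _ ltac:(lia) lipschitz4). simpl Nat.mul in F, V. simpl Nat.sub in F.
rewrite F. unfold E4. rewrite lambert_lam by exact Ht.
set (w := (2 * PI * Ci) ^ 4) in *. clearbody w.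
(* eulerian3 (-1) = 2, so 15 [zeta_Z 4] = (w / 6) 2 / 2^4. Then 2 c = w / 3 is 240 times this zeta
   value, the coefficient in E4. *)
assert (E : zeta_Z 4 = w / 720).
{ transitivity (1 / 15 * ((2 ^ 4 - 1) * zeta_Z 4)); [field|]. rewrite V. unfold eulerian3. simpl.
  replace (1 - - (1)) with (RtoC 2) by ring. field. }
rewrite E. field.
Qed.

Lemma lattice_E6 (tau : C) : upper tau -> lattice_sum 6 tau = - (2 * PI * Ci) ^ 6 / 30240 * E6 tau.
Proof.
intros Ht. assert (F := lattice_fourier 3 eulerian5 _ ltac:(lia) lipschitz6 series6 tau Ht).
assert (V := zeta_Z_value 3 eulerian5 _ ltac:(lia) lipschitz6). simpl Nat.mul in F, V. simpl Nat.sub in F.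
rewrite F. unfold E6. rewrite lambert_lam by exact Ht.
set (w := (2 * PI * Ci) ^ 6) in *. clearbody w.
assert (E : zeta_Z 6 = - w / 30240).
{ transitivity (1 / 63 * ((2 ^ 6 - 1) * zeta_Z 6)); [field|]. rewrite V. unfold eulerian5. simpl.
  replace (1 - - (1)) with (RtoC 2) by ring. field. }
rewrite E. field.
Qed.

(** For Im tau >= 1 all terms are dominated by those at |q| = e^(-2 pi). *)
Lemma lam_bounded (p : nat) : exists M, forall tau, (1 <= Im tau)%R -> (Cmod (lam p 0 tau) <= M)%R.
Proof.
set (rho := exp (- (2 * PI))). assert (HP := PI_RGT_0).
assert (Hrho : (0 < rho < 1)%R). { split; [apply exp_pos|]. unfold rho. rewrite <- exp_0. apply exp_increasing. lra. }
destruct (lam_summable p 0 rho Hrho) as [_ [M HM]]. exists M. intros tau Ht.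
assert (Hup : upper tau) by (unfold upper; lra).
apply (has_sum_bound _ _ M) with (2 := lam_correct p 0 tau Hup).
intros L HL. eapply Rle_trans; [|exact (HM L HL)]. apply rsum_le. intros i _.
rewrite Cmod_mult, Cmod_R, Rabs_pos_eq, Cmod_pow by apply lamw_pos. apply Rmult_le_compat_l; [apply lamw_pos|].
apply pow_incr. split; [apply Cmod_ge_0|]. rewrite Cmod_nome. unfold rho.
destruct (Req_dec (Im tau) 1) as [->|N]; [right; f_equal; ring|]. left. apply exp_increasing. nra.
Qed.

Lemma E4_modular : modular_form 4 E4.
Proof.
assert (HN := two_pi_i_nz). assert (HN4 := Cpow_nz _ 4 HN).
split; [|split].
- intros tau Ht. eexists. exact (E4_derive tau Ht).
- intros a b c d Hdet tau Ht.
  assert (H := lattice_modular 4 a b c d tau ltac:(lia) Hdet Ht).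
  rewrite !lattice_E4 in H by (try apply upper_mobius; assumption).
  set (w := (2 * PI * Ci) ^ 4) in *. clearbody w.
  match goal with |- ?x = ?y => transitivity (720 / w * (w / 720 * x)); [field; exact HN4|rewrite H; field; exact HN4] end.
- destruct (lam_bounded 3) as [M HM]. exists 1%R, (1 + 240 * M)%R. intros tau Ht HB. unfold E4. rewrite lambert_lam by exact Ht.
  eapply Rle_trans; [apply Cmod_triangle|]. rewrite Cmod_1, Cmod_mult, Cmod_R, Rabs_pos_eq by lra. specialize (HM tau HB). lra.
Qed.

Lemma E6_modular : modular_form 6 E6.
Proof.
assert (HN := two_pi_i_nz). assert (HN6 := Cpow_nz _ 6 HN).
split; [|split].
- intros tau Ht. eexists. exact (E6_derive tau Ht).
- intros a b c d Hdet tau Ht.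
  assert (H := lattice_modular 6 a b c d tau ltac:(lia) Hdet Ht).
  rewrite !lattice_E6 in H by (try apply upper_mobius; assumption).
  set (w := (2 * PI * Ci) ^ 6) in *. clearbody w.
  match goal with |- ?x = ?y => transitivity (- 30240 / w * (- w / 30240 * x)); [field; exact HN6|rewrite H; field; exact HN6] end.
- destruct (lam_bounded 5) as [M HM]. exists 1%R, (1 + 504 * M)%R. intros tau Ht HB. unfold E6. rewrite lambert_lam by exact Ht.
  unfold Cminus. eapply Rle_trans; [apply Cmod_triangle|]. rewrite Cmod_1, Cmod_opp, Cmod_mult, Cmod_R, Rabs_pos_eq by lra. specialize (HM tau HB). lra.
Qed.

(** * Generalised binomial coefficients and finite sums *)

Definition csum (f : nat -> C) (n : nat) : C := lsum f (seq 0 (S n)).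

Lemma sum_n_csum (f : nat -> C) (n : nat) : sum_n f n = csum f n.
Proof.
unfold csum. induction n.
- rewrite sum_O. simpl. ring.
- rewrite sum_Sn, IHn, (seq_S (S n)), lsum_app. change plus with Cplus. simpl. ring.
Qed.

Lemma csum_S (f : nat -> C) (n : nat) : csum f (S n) = csum f n + f (S n).
Proof. unfold csum. rewrite (seq_S (S n)), lsum_app. simpl. ring. Qed.

Lemma csum_0 (f : nat -> C) : csum f 0 = f 0%nat.
Proof. unfold csum. simpl. ring. Qed.

Lemma csum_ext (f g : nat -> C) (n : nat) : (forall i, (i <= n)%nat -> f i = g i) -> csum f n = csum g n.
Proof. intros H. apply lsum_ext. intros i Hi. apply in_seq in Hi. apply H. lia. Qed.

Lemma csum_plus (f g : nat -> C) (n : nat) : csum (fun i => f i + g i) n = csum f n + csum g n.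
Proof. apply lsum_plus. Qed.

Lemma csum_scal (c : C) (f : nat -> C) (n : nat) : csum (fun i => c * f i) n = c * csum f n.
Proof. apply lsum_scal. Qed.

Lemma csum_shift (h : nat -> C) (n : nat) :
  csum (fun r => match r with O => RtoC 0 | S r' => h r' end) (S n) = csum h n.
Proof.
unfold csum. change (seq 0 (S (S n))) with (0%nat :: seq 1 (S n)). rewrite <- seq_shift. cbn [lsum fold_right].
fold (lsum (fun r => match r with O => RtoC 0 | S r' => h r' end) (map S (seq 0 (S n)))). rewrite lsum_map. apply Cplus_0_l.
Qed.

Lemma csum_indicator (g : nat -> C) (p n : nat) : (p <= n)%nat ->
  csum (fun r => if (r <=? p)%nat then g r else RtoC 0) n = csum g p.
Proof.
intros H. induction n.
- replace p with 0%nat by lia. rewrite !csum_0. reflexivity.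
- destruct (Nat.eq_dec p (S n)) as [->|Hne].
  + apply csum_ext. intros i Hi. destruct (Nat.leb_spec i (S n)); [reflexivity|lia].
  + rewrite csum_S, IHn by lia. destruct (Nat.leb_spec (S n) p); [lia|]. ring.
Qed.

(** Both sides run over the triangle m + r <= n; padding with zeros to a square allows the
    interchange. *)
Lemma csum_triangle (h : nat -> nat -> C) (n : nat) :
  csum (fun m => csum (fun r => h m r) (n - m)) n = csum (fun r => csum (fun m => h m r) (n - r)) n.
Proof.
assert (Hswap : forall (g : nat -> nat -> C) a b, csum (fun m => csum (fun r => g m r) b) a = csum (fun r => csum (fun m => g m r) a) b).
{ intros g a b. induction a.
  - rewrite csum_0. apply csum_ext. intros. now rewrite csum_0.
  - rewrite csum_S, IHa, <- csum_plus. apply csum_ext. intros. now rewrite csum_S. }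
rewrite (csum_ext _ (fun m => csum (fun r => if (r <=? n - m)%nat then h m r else RtoC 0) n)).
2:{ intros m Hm. rewrite (csum_indicator (h m)) by lia. reflexivity. }
rewrite Hswap. apply csum_ext. intros r Hr.
rewrite <- (csum_indicator (fun m => h m r) (n - r) n) by lia. apply csum_ext. intros m Hm.
destruct (Nat.leb_spec r (n - m)), (Nat.leb_spec m (n - r)); try lia; reflexivity.
Qed.

Section binomial_facts.
Local Open Scope R_scope.

Lemma INR_S_nz (m : nat) : INR (S m) <> 0.
Proof. apply not_0_INR. lia. Qed.

Lemma binom_S_top (x : R) (m : nat) : binom (x + 1) (S m) = (x + 1) / INR (S m) * binom x m.
Proof.
induction m as [|m IH].
- simpl. field.
- change (binom (x + 1) (S (S m))) with (binom (x + 1) (S m) * (x + 1 - INR (S m)) / INR (S (S m))).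
  rewrite IH. change (binom x (S m)) with (binom x m * (x - INR m) / INR (S m)).
  assert (H1 := INR_S_nz m). assert (H2 := INR_S_nz (S m)). rewrite (S_INR m) in *. field. split; assumption.
Qed.

Lemma binom_S_top' (x : R) (m : nat) : INR (S m) * binom x (S m) = x * binom (x - 1) m.
Proof.
replace x with (x - 1 + 1) at 1 by ring. rewrite binom_S_top. assert (H := INR_S_nz m). field. exact H.
Qed.

Lemma binom_S_bot (x : R) (m : nat) : INR (S m) * binom x (S m) = binom x m * (x - INR m).
Proof. change (binom x (S m)) with (binom x m * (x - INR m) / INR (S m)). assert (H := INR_S_nz m). field. exact H. Qed.

Lemma binom_pascal (x : R) (m : nat) : binom (x + 1) (S m) = binom x (S m) + binom x m.
Proof.
rewrite binom_S_top. change (binom x (S m)) with (binom x m * (x - INR m) / INR (S m)).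
assert (H := INR_S_nz m). rewrite S_INR in *. field. exact H.
Qed.

Lemma binom_absorb (x : R) (m : nat) : binom x m * (x - INR m) = x * binom (x - 1) m.
Proof. now rewrite <- binom_S_bot, binom_S_top'. Qed.

Lemma binom_gt (n r : nat) : (n < r)%nat -> binom (INR n) r = 0.
Proof.
induction 1 as [|r H IH].
- change (binom (INR n) (S n)) with (binom (INR n) n * (INR n - INR n) / INR (S n)). assert (H := INR_S_nz n). field. exact H.
- change (binom (INR n) (S r)) with (binom (INR n) r * (INR n - INR r) / INR (S r)). rewrite IH. assert (H1 := INR_S_nz r). field. exact H1.
Qed.

Lemma binom_fact (r s : nat) : binom (INR (r + s)) r * INR (fact r) * INR (fact s) = INR (fact (r + s)).
Proof.
induction r as [|r IH].
- simpl. ring.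
- replace (INR (S r + s)) with (INR (r + s) + 1) by (rewrite <- S_INR; f_equal).
  rewrite binom_S_top. change (S r + s)%nat with (S (r + s)). rewrite (fact_simpl r), (fact_simpl (r + s)), !mult_INR, <- IH, (S_INR (r + s)).
  assert (H := INR_S_nz r). field. exact H.
Qed.

Lemma binom_sym (r s : nat) : binom (INR (r + s)) r = binom (INR (r + s)) s.
Proof.
assert (H1 := binom_fact r s). assert (H2 := binom_fact s r). rewrite (Nat.add_comm s r) in H2.
assert (N1 := INR_fact_neq_0 r). assert (N2 := INR_fact_neq_0 s).
apply (Rmult_eq_reg_r (INR (fact r) * INR (fact s))); [|now apply Rmult_integral_contrapositive]. lra.
Qed.

Lemma pochhammer_S (x : R) (m : nat) : pochhammer x (S m) = x * pochhammer (x + 1) m.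
Proof.
induction m as [|m IH].
- simpl. ring.
- change (pochhammer x (S (S m))) with (pochhammer x (S m) * (x + INR (S m))). rewrite IH.
  change (pochhammer (x + 1) (S m)) with (pochhammer (x + 1) m * (x + 1 + INR m)). rewrite S_INR. ring.
Qed.

Lemma binom_pochhammer (x : R) (s : nat) : binom (x + INR s - 1) s * INR (fact s) = pochhammer x s.
Proof.
revert x. induction s as [|s IH]; intros x.
- simpl. ring.
- replace (x + INR (S s) - 1) with (x + INR s - 1 + 1) by (rewrite S_INR; ring). rewrite binom_S_top, fact_simpl, mult_INR.
  change (pochhammer x (S s)) with (pochhammer x s * (x + INR s)). rewrite <- IH. assert (H := INR_S_nz s). field. exact H.
Qed.

(** In falling factorials this reads x^(m+s) = x^(m) (x-m)^(s), so it holds for every real x. *)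
Lemma binom_trinomial_revision (x : R) (m s : nat) :
  binom x (m + s) * INR (fact (m + s)) = binom x m * INR (fact m) * (binom (x - INR m) s * INR (fact s)).
Proof.
induction s as [|s IH].
- rewrite Nat.add_0_r. simpl. ring.
- rewrite Nat.add_succ_r, !fact_simpl, !mult_INR.
  change (binom x (S (m + s))) with (binom x (m + s) * (x - INR (m + s)) / INR (S (m + s))).
  change (binom (x - INR m) (S s)) with (binom (x - INR m) s * (x - INR m - INR s) / INR (S s)).
  assert (H1 := INR_S_nz s). assert (H2 := INR_S_nz (m + s)).
  transitivity (binom x (m + s) * INR (fact (m + s)) * (x - INR (m + s))); [field; exact H2|].
  rewrite IH, plus_INR. field. exact H1.
Qed.

Definition serre_coef (k : R) (n r : nat) : R := binom (INR n) r * pochhammer (k + INR r) (n - r).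

(** D x = - x^2 + E4/144 produces a term (n - r) x^(n-r-1) E4/144 at order n; this identity matches
    it with the E4 term subtracted in the canonical recursion. *)
Lemma serre_coef_lower (k : R) (n r : nat) : (r <= S n)%nat ->
  serre_coef k (S n) r * INR (S n - r) = INR (S n) * (INR (S n) + k - 1) * serre_coef k n r.
Proof.
intros Hr. unfold serre_coef. rewrite minus_INR by exact Hr.
destruct (Nat.eq_dec r (S n)) as [->|Hne].
- rewrite (binom_gt n (S n)) by lia. ring.
- replace (S n - r)%nat with (S (n - r)) by lia. cbn [pochhammer]. rewrite minus_INR by lia.
  transitivity ((binom (INR (S n)) r * (INR (S n) - INR r)) * (pochhammer (k + INR r) (n - r) * (k + INR n))); [ring|].
  rewrite binom_absorb. replace (INR (S n) - 1) with (INR n) by (rewrite S_INR; ring). rewrite S_INR. ring.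
Qed.

Lemma serre_coef_0 (k : R) (n : nat) : serre_coef k (S n) 0 = serre_coef k n 0 * (k + INR n).
Proof. unfold serre_coef. rewrite !Nat.sub_0_r. cbn [binom pochhammer INR]. ring. Qed.

(** Comparison of the coefficients of D^(r+1) f at orders n and n + 1. The factor k + n + (r+1) is
    (k + 2 n) - (n - (r+1)): the weight of the Serre derivative minus the exponent lost through -
    x^2 in D x. *)
Lemma serre_coef_S (k : R) (n r : nat) : (r <= n)%nat ->
  serre_coef k (S n) (S r) = serre_coef k n (S r) * (k + INR n + INR (S r)) + serre_coef k n r.
Proof.
intros Hr. unfold serre_coef. replace (S n - S r)%nat with (n - r)%nat by lia.
rewrite (S_INR n), binom_pascal.
destruct (Nat.eq_dec r n) as [->|Hne].
- rewrite (binom_gt n (S n)), !Nat.sub_diag by lia. simpl. ring.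
- replace (n - r)%nat with (S (n - S r)) by lia.
  rewrite (pochhammer_S (k + INR r)). cbn [pochhammer].
  replace (k + INR r + 1) with (k + INR (S r)) by (rewrite S_INR; ring).
  assert (H := binom_S_bot (INR n) r). rewrite minus_INR by lia.
  set (p := pochhammer (k + INR (S r)) (n - S r)) in *.
  transitivity (binom (INR n) (S r) * p * (k + INR n) + binom (INR n) r * (INR n - INR r) * p + binom (INR n) r * ((k + INR r) * p)); [ring|].
  rewrite <- H. ring.
Qed.
End binomial_facts.

(** * Canonical Serre derivatives *)

(** Unlike the total function [D], this relation carries differentiability along with the value. *)
Definition is_D (g : C -> C) (tau l : C) : Prop := is_Cderive g tau (2 * PI * Ci * l).

Lemma is_D_unique (g : C -> C) (tau l : C) : is_D g tau l -> D g tau = l.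
Proof.
intros H. unfold D. rewrite (is_C_derive_unique _ _ _ H). field. split; [apply Ci_nz|].
intros E. apply RtoC_inj in E. assert (HP := PI_RGT_0). lra.
Qed.

Lemma is_D_correct (g : C -> C) (tau : C) : (exists l : C, is_Cderive g tau l) -> is_D g tau (D g tau).
Proof.
intros [l Hl]. unfold is_D. rewrite (is_D_unique g tau (l / (2 * PI * Ci))).
- eapply is_Cderive_eq; [exact Hl|]. assert (N := two_pi_i_nz). field. split; [apply Ci_nz|].
  intros E. apply RtoC_inj in E. assert (HP := PI_RGT_0). lra.
- unfold is_D. eapply is_Cderive_eq; [exact Hl|]. field. split; [apply Ci_nz|].
  intros E. apply RtoC_inj in E. assert (HP := PI_RGT_0). lra.
Qed.

Lemma is_D_ext (f g : C -> C) (tau l : C) : upper tau -> (forall w, upper w -> f w = g w) -> is_D f tau l -> is_D g tau l.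
Proof. apply is_Cderive_ext_upper. Qed.

Lemma is_D_eq (f : C -> C) (tau l m : C) : is_D f tau l -> l = m -> is_D f tau m.
Proof. now intros H <-. Qed.

Lemma is_D_const (c tau : C) : is_D (fun _ => c) tau 0.
Proof. eapply is_Cderive_eq; [apply is_Cderive_const|ring]. Qed.

Lemma is_D_plus (f g : C -> C) (tau l m : C) : is_D f tau l -> is_D g tau m -> is_D (fun w => f w + g w) tau (l + m).
Proof. intros H1 H2. eapply is_Cderive_eq; [exact (is_Cderive_plus _ _ _ _ _ H1 H2)|ring]. Qed.

Lemma is_D_mult (f g : C -> C) (tau l m : C) : is_D f tau l -> is_D g tau m ->
  is_D (fun w => f w * g w) tau (l * g tau + f tau * m).
Proof. intros H1 H2. eapply is_Cderive_eq; [exact (is_Cderive_mult _ _ _ _ _ H1 H2)|ring]. Qed.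

Lemma is_D_scal (c : C) (f : C -> C) (tau l : C) : is_D f tau l -> is_D (fun w => c * f w) tau (c * l).
Proof. intros H. eapply is_D_eq; [exact (is_D_mult _ _ _ _ _ (is_D_const c tau) H)|cbv beta; ring]. Qed.

Lemma is_D_pow (f : C -> C) (tau l : C) (n : nat) : is_D f tau l ->
  is_D (fun w => f w ^ n) tau (INR n * f tau ^ (n - 1) * l).
Proof.
intros H. induction n as [|n IH].
- eapply is_D_eq; [exact (is_D_const 1 tau)|simpl; ring].
- eapply is_D_eq; [exact (is_D_mult f (fun w => f w ^ n) tau _ _ H IH)|].
  rewrite S_INR, RtoC_plus. replace (S n - 1)%nat with n by lia. destruct n as [|n]; [simpl; ring|].
  replace (S n - 1)%nat with n by lia. change (f tau ^ S n) with (f tau * f tau ^ n). ring.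
Qed.

Lemma is_D_csum (f : nat -> C -> C) (d : nat -> C) (tau : C) (n : nat) :
  (forall i, (i <= n)%nat -> is_D (f i) tau (d i)) -> is_D (fun w => csum (fun i => f i w) n) tau (csum d n).
Proof.
intros H. induction n as [|n IH].
- rewrite csum_0. eapply is_derive_ext; [|exact (H 0%nat (le_n _))]. intros t. now rewrite csum_0.
- rewrite csum_S. eapply is_derive_ext; [|exact (is_D_plus _ _ _ _ _ (IH (fun i Hi => H i (le_S _ _ Hi))) (H (S n) (le_n _)))].
  intros t. simpl. now rewrite csum_S.
Qed.

Lemma E2_D (tau : C) : upper tau -> is_D E2 tau ((E2 tau ^ 2 - E4 tau) / 12).
Proof. exact (E2_derive tau). Qed.
Lemma E4_D (tau : C) : upper tau -> is_D E4 tau ((E2 tau * E4 tau - E6 tau) / 3).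
Proof. exact (E4_derive tau). Qed.
Lemma E6_D (tau : C) : upper tau -> is_D E6 tau ((E2 tau * E6 tau - E4 tau ^ 2) / 2).
Proof. exact (E6_derive tau). Qed.

Lemma Diter_holomorphic (f : C -> C) (n : nat) : holomorphic f -> holomorphic (Diter n f).
Proof. intros Hf. induction n; [exact Hf|]. exact (holomorphic_D _ IHn). Qed.

Lemma Diter_D (f : C -> C) (n : nat) (tau : C) : holomorphic f -> upper tau ->
  is_D (Diter n f) tau (Diter (S n) f tau).
Proof. intros Hf Ht. apply is_D_correct. exact (Diter_holomorphic f n Hf tau Ht). Qed.

Definition E2_scaled (tau : C) : C := - E2 tau / 12.

Lemma E2_scaled_D (tau : C) : upper tau -> is_D E2_scaled tau (- E2_scaled tau ^ 2 + E4 tau / 144).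
Proof.
intros Ht. apply (is_D_ext (fun w => - (1) / 12 * E2 w)); [exact Ht|intros; unfold E2_scaled; field|].
eapply is_D_eq; [exact (is_D_scal _ _ _ _ (E2_D tau Ht))|]. unfold E2_scaled. simpl. field.
Qed.

Definition serre_sum (k : R) (n : nat) (f : C -> C) (tau : C) : C :=
  csum (fun r => serre_coef k n r * E2_scaled tau ^ (n - r) * Diter r f tau) n.

Lemma serre_sum_D (k : R) (n : nat) (f : C -> C) (tau : C) : holomorphic f -> upper tau ->
  is_D (serre_sum k n f) tau (csum (fun r => serre_coef k n r *
    (INR (n - r) * E2_scaled tau ^ (n - r - 1) * (- E2_scaled tau ^ 2 + E4 tau / 144) * Diter r f tau + E2_scaled tau ^ (n - r) * Diter (S r) f tau)) n).
Proof.
intros Hf Ht. unfold serre_sum. apply (is_D_csum (fun r t => serre_coef k n r * E2_scaled t ^ (n - r) * Diter r f t)).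
intros r Hr. apply (is_D_ext (fun t => serre_coef k n r * (E2_scaled t ^ (n - r) * Diter r f t))); [exact Ht|intros; ring|].
apply is_D_scal. exact (is_D_mult _ _ _ _ _ (is_D_pow E2_scaled tau _ (n - r) (E2_scaled_D tau Ht)) (Diter_D f r tau Hf Ht)).
Qed.

Lemma pow_pred_sqr (x : C) (n : nat) : INR n * x ^ (n - 1) * x ^ 2 = INR n * x * x ^ n.
Proof.
destruct n as [|n]; [simpl; ring|]. replace (S n - 1)%nat with n by lia. simpl. ring.
Qed.

(** At n = 0 the truncated index n - 1 is harmless, because its factor n (n + k - 1) is zero; so the
    step also covers order 1. *)
Lemma serre_sum_step (k : R) (n : nat) (f : C -> C) (tau : C) : holomorphic f -> upper tau ->
  serre_sum k (S n) f tau = D (serre_sum k n f) tau - (k + 2 * INR n)%R / 12 * E2 tau * serre_sum k n f tau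
   - (INR n * (INR n + k - 1) / 144)%R * E4 tau * serre_sum k (n - 1) f tau.
Proof.
intros Hf Ht. rewrite (is_D_unique _ _ _ (serre_sum_D k n f tau Hf Ht)).
set (x := E2_scaled tau). set (a := fun r => Diter r f tau).
assert (EE2 : E2 tau = - (12) * x) by (unfold x, E2_scaled; field).
assert (Hlow : (INR n * (INR n + k - 1))%R * serre_sum k (n - 1) f tau =
   csum (fun r => (serre_coef k n r * INR (n - r))%R * x ^ (n - r - 1) * a r) n).
{ destruct n as [|n].
  - rewrite csum_0. simpl. rewrite !Rmult_0_l, Rmult_0_r. ring.
  - replace (S n - 1)%nat with n by lia. unfold serre_sum. rewrite <- csum_scal, csum_S.
    rewrite Nat.sub_diag, Rmult_0_r. rewrite !Cmult_0_l, Cplus_0_r.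
    apply csum_ext. intros r Hr. rewrite serre_coef_lower by lia. fold x. fold (a r).
    replace (S n - r - 1)%nat with (n - r)%nat by lia. rewrite !RtoC_mult. ring. }
(* The coefficient recursion splits order n + 1 into terms keeping D^r f with one more x, and terms
   with one more derivative; the latter are an index shift. *)
assert (Htop : serre_sum k (S n) f tau =
   csum (fun r => (serre_coef k n r * (k + INR n + INR r))%R * x ^ (S n - r) * a r) n
   + csum (fun r => serre_coef k n r * x ^ (n - r) * a (S r)) n).
{ transitivity (csum (fun r => (serre_coef k n r * (k + INR n + INR r))%R * x ^ (S n - r) * a r) (S n)
   + csum (fun r => match r with O => RtoC 0 | S r' => serre_coef k n r' * x ^ (n - r') * a (S r') end) (S n)).
  - rewrite <- csum_plus. unfold serre_sum. apply csum_ext. intros [|r] Hr.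
    + rewrite serre_coef_0. fold x. simpl INR. rewrite Rplus_0_r. unfold a. ring.
    + rewrite serre_coef_S by lia. fold x. fold (a (S r)). replace (S n - S r)%nat with (n - r)%nat by lia.
      rewrite RtoC_plus. ring.
  - rewrite csum_shift, csum_S. unfold serre_coef at 2. rewrite (binom_gt n (S n)) by lia. rewrite !Rmult_0_l. ring. }
rewrite Htop.
replace ((INR n * (INR n + k - 1) / 144)%R * E4 tau * serre_sum k (n - 1) f tau)
  with (E4 tau / 144 * ((INR n * (INR n + k - 1))%R * serre_sum k (n - 1) f tau)) by (rewrite (RtoC_div _ 144) by lra; field).
rewrite Hlow. unfold serre_sum. fold x. rewrite EE2.
rewrite <- csum_plus.
replace ((k + 2 * INR n)%R / 12 * (- (12) * x) * csum (fun r => serre_coef k n r * x ^ (n - r) * Diter r f tau) n)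
  with (csum (fun r => - ((k + 2 * INR n)%R * x) * (serre_coef k n r * x ^ (n - r) * Diter r f tau)) n) by (rewrite csum_scal; field).
assert (Hopp : forall g m, - csum g m = csum (fun i => - (1) * g i) m) by (intros; rewrite csum_scal; ring).
unfold Cminus. rewrite <- csum_scal, !Hopp, <- !csum_plus.
apply csum_ext. intros r Hr. fold (a r). fold (a (S r)).
assert (Hp := pow_pred_sqr x (n - r)).
assert (Hr' : (k + INR n + INR r = k + 2 * INR n - INR (n - r))%R) by (rewrite minus_INR by exact Hr; ring).
rewrite Hr'. replace (S n - r)%nat with (S (n - r)) by lia. change (x ^ S (n - r)) with (x * x ^ (n - r)).
rewrite !RtoC_mult, RtoC_minus.
transitivity (serre_coef k n r * (k + 2 * INR n)%R * x * x ^ (n - r) * a r - serre_coef k n r * a r * (INR (n - r) * x * x ^ (n - r)) + serre_coef k n r * x ^ (n - r) * a (S r)); [ring|].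
rewrite <- Hp. field.
Qed.

Lemma canonical_serre_sum (f : C -> C) (k : R) : holomorphic f ->
  forall n tau, upper tau -> canonical_serre k n f tau = serre_sum k n f tau.
Proof.
(* The recursion has two terms, so two consecutive orders are carried through the induction. *)
intros Hf n. cut ((forall tau, upper tau -> canonical_serre k n f tau = serre_sum k n f tau) /\
  (forall tau, upper tau -> canonical_serre k (S n) f tau = serre_sum k (S n) f tau)); [tauto|].
assert (H0 : forall tau, upper tau -> canonical_serre k 0 f tau = serre_sum k 0 f tau).
{ intros tau _. unfold serre_sum. rewrite csum_0. unfold serre_coef. simpl. rewrite Rmult_1_r. ring. }
assert (HD : forall m, (forall tau, upper tau -> canonical_serre k m f tau = serre_sum k m f tau) ->
  forall tau, upper tau -> D (canonical_serre k m f) tau = D (serre_sum k m f) tau).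
{ intros m Hm tau Ht. apply is_D_unique. apply (is_D_ext (serre_sum k m f)); [exact Ht|intros; symmetry; auto|].
  apply is_D_correct. eexists. exact (serre_sum_D k m f tau Hf Ht). }
induction n as [|n [IH1 IH2]].
- split; [exact H0|]. intros tau Ht. rewrite (serre_sum_step k 0 f tau Hf Ht). cbn [canonical_serre]. unfold serre.
  rewrite <- (HD 0%nat H0 tau Ht), <- (H0 tau Ht). cbn [canonical_serre INR Nat.sub].
  rewrite Rmult_0_r, Rplus_0_r, !Rmult_0_l. unfold Rdiv. rewrite Rmult_0_l.
  rewrite RtoC_mult, (RtoC_inv 12) by lra. unfold Cdiv. ring.
- split; [exact IH2|]. intros tau Ht. rewrite (serre_sum_step k (S n) f tau Hf Ht).
  rewrite <- (HD (S n) IH2 tau Ht), <- (IH2 tau Ht). replace (S n - 1)%nat with n by lia. rewrite <- (IH1 tau Ht).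
  change (canonical_serre k (S (S n)) f tau) with (serre (k + 2 * INR (S n)) (canonical_serre k (S n) f) tau
     - (INR (S n) * (INR (S n) + k - 1) / 144)%R * E4 tau * canonical_serre k n f tau).
  unfold serre. rewrite (RtoC_div (k + 2 * INR (S n))) by lra. reflexivity.
Qed.

(** * The modular forms omega_m and the Kaneko-Koike operator *)

(** Isobaric polynomials in E4 and E6, up to equality on the half-plane. Ramanujan's equations keep
    this class stable under the Serre derivative. [iso_zero] supplies zero in every weight, as for
    omega_1 in weight 2. *)
Inductive isobaric : nat -> (C -> C) -> Prop :=
| iso_const c : isobaric 0 (fun _ => c)
| iso_zero w : isobaric w (fun _ => RtoC 0)
| iso_E4 w w' g : w' = (4 + w)%nat -> isobaric w g -> isobaric w' (fun t => E4 t * g t)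
| iso_E6 w w' g : w' = (6 + w)%nat -> isobaric w g -> isobaric w' (fun t => E6 t * g t)
| iso_lin w g h a b : isobaric w g -> isobaric w h -> isobaric w (fun t => a * g t + b * h t)
| iso_ext w g h : (forall t, upper t -> g t = h t) -> isobaric w g -> isobaric w h.

Lemma modular_form_mult (v w : nat) (f g : C -> C) : modular_form v f -> modular_form w g ->
  modular_form (v + w) (fun t => f t * g t).
Proof.
intros (F1 & F2 & B1 & M1 & F3) (G1 & G2 & B2 & M2 & G3). split; [|split].
- intros t Ht. destruct (F1 t Ht) as [l Hl]. destruct (G1 t Ht) as [m Hm]. eexists. exact (is_Cderive_mult _ _ _ _ _ Hl Hm).
- intros a b c d Hd t Ht. rewrite F2, G2, Cpow_add_r by assumption. ring.
- exists (Rmax B1 B2), (M1 * M2)%R. intros t Ht HB. rewrite Cmod_mult. apply Rmult_le_compat; try apply Cmod_ge_0.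
  + apply F3; [exact Ht|]. eapply Rle_trans; [apply Rmax_l|exact HB].
  + apply G3; [exact Ht|]. eapply Rle_trans; [apply Rmax_r|exact HB].
Qed.

Lemma isobaric_modular (w : nat) (g : C -> C) : isobaric w g -> modular_form w g.
Proof.
induction 1 as [c|w|w w' g -> _ IH|w w' g -> _ IH|w g h a b _ IH1 _ IH2|w g h Hgh _ IH].
- split; [|split].
  + intros t _. eexists. apply is_Cderive_const.
  + intros. simpl. ring.
  + exists 0%R, (Cmod c). intros. apply Rle_refl.
- split; [|split].
  + intros t _. eexists. apply is_Cderive_const.
  + intros. ring.
  + exists 0%R, 0%R. intros. rewrite Cmod_0. apply Rle_refl.
- exact (modular_form_mult 4 w _ _ E4_modular IH).
- exact (modular_form_mult 6 w _ _ E6_modular IH).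
- destruct IH1 as (F1 & F2 & B1 & M1 & F3). destruct IH2 as (G1 & G2 & B2 & M2 & G3). split; [|split].
  + intros t Ht. destruct (F1 t Ht) as [l Hl]. destruct (G1 t Ht) as [m Hm]. eexists. cderive.
  + intros a' b' c d Hd t Ht. rewrite F2, G2 by assumption. ring.
  + exists (Rmax B1 B2), (Cmod a * M1 + Cmod b * M2)%R. intros t Ht HB.
    eapply Rle_trans; [apply Cmod_triangle|]. rewrite !Cmod_mult.
    apply Rplus_le_compat; apply Rmult_le_compat_l; try apply Cmod_ge_0.
    * apply F3; [exact Ht|]. eapply Rle_trans; [apply Rmax_l|exact HB].
    * apply G3; [exact Ht|]. eapply Rle_trans; [apply Rmax_r|exact HB].
- destruct IH as (F1 & F2 & B1 & M1 & F3). split; [|split].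
  + intros t Ht. destruct (F1 t Ht) as [l Hl]. exists l. exact (is_Cderive_ext_upper _ _ _ _ Ht Hgh Hl).
  + intros a b c d Hd t Ht. rewrite <- !Hgh by (try apply upper_mobius; assumption). now apply F2.
  + exists B1, M1. intros t Ht HB. rewrite <- Hgh by exact Ht. now apply F3.
Qed.

(** Here [h] is the Serre derivative of [g]. *)
Lemma isobaric_D (w : nat) (g : C -> C) : isobaric w g ->
  exists h, isobaric (2 + w) h /\ forall t, upper t -> is_D g t (INR w / 12 * E2 t * g t + h t).
Proof.
induction 1 as [c|w|w w' g -> Hg IH|w w' g -> Hg IH|w g h a b Hg IH1 Hh IH2|w g h Hgh Hg IH].
- exists (fun _ => RtoC 0). split; [apply iso_zero|]. intros t Ht. eapply is_D_eq; [apply is_D_const|]. simpl. field.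
- exists (fun _ => RtoC 0). split; [apply iso_zero|]. intros t Ht. eapply is_D_eq; [apply is_D_const|]. field.
- destruct IH as (h & Hh & Hd). exists (fun t => 1 * (E4 t * h t) + (- (1) / 3) * (E6 t * g t)). split.
  + apply iso_lin; [apply (iso_E4 (2 + w)); [lia|exact Hh]|apply (iso_E6 w); [lia|exact Hg]].
  + intros t Ht. eapply is_D_eq; [exact (is_D_mult _ _ _ _ _ (E4_D t Ht) (Hd t Ht))|].
    rewrite plus_INR, RtoC_plus. simpl INR. replace (1 + 1 + 1 + 1)%R with 4%R by ring. field.
- destruct IH as (h & Hh & Hd). exists (fun t => 1 * (E6 t * h t) + (- (1) / 2) * (E4 t * (E4 t * g t))). split.
  + apply iso_lin; [apply (iso_E6 (2 + w)); [lia|exact Hh]|apply (iso_E4 (4 + w)); [lia|]; apply (iso_E4 w); [lia|exact Hg]].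
  + intros t Ht. eapply is_D_eq; [exact (is_D_mult _ _ _ _ _ (E6_D t Ht) (Hd t Ht))|].
    rewrite plus_INR, RtoC_plus. simpl INR. replace (1 + 1 + 1 + 1 + 1 + 1)%R with 6%R by ring. field.
- destruct IH1 as (u & Hu & Hd). destruct IH2 as (v & Hv & He). exists (fun t => a * u t + b * v t).
  split; [now apply iso_lin|]. intros t Ht.
  eapply is_D_eq; [exact (is_D_plus _ _ _ _ _ (is_D_scal a _ _ _ (Hd t Ht)) (is_D_scal b _ _ _ (He t Ht)))|]. ring.
- destruct IH as (u & Hu & Hd). exists u. split; [exact Hu|]. intros t Ht.
  rewrite <- (Hgh t Ht). exact (is_D_ext _ _ _ _ Ht Hgh (Hd t Ht)).
Qed.

(** [omega_red m] is omega_m / (m!)^2.  Substituting the expansion of D omega_m in the generating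
    series of the coefficients of the Kaneko-Koike operator yields the recursion
    m (m+1) w_(m+1) = - theta_(2m) w_m - E4/144 w_(m-1). *)
Fixpoint omega_red (m : nat) : C -> C :=
  match m with
  | O => fun _ => RtoC 1
  | S O => fun _ => RtoC 0
  | S (S m'' as m') => fun t =>
      - (serre (2 * INR m') (omega_red m') t + E4 t / 144 * omega_red m'' t) / (INR m' * (INR m' + 1))
  end.

Lemma omega_red_SS (m : nat) (t : C) : omega_red (S (S m)) t =
  - (serre (2 * INR (S m)) (omega_red (S m)) t + E4 t / 144 * omega_red m t) / (INR (S m) * (INR (S m) + 1)).
Proof. reflexivity. Qed.

Lemma INR_S_C_nz (m : nat) : RtoC (INR (S m)) <> 0 /\ INR (S m) + 1 <> 0.
Proof.
split.
- intros E. apply RtoC_inj in E. exact (INR_S_nz m E).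
- rewrite <- RtoC_plus, <- S_INR. intros E. apply RtoC_inj in E. exact (INR_S_nz (S m) E).
Qed.

Lemma omega_red_isobaric (m : nat) : isobaric (2 * m) (omega_red m).
Proof.
cut (isobaric (2 * m) (omega_red m) /\ isobaric (2 * S m) (omega_red (S m))); [tauto|].
induction m as [|m [IH1 IH2]].
- split; [exact (iso_const 1)|exact (iso_zero 2)].
- split; [exact IH2|]. destruct (isobaric_D _ _ IH2) as (h & Hh & Hd).
  destruct (INR_S_C_nz m) as [N1 N2].
  apply (iso_ext _ (fun t => (- (1) / (INR (S m) * (INR (S m) + 1))) * h t + (- (1) / (144 * (INR (S m) * (INR (S m) + 1)))) * (E4 t * omega_red m t))).
  + intros t Ht. rewrite omega_red_SS. unfold serre. rewrite (is_D_unique _ _ _ (Hd t Ht)).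
    rewrite (mult_INR 2 (S m)), RtoC_div, !RtoC_mult by lra. change (INR 2) with (1 + 1)%R. rewrite RtoC_plus. field. split; [exact N2|exact N1].
  + apply iso_lin; [replace (2 * S (S m))%nat with (2 + 2 * S m)%nat by lia; exact Hh|].
    apply (iso_E4 (2 * m)); [lia|exact IH1].
Qed.

(** The recursion solved for the derivative, with w_(-1) read as 0 so that m = 0 is included. *)
Lemma omega_red_D (m : nat) (t : C) : upper t -> is_D (omega_red m) t
  (- (INR m * (INR m + 1)) * omega_red (S m) t - E4 t / 144 * (match m with O => RtoC 0 | S m' => omega_red m' t end) - 2 * INR m * E2_scaled t * omega_red m t).
Proof.
intros Ht. destruct m as [|m].
- eapply is_D_eq; [apply is_D_const|]. simpl. field.
- destruct (isobaric_D _ _ (omega_red_isobaric (S m))) as (h & Hh & Hd).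
  eapply is_D_eq; [apply is_D_correct; eexists; exact (Hd t Ht)|].
  destruct (INR_S_C_nz m) as [N1 N2]. rewrite omega_red_SS. unfold serre, E2_scaled.
  rewrite RtoC_div, RtoC_mult by lra. field. split; [exact N2|exact N1].
Qed.

Definition divided_pow (s : nat) (t : C) : C := E2_scaled t ^ s / INR (fact s).

Lemma fact_C_nz (s : nat) : RtoC (INR (fact s)) <> 0.
Proof. intros E. apply RtoC_inj in E. exact (INR_fact_neq_0 s E). Qed.

Lemma divided_pow_S (s : nat) (t : C) : INR (S s) * divided_pow (S s) t = E2_scaled t * divided_pow s t.
Proof.
unfold divided_pow. rewrite fact_simpl, mult_INR, RtoC_mult. change (E2_scaled t ^ S s) with (E2_scaled t * E2_scaled t ^ s).
destruct (INR_S_C_nz s) as [N _]. assert (F := fact_C_nz s). field. split; assumption.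
Qed.

(** After division by s! the E4 part becomes E4/144 times the previous divided power, mirroring the
    term - E4/144 w_(m-1) in [omega_red_D]; the two cancel in [kk_coef_D]. *)
Lemma divided_pow_D (s : nat) (t : C) : upper t ->
  is_D (divided_pow s) t (- (INR s * E2_scaled t * divided_pow s t) + E4 t / 144 * (match s with O => RtoC 0 | S s' => divided_pow s' t end)).
Proof.
intros Ht. assert (F := fact_C_nz s).
apply (is_D_ext (fun w => / INR (fact s) * E2_scaled w ^ s)); [exact Ht|intros; unfold divided_pow, Cdiv; ring|].
eapply is_D_eq; [exact (is_D_scal _ _ _ _ (is_D_pow E2_scaled t _ s (E2_scaled_D t Ht)))|].
unfold divided_pow. destruct s as [|s].
- simpl. field.
- replace (S s - 1)%nat with s by lia. rewrite fact_simpl, mult_INR, RtoC_mult in *.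
  destruct (INR_S_C_nz s) as [N _]. assert (F' := fact_C_nz s). change (E2_scaled t ^ S s) with (E2_scaled t * E2_scaled t ^ s). simpl (E2_scaled t ^ 2). field. split; assumption.
Qed.

(** The coefficient of T^j in e^(x T) sum_m w_m T^m; up to a factor depending on n, k and j it is
    the coefficient of D^(n-j) f in the Kaneko-Koike operator. *)
Definition kk_coef (j : nat) (t : C) : C := csum (fun m => omega_red m t * divided_pow (j - m) t) j.

Lemma kk_coef_D (j : nat) (t : C) : upper t -> is_D (kk_coef j) t (- (INR j * (INR j + 1)) * kk_coef (S j) t).
Proof.
intros Ht.
eapply is_D_eq; [exact (is_D_csum (fun m t => omega_red m t * divided_pow (j - m) t) _ t j (fun m _ => is_D_mult _ _ _ _ _ (omega_red_D m t Ht) (divided_pow_D (j - m) t Ht)))|].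
cbv beta.
set (w := fun m => omega_red m t). set (x := E2_scaled t). set (v := fun s => divided_pow s t).
assert (Hv : forall s, x * v s = INR (S s) * v (S s)) by (intros s; symmetry; apply divided_pow_S).
(* The contributions of E4 cancel. *)
assert (HE4 : csum (fun m => w m * (match (j - m)%nat with O => RtoC 0 | S s' => v s' end)) j
   = csum (fun m => (match m with O => RtoC 0 | S m' => w m' end) * v (j - m)%nat) j).
{ destruct j as [|j].
  - rewrite !csum_0. simpl. ring.
  - rewrite csum_S, Nat.sub_diag.
    rewrite (csum_ext (fun m => (match m with O => RtoC 0 | S m' => w m' end) * v (S j - m)%nat)
       (fun m => match m with O => RtoC 0 | S m' => w m' * v (j - m')%nat end)).
    2:{ intros [|m] Hm; [ring|]. reflexivity. }
    rewrite csum_shift, Cmult_0_r, Cplus_0_r. apply csum_ext. intros m Hm.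
    replace (S j - m)%nat with (S (j - m)) by lia. reflexivity. }
assert (Hshift : csum (fun m => - (INR m * (INR m + 1)) * w (S m) * v (j - m)%nat) j =
   csum (fun m => - (INR m * (INR m - 1)) * w m * v (S j - m)%nat) (S j)).
{ rewrite <- csum_shift. apply csum_ext. intros [|m] Hm; [simpl; ring|].
  rewrite S_INR, RtoC_plus. replace (S j - S m)%nat with (j - m)%nat by lia. ring. }
(* x v_s = (s+1) v_(s+1) raises the order to j + 1, and 2 m + (j - m) = m + j. The added term m = j
   + 1 is zero. *)
assert (Hx : csum (fun m => - (2 * INR m + INR (j - m)) * w m * (x * v (j - m)%nat)) j =
   csum (fun m => - ((INR m + INR j) * (INR j + 1 - INR m)) * w m * v (S j - m)%nat) (S j)).
{ rewrite csum_S. replace (INR j + 1 - INR (S j)) with (RtoC 0) by (rewrite S_INR, RtoC_plus; ring).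
  transitivity (csum (fun m => - ((INR m + INR j) * (INR j + 1 - INR m)) * w m * v (S j - m)%nat) j); [|ring].
  apply csum_ext. intros m Hm. rewrite Hv. replace (S j - m)%nat with (S (j - m)) by lia.
  rewrite S_INR, minus_INR, RtoC_plus, RtoC_minus by exact Hm. ring. }
unfold kk_coef. rewrite <- csum_scal.
transitivity (csum (fun m => - (INR m * (INR m + 1)) * w (S m) * v (j - m)%nat) j
   + csum (fun m => - (2 * INR m + INR (j - m)) * w m * (x * v (j - m)%nat)) j
   + (E4 t / 144 * csum (fun m => w m * (match (j - m)%nat with O => RtoC 0 | S s' => v s' end)) j
   + - (E4 t / 144) * csum (fun m => (match m with O => RtoC 0 | S m' => w m' end) * v (j - m)%nat) j)).
- rewrite <- !csum_scal, <- !csum_plus. apply csum_ext. intros m Hm. fold x. fold (w m) (w (S m)) (v (j - m)%nat).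
  replace (match (j - m)%nat with O => RtoC 0 | S s' => divided_pow s' t end) with (match (j - m)%nat with O => RtoC 0 | S s' => v s' end) by reflexivity.
  replace (match m with O => RtoC 0 | S m' => omega_red m' t end) with (match m with O => RtoC 0 | S m' => w m' end) by reflexivity.
  ring.
- rewrite HE4, Hshift, Hx.
  match goal with |- ?a + ?b + (?c * ?e + - ?c * ?e) = _ => transitivity (a + b); [ring|] end.
  (* The coefficients combine to a constant: m (m - 1) + (m + j)(j + 1 - m) = j (j + 1). *)
  rewrite <- csum_plus. apply csum_ext. intros m Hm. fold (w m). fold (v (S j - m)%nat). ring.
Qed.

Lemma kk_coef_0 (t : C) : kk_coef 0 t = 1.
Proof. unfold kk_coef. rewrite csum_0. unfold divided_pow. simpl. field. Qed.

Lemma kk_coef_1 (t : C) : kk_coef 1 t = E2_scaled t.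
Proof. unfold kk_coef. rewrite csum_S, csum_0. unfold divided_pow. simpl. field. Qed.

Lemma E2_holomorphic : holomorphic E2.
Proof. intros t Ht. eexists. exact (E2_derive t Ht). Qed.

(** Starting from c_1 = - E2/12, each application of D divides by - j (j+1); these factors
    accumulate to the sign and the factorials. *)
Lemma kk_coef_S (j : nat) : forall t, upper t ->
  INR (S j) * (INR (fact j) * INR (fact j)) * kk_coef (S j) t = (- (1)) ^ S j / 12 * Diter j E2 t.
Proof.
induction j as [|j IH]; intros t Ht.
- rewrite kk_coef_1. unfold E2_scaled. simpl. field.
- assert (HD : is_D (fun t => / (INR (S j) * (INR (fact j) * INR (fact j))) * ((- (1)) ^ S j / 12 * Diter j E2 t)) t
     (- (INR (S j) * (INR (S j) + 1)) * kk_coef (S (S j)) t)).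
  { apply (is_D_ext (kk_coef (S j))); [exact Ht| |exact (kk_coef_D (S j) t Ht)].
    intros u Hu. rewrite <- (IH u Hu). destruct (INR_S_C_nz j) as [N _]. assert (F := fact_C_nz j). field. split; assumption. }
  assert (HD2 := is_D_scal (/ (INR (S j) * (INR (fact j) * INR (fact j)))) _ _ _
     (is_D_scal ((- (1)) ^ S j / 12) _ _ _ (Diter_D E2 j t E2_holomorphic Ht))).
  assert (E := is_D_unique _ _ _ HD). rewrite (is_D_unique _ _ _ HD2) in E.
  destruct (INR_S_C_nz j) as [N N']. assert (F := fact_C_nz j).
  rewrite fact_simpl, mult_INR, (S_INR (S j)), RtoC_plus, RtoC_mult.
  change ((- (1)) ^ S (S j)) with (- (1) * (- (1)) ^ S j).
  transitivity (- ((INR (S j) * (INR (fact j) * INR (fact j))) * (- (INR (S j) * (INR (S j) + 1)) * kk_coef (S (S j)) t))); [ring|].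
  rewrite <- E. field. split; assumption.
Qed.

(** One step of the recursion when w_(m+1) is known as a closed form g with derivative l; n/6 is the
    coefficient 2 n / 12 of the Serre derivative. *)
Lemma omega_red_step (m : nat) (n : R) (g : C -> C) (t l : C) : INR (S m) = n -> upper t ->
  (forall u, upper u -> omega_red (S m) u = g u) -> is_D g t l ->
  omega_red (S (S m)) t = - (l - n / 6 * E2 t * g t + E4 t / 144 * omega_red m t) / (n * (n + 1)).
Proof.
intros Hn Ht Hg Hl. rewrite omega_red_SS. unfold serre.
rewrite (is_D_unique (omega_red (S m)) t l) by (apply (is_D_ext g); [exact Ht|intros; symmetry; auto|exact Hl]).
rewrite (Hg t Ht), Hn, RtoC_div, RtoC_mult by lra. f_equal. f_equal. field.
Qed.

Lemma E4_E6_monomial_D (a b : nat) (t : C) : upper t -> is_D (fun t => E4 t ^ a * E6 t ^ b) t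
  (INR a * E4 t ^ (a - 1) * ((E2 t * E4 t - E6 t) / 3) * E6 t ^ b
   + E4 t ^ a * (INR b * E6 t ^ (b - 1) * ((E2 t * E6 t - E4 t ^ 2) / 2))).
Proof. intros Ht. exact (is_D_mult _ _ _ _ _ (is_D_pow E4 t _ a (E4_D t Ht)) (is_D_pow E6 t _ b (E6_D t Ht))). Qed.

Definition omega (m : nat) (t : C) : C := (INR (fact m) * INR (fact m)) * omega_red m t.

(** The denominators are those of omega_m multiplied by (m!)^2. *)
Lemma omega_red_values (t : C) : upper t ->
  omega_red 2 t = - E4 t / 288 /\ omega_red 3 t = - E6 t / 5184 /\ omega_red 4 t = - E4 t ^ 2 / 165888 /\
  omega_red 5 t = - (5 * E4 t * E6 t) / 37324800 /\
  omega_red 6 t = - (9 * E4 t ^ 3 + 16 * E6 t ^ 2) / 10749542400 /\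
  omega_red 7 t = - (35 * E4 t ^ 2 * E6 t) / 1053455155200 /\
  omega_red 8 t = - (117 * E4 t ^ 4 + 128 * E4 t * E6 t ^ 2) / 606790169395200.
Proof.
assert (H2 : forall t, upper t -> omega_red 2 t = - E4 t / 288).
{ intros u Hu. rewrite (omega_red_step 0 1 (fun _ => RtoC 0) u 0 eq_refl Hu (fun _ _ => eq_refl) (is_D_const 0 u)). simpl omega_red. field. }
assert (H3 : forall t, upper t -> omega_red 3 t = - E6 t / 5184).
{ intros u Hu. erewrite (omega_red_step 1 2 (fun t => - (1) / 288 * (E4 t ^ 1 * E6 t ^ 0)) u _ eq_refl Hu);
    [|intros v Hv; rewrite (H2 v Hv); field|apply is_D_scal, (E4_E6_monomial_D 1 0 u Hu)].
  simpl omega_red. simpl INR. simpl Nat.sub. simpl Cpow. field. }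
assert (H4 : forall t, upper t -> omega_red 4 t = - E4 t ^ 2 / 165888).
{ intros u Hu. erewrite (omega_red_step 2 3 (fun t => - (1) / 5184 * (E4 t ^ 0 * E6 t ^ 1)) u _ ltac:(simpl; ring) Hu);
    [|intros v Hv; rewrite (H3 v Hv); field|apply is_D_scal, (E4_E6_monomial_D 0 1 u Hu)].
  rewrite (H2 u Hu). simpl INR. simpl Nat.sub. simpl Cpow. field. }
assert (H5 : forall t, upper t -> omega_red 5 t = - (5 * E4 t * E6 t) / 37324800).
{ intros u Hu. erewrite (omega_red_step 3 4 (fun t => - (1) / 165888 * (E4 t ^ 2 * E6 t ^ 0)) u _ ltac:(simpl; ring) Hu);
    [|intros v Hv; rewrite (H4 v Hv); simpl; field|apply is_D_scal, (E4_E6_monomial_D 2 0 u Hu)].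
  rewrite (H3 u Hu). simpl INR. rewrite ?RtoC_plus. simpl Nat.sub. simpl Cpow. field. }
assert (H6 : forall t, upper t -> omega_red 6 t = - (9 * E4 t ^ 3 + 16 * E6 t ^ 2) / 10749542400).
{ intros u Hu. erewrite (omega_red_step 4 5 (fun t => - (5) / 37324800 * (E4 t ^ 1 * E6 t ^ 1)) u _ ltac:(simpl; ring) Hu);
    [|intros v Hv; rewrite (H5 v Hv); simpl; field|apply is_D_scal, (E4_E6_monomial_D 1 1 u Hu)].
  rewrite (H4 u Hu). simpl INR. rewrite ?RtoC_plus. simpl Nat.sub. simpl Cpow. field. }
assert (H7 : forall t, upper t -> omega_red 7 t = - (35 * E4 t ^ 2 * E6 t) / 1053455155200).
{ intros u Hu. erewrite (omega_red_step 5 6 (fun t => - (9) / 10749542400 * (E4 t ^ 3 * E6 t ^ 0) + - (16) / 10749542400 * (E4 t ^ 0 * E6 t ^ 2)) u _ ltac:(simpl; ring) Hu);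
    [|intros v Hv; rewrite (H6 v Hv); simpl; field
     |apply (is_D_plus (fun t => - (9) / 10749542400 * (E4 t ^ 3 * E6 t ^ 0))); apply is_D_scal; [apply (E4_E6_monomial_D 3 0 u Hu)|apply (E4_E6_monomial_D 0 2 u Hu)]].
  rewrite (H5 u Hu). simpl INR. rewrite ?RtoC_plus. simpl Nat.sub. simpl Cpow. field. }
assert (H8 : forall t, upper t -> omega_red 8 t = - (117 * E4 t ^ 4 + 128 * E4 t * E6 t ^ 2) / 606790169395200).
{ intros u Hu. erewrite (omega_red_step 6 7 (fun t => - (35) / 1053455155200 * (E4 t ^ 2 * E6 t ^ 1)) u _ ltac:(simpl; ring) Hu);
    [|intros v Hv; rewrite (H7 v Hv); simpl; field|apply is_D_scal, (E4_E6_monomial_D 2 1 u Hu)].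
  rewrite (H6 u Hu). simpl INR. rewrite ?RtoC_plus. simpl Nat.sub. simpl Cpow. field. }
intros Ht. repeat split; auto.
Qed.

Lemma omega_values (t : C) : upper t ->
  omega 0 t = 1 /\ omega 1 t = 0 /\ omega 2 t = - E4 t / 72 /\ omega 3 t = - E6 t / 144 /\
  omega 4 t = - E4 t ^ 2 / 288 /\ omega 5 t = - (5 * E4 t * E6 t) / 2592 /\
  omega 6 t = - (9 * E4 t ^ 3 + 16 * E6 t ^ 2) / 20736 /\
  omega 7 t = - (35 * E4 t ^ 2 * E6 t) / 41472 /\
  omega 8 t = - (117 * E4 t ^ 4 + 128 * E4 t * E6 t ^ 2) / 373248.
Proof.
intros Ht. destruct (omega_red_values t Ht) as (H2 & H3 & H4 & H5 & H6 & H7 & H8).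
assert (Hf : forall n, INR (fact n) = IZR (Z.of_nat (fact n))) by (intros; apply INR_IZR_INZ).
unfold omega. rewrite H2, H3, H4, H5, H6, H7, H8, !Hf.
change (Z.of_nat (fact 0)) with 1%Z. change (Z.of_nat (fact 1)) with 1%Z. change (Z.of_nat (fact 2)) with 2%Z.
change (Z.of_nat (fact 3)) with 6%Z. change (Z.of_nat (fact 4)) with 24%Z. change (Z.of_nat (fact 5)) with 120%Z.
change (Z.of_nat (fact 6)) with 720%Z. change (Z.of_nat (fact 7)) with 5040%Z. change (Z.of_nat (fact 8)) with 40320%Z.
simpl omega_red. repeat split; field.
Qed.

Lemma omega_modular (m : nat) : modular_form (2 * m) (omega m).
Proof.
apply isobaric_modular. apply (iso_ext _ (fun t => (INR (fact m) * INR (fact m)) * omega_red m t + 0 * omega_red m t)).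
- intros t _. unfold omega. ring.
- apply iso_lin; apply omega_red_isobaric.
Qed.

(** Trinomial revision is applied to both binomials; the factors C(r+s, r) and (k+r)_s that it
    splits off are those of [serre_coef]. With n = r + m + s, the right side depends on m only
    through m + s = n - r and s!, so the sum over m leaves exactly c_(n-r). *)
Lemma kk_coefficient (k : R) (r s m : nat) :
  (binom (INR (r + (m + s))) m * binom (k + INR (r + (m + s)) - 1) m * (INR (fact m) * INR (fact m))
    * serre_coef k (r + s) r
  = binom (INR (r + (m + s))) (m + s) * binom (k + INR (r + (m + s)) - 1) (m + s)
    * (INR (fact (m + s)) * INR (fact (m + s))) * / INR (fact s))%R.
Proof.
unfold serre_coef. replace (r + s - r)%nat with s by lia.
assert (F := INR_fact_neq_0 s).
assert (B1 := binom_trinomial_revision (INR (r + (m + s))) m s).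
assert (B2 := binom_trinomial_revision (k + INR (r + (m + s)) - 1) m s).
replace (INR (r + (m + s)) - INR m)%R with (INR (r + s)) in B1 by (rewrite !plus_INR; ring).
replace (k + INR (r + (m + s)) - 1 - INR m)%R with (k + INR r + INR s - 1)%R in B2 by (rewrite !plus_INR; ring).
rewrite binom_pochhammer in B2. rewrite <- (binom_sym r s) in B1.
transitivity ((binom (INR (r + (m + s))) (m + s) * INR (fact (m + s))) * (binom (k + INR (r + (m + s)) - 1) (m + s) * INR (fact (m + s))) * / INR (fact s))%R; [|ring].
rewrite B1, B2. field. exact F.
Qed.

Lemma kk_rhs (k : R) (n : nat) (f : C -> C) (t : C) :
  csum (fun m => binom (INR n) m * binom (k + INR n - 1)%R m * omega m t * serre_sum k (n - m) f t) n
  = csum (fun r => (binom (INR n) (n - r) * binom (k + INR n - 1) (n - r) * (INR (fact (n - r)) * INR (fact (n - r))))%R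
      * kk_coef (n - r) t * Diter r f t) n.
Proof.
unfold serre_sum.
rewrite (csum_ext _ (fun m => csum (fun r => binom (INR n) m * binom (k + INR n - 1)%R m * omega m t *
   (serre_coef k (n - m) r * E2_scaled t ^ (n - m - r) * Diter r f t)) (n - m))) by (intros; now rewrite csum_scal).
rewrite csum_triangle. apply csum_ext. intros r Hr.
rewrite <- Cmult_assoc, (Cmult_comm (kk_coef _ _)), Cmult_assoc. unfold kk_coef. rewrite <- csum_scal.
apply csum_ext. intros m Hm. unfold omega, divided_pow.
set (s := (n - r - m)%nat). replace (n - m - r)%nat with s by lia.
replace (n - m)%nat with (r + s)%nat by lia. replace (n - r)%nat with (m + s)%nat by lia.
replace n with (r + (m + s))%nat by lia.
assert (E := kk_coefficient k r s m). apply (f_equal RtoC) in E. rewrite !RtoC_mult, RtoC_inv in E by apply INR_fact_neq_0.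
unfold Cdiv. rewrite !RtoC_mult.
transitivity (RtoC (binom (INR (r + (m + s))) m) * RtoC (binom (k + INR (r + (m + s)) - 1) m) *
   (INR (fact m) * INR (fact m)) * serre_coef k (r + s) r * (omega_red m t * E2_scaled t ^ s * Diter r f t)); [ring|].
rewrite E. ring.
Qed.

Lemma Cm1_pow (n : nat) : RtoC ((-1) ^ n) = (- (1)) ^ n.
Proof. rewrite RtoC_pow. f_equal. apply injective_projections; simpl; ring. Qed.

Lemma kk_lhs (k : R) (n : nat) (f : C -> C) (t : C) : upper t ->
  kaneko_koike k n f t = csum (fun r => (binom (INR n) (n - r) * binom (k + INR n - 1) (n - r) * (INR (fact (n - r)) * INR (fact (n - r))))%R
      * kk_coef (n - r) t * Diter r f t) n.
Proof.
intros Ht. destruct n as [|N].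
- rewrite csum_0. cbn [Nat.sub fact]. rewrite kk_coef_0. simpl. rewrite !Rmult_1_r. ring.
(* The term r = n is D^n f, since c_0 = 1; all other terms are matched with the Rankin-Cohen bracket
   of order N = n - 1. *)
- cbn [kaneko_koike]. unfold rankin_cohen. rewrite sum_n_csum, csum_S, Nat.sub_diag, kk_coef_0.
  replace (binom (INR (S N)) 0 * binom (k + INR (S N) - 1) 0 * (INR (fact 0) * INR (fact 0)))%R with 1%R by (simpl; ring).
  rewrite <- csum_scal. unfold Cminus. rewrite Cplus_comm.
  replace (- csum (fun i => ((k + INR (S N) - 1) / 12)%R * (((-1) ^ (N - i) * binom (INR N + k - 1) (N - i) * binom (INR N + 2 - 1) i)%R * Diter i f t * Diter (N - i) E2 t)) N)
    with (csum (fun i => - (1) * (((k + INR (S N) - 1) / 12)%R * (((-1) ^ (N - i) * binom (INR N + k - 1) (N - i) * binom (INR N + 2 - 1) i)%R * Diter i f t * Diter (N - i) E2 t))) N) by (rewrite csum_scal; ring).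
  f_equal; [|ring]. apply csum_ext. intros r Hr.
  set (j := (N - r)%nat). replace (S N - r)%nat with (S j) by lia.
  assert (ES := kk_coef_S j t Ht).
  (* Absorption: the prefactor k + n - 1 of the bracket turns C(k+n-2, j) into (j+1) C(k+n-1,
     j+1). *)
  assert (B1 := binom_S_top' (k + INR (S N) - 1) j).
  replace (k + INR (S N) - 1 - 1)%R with (INR N + k - 1)%R in B1 by (rewrite S_INR; ring).
  assert (B2 : binom (INR N + 2 - 1) r = binom (INR (S N)) (S j)).
  { replace (INR N + 2 - 1)%R with (INR (S N)) by (rewrite S_INR; ring).
    replace (S N) with (r + S j)%nat by lia. apply binom_sym. }
  rewrite B2. rewrite fact_simpl, mult_INR.
  apply (f_equal RtoC) in B1. rewrite !RtoC_mult in B1.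
  rewrite RtoC_div by lra. rewrite !RtoC_mult, Cm1_pow.
  change ((- (1)) ^ S j) with (- (1) * (- (1)) ^ j) in ES.
  transitivity (binom (INR (S N)) (S j) * (RtoC (k + INR (S N) - 1) * RtoC (binom (INR N + k - 1) j)) *
     (- (1) * (- (1)) ^ j / 12 * Diter j E2 t) * Diter r f t); [field|].
  rewrite <- B1, <- ES. ring.
Qed.

Theorem theorem1 :
  (forall (f : C -> C) (k n : nat), holomorphic f ->
     forall tau, upper tau ->
       canonical_serre (INR k) n f tau
       = sum_n (fun r =>
           binom (INR n) r * pochhammer (INR k + INR r) (n - r)
           * (- E2 tau / 12) ^ (n - r) * Diter r f tau) n)
  /\
  (exists omega : nat -> C -> C,
     (forall m : nat, modular_form (2 * m) (omega m)) /\
     (forall tau, upper tau ->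
        omega 0%nat tau = 1 /\
        omega 1%nat tau = 0 /\
        omega 2%nat tau = - E4 tau / 72 /\
        omega 3%nat tau = - E6 tau / 144 /\
        omega 4%nat tau = - E4 tau ^ 2 / 288 /\
        omega 5%nat tau = - (5 * E4 tau * E6 tau) / 2592 /\
        omega 6%nat tau = - (9 * E4 tau ^ 3 + 16 * E6 tau ^ 2) / 20736 /\
        omega 7%nat tau = - (35 * E4 tau ^ 2 * E6 tau) / 41472 /\
        omega 8%nat tau
        = - (117 * E4 tau ^ 4 + 128 * E4 tau * E6 tau ^ 2) / 373248) /\
     (forall (f : C -> C) (k n : nat), holomorphic f ->
        forall tau, upper tau ->
          kaneko_koike (INR k) n f tau
          = sum_n (fun m =>
              binom (INR n) m * binom (INR k + INR n - 1)%R m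
              * omega m tau * canonical_serre (INR k) (n - m) f tau) n)).
Proof.
split.
- intros f k n Hf tau Ht. rewrite (canonical_serre_sum f (INR k) Hf n tau Ht), sum_n_csum.
  apply csum_ext. intros r Hr. unfold serre_coef. rewrite RtoC_mult. reflexivity.
- exists omega. split; [exact omega_modular|]. split; [exact omega_values|].
  intros f k n Hf tau Ht. rewrite sum_n_csum, (kk_lhs (INR k) n f tau Ht), <- kk_rhs.
  apply csum_ext. intros m Hm. now rewrite (canonical_serre_sum f (INR k) Hf (n - m) tau Ht).
Qed.
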